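(* Let $R$ be a commutative Noetherian ring with $1\neq 0$ such that every nonzero proper ideal of $R$ is a vertex of $\mathbb{AG}(R)$. If $0<\gamma(\mathbb{AG}(R))<\infty$, then $R$ is an Artinian ring with only finitely many ideals.
   Context: Annihilating-ideal graph: an ideal $I$ of a commutative ring $R$ is an annihilating-ideal if there is a nonzero ideal $J$ of $R$ with $IJ=(0)$. The annihilating-ideal graph $\mathbb{AG}(R)$ is the simple undirected graph whose vertices are the nonzero annihilating-ideals of $R$, two distinct vertices $I\neq J$ being adjacent if and only if $IJ=(0)$. Genus: $S_k$ denotes the oriented surface of genus $k$ (the sphere with $k$ handles), $k\ge 0$. The genus $\gamma(G)$ of a graph $G$ is the minimal integer $n\geq 0$ such that $G$ can be embedded in $S_n$ (i.e. drawn in $S_n$ so that edges intersect only at common vertices). An infinite graph $G$ has infinite genus, $\gamma(G)=\infty$, if for every natural number $n$ there is a finite subgraph $G_n$ of $G$ with $\gamma(G_n)=n$. *)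

(* Defs.v *)
From mathcomp Require Import all_boot all_order all_algebra.
From mathcomp Require Import all_classical all_reals all_analysis.
Set Implicit Arguments.
Unset Strict Implicit.
Unset Printing Implicit Defensive.
Import Order.TTheory GRing.Theory Num.Theory.
Import numFieldNormedType.Exports.
Local Open Scope classical_set_scope.
Local Open Scope ring_scope.

Definition is_ideal (R : comNzRingType) (I : set R) : Prop :=
  [/\ I 0,
      forall x y, I x -> I y -> I (x + y) &
      forall a x, I x -> I (a * x)].

Definition ideal_mul (R : comNzRingType) (I J : set R) : set R :=
  [set x | exists2 s : seq (R * R),
     (forall p, p \in s -> I p.1 /\ J p.2) & x = \sum_(p <- s) p.1 * p.2].

Definition noetherian (R : comNzRingType) : Prop :=
  forall I : nat -> set R,
    (forall n, is_ideal (I n)) -> (forall n, I n `<=` I n.+1) ->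
    exists N, forall n, (N <= n)%N -> I n = I N.

Definition artinian (R : comNzRingType) : Prop :=
  forall I : nat -> set R,
    (forall n, is_ideal (I n)) -> (forall n, I n.+1 `<=` I n) ->
    exists N, forall n, (N <= n)%N -> I n = I N.

(* The vertices form a subset of an ambient type, so that a subgraph lives on
   the same type. *)
Record sgraph (T : Type) := SGraph {
  verts : set T;
  adj : T -> T -> Prop;
  adj_vertsl : forall u v, adj u v -> verts u;
  adj_sym : forall u v, adj u v -> adj v u;
  adj_irrefl : forall u, ~ adj u u }.

Definition subgraph (T : Type) (H G : sgraph T) : Prop :=
  verts H `<=` verts G /\ forall u v, adj H u v -> adj G u v.

Definition annihilating_ideal (R : comNzRingType) (I : set R) : Prop :=
  is_ideal I /\
  exists J : set R, [/\ is_ideal J, J <> [set 0] & ideal_mul I J = [set 0]].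

Definition AG_verts (R : comNzRingType) : set (set R) :=
  [set I | annihilating_ideal I /\ I <> [set 0]].

Definition AG_adj (R : comNzRingType) (I J : set R) : Prop :=
  [/\ AG_verts I, AG_verts J, I <> J & ideal_mul I J = [set 0]].

Lemma ideal_mulC (R : comNzRingType) (I J : set R) :
  ideal_mul I J = ideal_mul J I.
Proof.
suff le (A B : set R) : ideal_mul A B `<=` ideal_mul B A by apply/seteqP; split.
move=> x [s sAB ->]; exists [seq (p.2, p.1) | p <- s].
  by move=> _ /mapP[p /sAB[Ap Bp] ->].
by rewrite big_map; apply: eq_bigr => p _; rewrite mulrC.
Qed.

Lemma AG_adj_vertsl (R : comNzRingType) (I J : set R) :
  AG_adj I J -> AG_verts I.
Proof. by case. Qed.

Lemma AG_adj_sym (R : comNzRingType) (I J : set R) : AG_adj I J -> AG_adj J I.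
Proof. by case=> VI VJ nIJ IJ0; split; rewrite 1?ideal_mulC //; apply/nesym. Qed.

Lemma AG_adj_irrefl (R : comNzRingType) (I : set R) : ~ AG_adj I I.
Proof. by case. Qed.

Definition AG (R : comNzRingType) : sgraph (set R) :=
  SGraph (@AG_adj_vertsl R) (@AG_adj_sym R) (@AG_adj_irrefl R).

(* The closed oriented surface of genus g, realised in 3-space.  The right-hand
   side is nonnegative exactly on the closed disc of radius 4g+1 about the
   origin with the g disjoint open unit discs centred at (4i, 0), i < g,
   removed.  The surface is the double of that region along its boundary: the
   boundary of a ball pierced by g tunnels, i.e. the sphere with g handles (for
   g = 0 it is the unit sphere). *)
Definition surface (K : realType) (g : nat) : set (K * K * K) :=
  [set p | let x := p.1.1 in let y := p.1.2 in let z := p.2 in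
     z ^+ 2 = ((4 * g + 1)%:R ^+ 2 - x ^+ 2 - y ^+ 2)
              * \prod_(i < g) ((x - (4 * i)%:R) ^+ 2 + y ^+ 2 - 1)].

Definition is_arc (K : realType) (a b : K * K * K) (A : set (K * K * K)) :
    Prop :=
  exists f : K -> K * K * K,
    [/\ {within `[0, 1], continuous f}, set_inj `[0, 1] f,
        f 0 = a, f 1 = b & A = f @` `[0, 1]].

(* Nothing is required beyond the pairwise intersection conditions; for an
   infinite graph the drawing need not be a homeomorphic embedding of a
   1-dimensional complex. *)
Definition is_drawing (K : realType) (T : Type) (G : sgraph T)
    (S : set (K * K * K)) (pos : T -> K * K * K)
    (edge : T -> T -> set (K * K * K)) : Prop :=
  [/\ (forall u, verts G u -> S (pos u)) /\ set_inj (verts G) pos,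
      forall u v, adj G u v ->
        [/\ is_arc (pos u) (pos v) (edge u v),
            edge u v `<=` S & edge v u = edge u v],
      forall u v w, adj G u v -> verts G w -> edge u v (pos w) ->
        w = u \/ w = v &
      forall u v u' v', adj G u v -> adj G u' v' ->
        [set u; v] <> [set u'; v'] ->
        edge u v `&` edge u' v' `<=` pos @` ([set u; v] `&` [set u'; v'])].

Definition embeddable (K : realType) (T : Type) (G : sgraph T) (g : nat) :
    Prop :=
  exists pos edge, is_drawing G (@surface K g) pos edge.

Definition has_genus (K : realType) (T : Type) (G : sgraph T) (n : nat) :
    Prop :=
  embeddable K G n /\ forall m, embeddable K G m -> (n <= m)%N.

Definition has_infinite_genus (K : realType) (T : Type) (G : sgraph T) : Prop :=
  infinite_set (verts G) /\
  forall n, exists H : sgraph T,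
    [/\ subgraph H G, finite_set (verts H) & has_genus K H n].

(* Hence "the genus is finite and equal to n" needs no hypothesis besides
   [has_genus]. *)
Lemma has_genus_not_infinite (K : realType) (T : Type) (G : sgraph T) (n : nat) :
  has_genus K G n -> ~ has_infinite_genus K G.
Proof.
move=> [[pos [edge [[posS pos_inj] arcs noV noE]]] _] [_ /(_ n.+1)].
move=> [H [[sV sE] _ [_ /(_ n)]]]; rewrite ltnn => minH.
suff /minH : embeddable K H n by [].
exists pos, edge; split.
- split=> [u /sV|u v]; first exact: posS.
  by rewrite !inE => /sV Vu /sV Vv; apply: pos_inj; rewrite inE.
- by move=> u v /sE; apply: arcs.
- by move=> u v w /sE uv /sV; apply: noV.
- by move=> u v u' v' /sE uv /sE; apply: noE.
Qed.

(* Main.v *)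
Require Import Defs.
From mathcomp Require Import all_boot all_order all_algebra zify ring lra.
From mathcomp Require Import all_classical all_reals all_analysis.
Set Implicit Arguments.
Unset Strict Implicit.
Unset Printing Implicit Defensive.
Import Order.TTheory GRing.Theory Num.Theory.
Import numFieldNormedType.Exports.

(** Descending chains inside a finite set of ideals are stationary, so the point
is that R has finitely many ideals.  Suppose it has infinitely many.  By
minimality of the genus n > 0, the graph AG(R) is drawn in the surface of genus
n but has no drawing in the sphere.  The proof confronts this with the ideal
theory of R, through two kinds of statements about drawings.

Obstructions in a surface of genus g.  No drawing contains three vertices that
are all adjacent to the same infinitely many vertices ([no_infinite_K3]); nor
the same with the edges at the third vertex subdivided ([no_subdivided_K3]);
nor two vertices with uncountably many common neighbours t, each of which has a
further neighbour w of its own ([countable_triods]: infinitely many of the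
points w fall in one small disc or arc that avoids the edges from the two
vertices to their t, and this disc acts as the third vertex).  All of them come from [no_bipartite_continua]: the
surface does not contain K_(3,N), for N large, with vertices and edges fattened
to continua.  To see this, approximate the surface by a finite cell complex
made of four rectangular sheets glued along finitely many seams, in which
points close to each other are linked by short walks; continua become connected
sets of vertices.  In such a complex a count modulo 2 replaces the Euler formula
([bounded_bipartite_minor]): K_(3,N) has 2 ^ (2N - 2) cycles, and up to one
parity per seam each of them bounds a union of faces.  The indecomposable unions
in question have at least four of the 3N edges on their boundary, and an edge
lies on at most two of them, so there are at most 3N/2 of them; hence 2N - 2 is
at most 3N/2 plus the number of seams.

Drawings in the sphere.  If the edges that avoid one vertex form a matching, or
if those that avoid two vertices form a countable matching, then the graph can
be drawn in the sphere: place the vertices in the plane on parallel lines, or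
on one line, and send the first vertex to infinity by stereographic projection
([one_pole_embeddable], [two_poles_embeddable]).

Ideals.  If R has two maximal ideals M1 and M2, then three nonzero ideals kill
the intersection of M1 and M2, which therefore contains finitely many ideals;
but an ideal is determined by its trace on that intersection and two bits
([nonlocal_finite]).  So let R be local with maximal ideal m and let S be the
annihilator of m.

If m is not nilpotent, at most two nonzero ideals are killed by a power of m
(else infinitely many powers of m have three killers), and every edge contains
one of them (if I J = 0 with both outside, infinitely many m^i I are killed by
three m^j J), so AG(R) is planar ([not_nilpotent_False]).

If m is nilpotent, R/m is infinite, as otherwise R would be finite.  Then S is
simple, as otherwise infinitely many lines of S would kill one another.  Let Z
be the annihilator of m^2 and d the dimension of Z/S over R/m.  For d = 1 the ideals are the annihilators of the
powers of one element ([rank_one_finite]).  For d > 2 infinitely many lines of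
Z are killed by S and by an element x1 of m, and each is joined by a path of
length two to a further ideal x2 R ([no_independent_triple]).  For d = 2 and
m^3 = 0, the edges that avoid S join a line of m to its orthogonal
([cube_zero_False]).  For d = 2 and m^3 nonzero, put J = m^2; the edges that
avoid S and J form a matching between the ideals inside Z and the ideals not
inside Z, countable by [countable_triods], so that again AG(R) is planar
([cube_nonzero_False]). *)

(** * Walks and mod 2 chains in a finite multigraph *)

Section Chains.
Variables (V E : finType) (d0 d1 : E -> V).
Implicit Types (x y v : V) (e : E) (Z : E -> bool).

Definition incident e v := (d0 e == v) (+) (d1 e == v).

Definition degree_parity Z v := \big[addb/false]_e (Z e && incident e v).

Definition joins x y e :=
  (d0 e == x) && (d1 e == y) || (d0 e == y) && (d1 e == x).

Definition neighbour x y := [exists e, joins x y e].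

(** Several edges may join x and y; a walk uses the edge picked here, so that a
sequence of vertices determines a chain of edges. *)
Definition link x y := [pick e | joins x y e].

Definition neighbour_in (X : {set V}) x y :=
  [&& x \in X, y \in X & neighbour x y].

Fixpoint walk_chain x p e :=
  if p is y :: p' then (link x y == Some e) (+) walk_chain y p' e else false.

Lemma joinsC x y e : joins x y e = joins y x e.
Proof. by rewrite /joins orbC. Qed.

Lemma neighbourC x y : neighbour x y = neighbour y x.
Proof. by apply: eq_existsb => e; rewrite joinsC. Qed.

Lemma joins_link x y : neighbour x y -> exists2 e, link x y = Some e & joins x y e.
Proof.
rewrite /link; case: pickP => [e je _|no /existsP[e]]; first by exists e.
by rewrite no.
Qed.

Lemma linkP x y e : link x y = Some e -> joins x y e.
Proof. by rewrite /link; case: pickP => // e' ? [<-]. Qed.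

Lemma incident_joins x y e v : joins x y e -> incident e v = (x == v) (+) (y == v).
Proof.
by rewrite /incident => /orP[] /andP[/eqP-> /eqP->] //; rewrite addbC.
Qed.

Lemma degree_parityD Z Z' v :
  degree_parity (fun e => Z e (+) Z' e) v =
  degree_parity Z v (+) degree_parity Z' v.
Proof.
rewrite /degree_parity -big_split /=; apply: eq_bigr => e _.
by rewrite andb_addl.
Qed.

Lemma sum_pred1 (T : finType) (P : pred T) a :
  \big[addb/false]_(e : T) ((e == a) && P e) = P a.
Proof.
rewrite (bigD1 a) //= eqxx big1 ?addbF // => e /negbTE->.
by [].
Qed.

(** Modulo 2 the boundary of a walk consists of its two ends, even if the walk
repeats edges. *)
Lemma walk_chain_boundary x p v : path neighbour x p ->
  degree_parity (walk_chain x p) v = (x == v) (+) (last x p == v).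
Proof.
elim: p x => [|y p IH] x /=.
  by rewrite addbb /degree_parity big1.
case/andP=> /joins_link[e le je] /IH IHy.
rewrite degree_parityD IHy /degree_parity le.
rewrite (eq_bigr (fun e' => (e' == e) && incident e' v)); last first.
  by move=> e' _; rewrite (inj_eq Some_inj) eq_sym.
rewrite sum_pred1 (incident_joins _ je).
by case: (x == v); case: (y == v); case: (last y p == v).
Qed.

Lemma degree_parity_sum Z (P : pred V) :
  \big[addb/false]_(v | P v) degree_parity Z v =
  \big[addb/false]_e (Z e && (P (d0 e) (+) P (d1 e))).
Proof.
rewrite exchange_big /=; apply: eq_bigr => e _.
have one a : \big[addb/false]_(v | P v) (a == v) = P a.
  rewrite big_mkcond -[RHS](sum_pred1 P); apply: eq_bigr => v _.
  by rewrite eq_sym; case: (P v); rewrite ?andbT ?andbF.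
rewrite -!one -big_split /= big_distrr /=.
by apply: eq_bigr.
Qed.

Lemma connect_in_walk X x y : connect (neighbour_in X) x y ->
  exists p, [/\ path neighbour x p, last x p = y & {subset p <= X}].
Proof.
case/connectP=> p px ->; exists p; split=> //.
  by apply: sub_path px => a b /and3P[].
elim: p x px => // a p IH x /= /andP[/and3P[_ aX _] /IH pX] z.
by rewrite inE => /predU1P[->|/pX].
Qed.

Lemma joins_ends x y e : joins x y e -> d0 e \in [:: x; y] /\ d1 e \in [:: x; y].
Proof. by case/orP=> /andP[/eqP<- /eqP<-]; rewrite !inE !eqxx ?orbT. Qed.

Lemma walk_chain_ends x p e : walk_chain x p e ->
  d0 e \in x :: p /\ d1 e \in x :: p.
Proof.
elim: p x => // y p IH x /=.
case: eqP => [le|_] /=; last first.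
  by case/IH=> h0 h1; rewrite !(in_cons x) h0 h1 !orbT.
case: (joins_ends (linkP le)) => d0e d1e _.
by move: d0e d1e; rewrite !inE => /orP[]-> /orP[]->; rewrite ?orbT.
Qed.

Lemma path_chain_eq0 p x Z : path neighbour x p -> uniq (x :: p) ->
  (forall e, Z e -> walk_chain x p e) ->
  (forall v, v \in belast x p -> degree_parity Z v = false) ->
  forall e, Z e = false.
Proof.
elim: p x => [|y p IH] x; first by move=> _ _ sZ _ e; apply/negP => /sZ.
move=> /= /andP[/joins_link[e1 le je] py] /andP[xyp uyp] sZ dZ.
have Ze1 : Z e1 = false.
  rewrite -(dZ x) ?mem_head // /degree_parity.
  rewrite -(sum_pred1 Z); apply: eq_bigr => e _.
  case: eqP => [->|/eqP ne] /=.
    rewrite (incident_joins _ je) eqxx eq_sym; case: eqP xyp => [->|_ _].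
      by rewrite mem_head.
    by rewrite andbT.
  case Ze: (Z e) => //=; have := sZ _ Ze; rewrite /= le.
  rewrite (inj_eq Some_inj) eq_sym (negbTE ne) /= => /walk_chain_ends[] d0e d1e.
  rewrite /incident; case: eqP d0e xyp => [->->//|_ _].
  by case: eqP d1e => [->->|].
apply: (IH y) => // [e Ze|v vb]; last by apply: dZ; rewrite inE vb orbT.
have := sZ _ Ze; rewrite /= le; case: eqP => [[E1]|//].
by rewrite E1 Ze in Ze1.
Qed.

(** Along a path without repetition every inner vertex has degree two, so a chain
supported on the path with no boundary at the inner vertices is constant. *)
Lemma path_chain_const p x Z : path neighbour x p -> uniq (x :: p) ->
  (forall e, Z e -> walk_chain x p e) ->
  (forall v, v \in p -> v != last x p -> degree_parity Z v = false) ->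
  forall e, Z e = degree_parity Z x && walk_chain x p e.
Proof.
move=> px up sZ dZ e; set c := degree_parity Z x.
have cD v : degree_parity (fun e => c && walk_chain x p e) v =
            c && ((x == v) (+) (last x p == v)).
  rewrite -(walk_chain_boundary v px) /degree_parity big_distrr /=.
  by apply: eq_bigr => ? _; rewrite andbA.
suff : Z e (+) (c && walk_chain x p e) = false.
  by case: (Z e); case: (_ && _).
apply: (@path_chain_eq0 p x (fun e => Z e (+) (c && walk_chain x p e)) px up).
  move=> e'; case: (walk_chain x p e') (sZ e') => //.
  by rewrite andbF addbF.
move=> v vb; move: (up); rewrite lastI rcons_uniq => /andP[lb _].
have vl : v != last x p by apply: contraNneq lb => <-.
rewrite degree_parityD cD [last x p == v]eq_sym (negbTE vl) addbF.
case: eqVneq => [<-|xv]; first by rewrite andbT addbb.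
rewrite andbF dZ //; move: (mem_belast vb).
by rewrite inE eq_sym (negbTE xv).
Qed.

(** Shortening a walk until it leaves A only at its start and reaches B only at its
end; this makes the edges of the minor below meet the blobs at single
vertices. *)
Lemma thin_path (A B M : {set V}) a b : [disjoint A & B] ->
  a \in A :&: M -> b \in B :&: M -> connect (neighbour_in M) a b ->
  exists x p, [/\ path neighbour x p, uniq (x :: p), {subset x :: p <= M},
    x \in A & last x p \in B] /\
    ({in p, forall y, y \notin A} /\ {in belast x p, forall y, y \notin B}).
Proof.
move=> AB /setIP[aA aM] /setIP[bB bM] /connect_in_walk[p [pa lb pM]].
have aM' : {subset a :: p <= M}.
  by move=> z; rewrite inE => /predU1P[->//|/pM].
rewrite -lb in bB; move: aA bB pa aM' {aM bM pM lb b}.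
have [n] := ubnP (size p); elim: n a p => // n IH a p; rewrite ltnS => sp.
move=> aA lB pa pM.
case: (shortenP pa) lB => p' pa' up' sub lB.
have szp : (size p' <= size p)%N.
  by apply: uniq_leq_size => //; case/andP: up'.
have pM' : {subset a :: p' <= M}.
  move=> z; rewrite inE => /predU1P[->|/sub zp]; first by rewrite pM ?mem_head.
  by rewrite pM // inE zp orbT.
have [/hasP[y yp yA]|/hasPn pA] := boolP (has (mem A) p').
  case/splitPr def_p : p' / yp => [p1 p2] in szp pa' pM' lB.
  apply: (IH y p2) => //.
  - by rewrite (leq_trans _ sp) // (leq_trans _ szp) // size_cat /= addnS ltnS leq_addl.
  - by rewrite last_cat in lB.
  - by move: pa'; rewrite cat_path /= => /and3P[].
  - by move=> z zp; apply: pM'; rewrite inE mem_cat zp !orbT.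
have [/hasP[y yp yB]|/hasPn pB] := boolP (has (mem B) (belast a p')); last first.
  by exists a, p'; split=> //; split.
have yap : y \in a :: p' by exact: mem_belast.
case/splitPl def_p : p' / yap => [p1 p2 l1] in szp pa' pM' lB up' yp.
have p20 : p2 != [::].
  apply: contraTneq yp => p20; move: up'; rewrite p20 cats0 lastI rcons_uniq l1.
  by case/andP.
apply: (IH a p1) => //.
- rewrite (leq_trans _ sp) // (leq_trans _ szp) // size_cat.
  by rewrite -[X in (X < _)%N]addn0 ltn_add2l; case: p2 p20 {def_p szp pa' pM' lB up' yp}.
- by rewrite l1.
- by move: pa'; rewrite cat_path => /andP[].
- by move=> z; rewrite inE => /predU1P[->|zp]; apply: pM'; rewrite ?mem_head// inE mem_cat zp orbT.
Qed.

End Chains.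

(** * Cycles of a complete bipartite graph inside a multigraph *)

Section ThinMinor.
Variables (V E : finType) (d0 d1 : E -> V) (N : nat).
Let I := ('I_3 * 'I_N)%type.
Let U := ('I_3 + 'I_N)%type.
Variables (X : U -> {set V}) (x : I -> V) (p : I -> seq V).
Hypothesis disjX : forall u v, u != v -> [disjoint X u & X v].
Hypothesis path_p : forall k, path (neighbour d0 d1) (x k) (p k).
Hypothesis uniq_p : forall k, uniq (x k :: p k).
Hypothesis disj_p : forall k k' y, y \in x k :: p k -> y \in x k' :: p k' -> k = k'.
Hypothesis start_p : forall k, x k \in X (inl k.1).
Hypothesis end_p : forall k, last (x k) (p k) \in X (inr k.2).
Hypothesis inner_p : forall k y u, y \in p k -> y != last (x k) (p k) -> y \notin X u.
Hypothesis connX : forall u, {in X u &, forall a b, connect (neighbour_in d0 d1 (X u)) a b}.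
Implicit Types (k : I) (u : U) (e : E) (Z : E -> bool) (z : I -> bool).

Definition edge_chain k := walk_chain d0 d1 (x k) (p k).

Definition in_blob u e := (d0 e \in X u) && (d1 e \in X u).

Definition minor_edge e :=
  [exists u, in_blob u e] || [exists k, edge_chain k e].

Definition ends k u := (u == inl k.1) (+) (u == inr k.2).

(** By [flow_edge] below, a cycle inside the minor is constant along the path k;
this is its value there, read off at the start of the path. *)
Definition flow Z k := degree_parity d0 d1 (fun e => Z e && edge_chain k e) (x k).

(** A subset z of the edges of K_(3,N) with even degree at every vertex. *)
Definition cycle_of z := forall u, \big[addb/false]_k (z k && ends k u) = false.

Lemma inX_eq y u v : y \in X u -> y \in X v -> u = v.
Proof.
move=> yu yv; apply/eqP; apply: contraTT yv => /disjX/disjointFr.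
by move/(_ _ yu)->.
Qed.

Lemma end_neq_start k : last (x k) (p k) != x k.
Proof.
apply: contraTneq (start_p k) => <-.
by apply/negP => /inX_eq/(_ (end_p k)).
Qed.

Lemma inX_path k y u : y \in x k :: p k -> y \in X u ->
  y = x k /\ u = inl k.1 \/ y = last (x k) (p k) /\ u = inr k.2.
Proof.
rewrite inE => /predU1P[->|yp] yu; first by left; rewrite (inX_eq yu (start_p k)).
right; have yl : y = last (x k) (p k).
  by apply: contraTeq yu; apply: inner_p.
by rewrite yl in yu *; rewrite (inX_eq yu (end_p k)).
Qed.

Lemma edge_chain_inj k k' e : edge_chain k e -> edge_chain k' e -> k = k'.
Proof. by move=> /walk_chain_ends[ek _] /walk_chain_ends[ek' _]; apply: disj_p ek ek'. Qed.

Lemma walk_chain_neq a q e : uniq (a :: q) -> walk_chain d0 d1 a q e -> d0 e != d1 e.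
Proof.
elim: q a => // y q IH a /= /andP[aq uq].
case: eqP => [/linkP je|_] /=; last exact: IH.
have ay : a != y by apply: contraNneq aq => ->; rewrite mem_head.
by move=> _; case/orP: je => /andP[/eqP-> /eqP->] //; rewrite eq_sym.
Qed.

Lemma edge_chain_not_blob k e u : edge_chain k e -> in_blob u e = false.
Proof.
move=> ke; apply/negP => /andP[e0 e1].
have [k0 k1] := walk_chain_ends ke.
suff /eqP loop : d0 e == d1 e by case/eqP: (walk_chain_neq (uniq_p k) ke).
case: (inX_path k0 e0) => -[-> ue0]; case: (inX_path k1 e1) => -[-> ue1] //;
  by rewrite ue0 in ue1.
Qed.

Lemma flow_edge Z k e : (forall e, Z e -> minor_edge e) ->
  (forall v, degree_parity d0 d1 Z v = false) ->
  edge_chain k e -> Z e = flow Z k.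
Proof.
move=> sZ dZ ke.
have := @path_chain_const _ _ d0 d1 (p k) (x k) (fun e => Z e && edge_chain k e)
  (path_p k) (uniq_p k).
move=> /(_ _ _ e); rewrite -/(edge_chain k e) ke !andbT; apply.
  by move=> e' /andP[].
move=> v vp vl; rewrite -(dZ v); apply: eq_bigr => e' _.
case Ze: (Z e') => //=; case ke' : (edge_chain k e') => //=.
apply/esym/negP => iv.
have vk : v \in x k :: p k by rewrite inE vp orbT.
have ve : (v == d0 e') || (v == d1 e').
  by move: iv; rewrite /incident !(eq_sym v); case: eqP => // _ /=; case: eqP.
case/orP: (sZ _ Ze) => [/existsP[u /andP[e0 e1]]|/existsP[k' k'e]].
  by case/orP: ve => /eqP ve; move: (inner_p u vp vl); rewrite ve ?e0 ?e1.
have [e0 e1] := walk_chain_ends k'e.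
suff kk' : k' = k by rewrite kk' ke' in k'e.
by case/orP: ve => /eqP ve; rewrite ve in vk; [apply: disj_p e0 vk|apply: disj_p e1 vk].
Qed.

Lemma sum_mem (A : {set V}) a : \big[addb/false]_(v in A) (a == v) = (a \in A).
Proof.
rewrite big_mkcond -[RHS](sum_pred1 (mem A) a); apply: eq_bigr => v _.
by rewrite /= eq_sym; case: (v \in A); rewrite ?andbT ?andbF.
Qed.

(** Sum the boundary of Z over a blob: edges inside the blob cancel, and what
remains is the flow through the paths ending there. *)
Lemma flow_cycle Z : (forall e, Z e -> minor_edge e) ->
  (forall v, degree_parity d0 d1 Z v = false) -> cycle_of (flow Z).
Proof.
move=> sZ dZ u.
transitivity (\big[addb/false]_(v in X u) degree_parity d0 d1 Z v); last first.
  by rewrite big1.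
rewrite degree_parity_sum.
transitivity (\big[addb/false]_k \big[addb/false]_(v in X u)
    degree_parity d0 d1 (fun e => Z e && edge_chain k e) v).
  apply: eq_bigr => k _.
  have fl e : Z e && edge_chain k e = flow Z k && edge_chain k e.
    by case ke: (edge_chain k e); rewrite ?andbF ?andbT //; apply: flow_edge.
  transitivity (\big[addb/false]_(v in X u)
      (flow Z k && ((x k == v) (+) (last (x k) (p k) == v)))).
    rewrite -big_distrr /= big_split /= !sum_mem /ends; congr (_ && (_ (+) _)).
      apply/eqP/idP => [->//|xu]; exact: inX_eq xu (start_p k).
    apply/eqP/idP => [->//|xu]; exact: inX_eq xu (end_p k).
  apply: eq_bigr => v _; rewrite -(walk_chain_boundary v (path_p k)).
  rewrite /degree_parity big_distrr /=; apply: eq_bigr => e _.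
  by rewrite andbA -fl.
under eq_bigr do rewrite degree_parity_sum.
rewrite exchange_big /=; apply: eq_bigr => e _.
rewrite -big_distrl /= -big_distrr /=.
have [Ze|//] := boolP (Z e).
have := sZ _ Ze; rewrite /minor_edge => /orP[/existsP[u' /andP[e0 e1]]|/existsP[k ke]].
  suff -> : (d0 e \in X u) = (d1 e \in X u) by rewrite addbb !andbF.
  have [uu'|/disjX uu'] := eqVneq u' u; first by rewrite -uu' e0 e1.
  by rewrite (disjointFr uu' e0) (disjointFr uu' e1).
rewrite (bigD1 k) //= ke big1 // => k' nk.
by apply/negP => /edge_chain_inj/(_ ke) kk; rewrite kk eqxx in nk.
Qed.

Lemma marker_exists k : exists e, edge_chain k e.
Proof.
have := uniq_p k; have := path_p k; have := end_neq_start k; rewrite /edge_chain.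
case: (p k) => [|y q]; first by rewrite eqxx.
move=> /= _ /andP[/joins_link[e le je] _] /andP[xq _]; exists e; rewrite /= le eqxx.
suff /negbTE-> : ~~ walk_chain d0 d1 y q e by [].
apply: contra xq => /walk_chain_ends[e0 e1].
by case/orP: je => [/andP[/eqP<- _]|/andP[_ /eqP<-]].
Qed.

Variable b : U -> V.
Hypothesis base : forall u, b u \in X u.

(** The edge (i, j) of K_(3,N) is replaced by a walk from a base point of the blob
i to a base point of the blob j that follows the path (i, j) in between; the
boundaries at the base points cancel for a cycle. *)
Lemma lift_cycles : exists K : I -> E -> bool, forall z, cycle_of z ->
  let Z e := \big[addb/false]_k (z k && K k e) in
  [/\ forall e, Z e -> minor_edge e, forall v, degree_parity d0 d1 Z v = false &
      forall k, flow Z k = z k].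
Proof.
have /boolp.choice[K KP] k : exists K : E -> bool,
    [/\ forall e, K e -> minor_edge e,
        forall v, degree_parity d0 d1 K v = (b (inl k.1) == v) (+) (b (inr k.2) == v) &
        forall k' e, edge_chain k' e -> K e = (k == k')].
  have link u a : a \in X u -> exists q, [/\ path (neighbour d0 d1) (b u) q,
      last (b u) q = a & forall e, walk_chain d0 d1 (b u) q e -> in_blob u e].
    move=> au; have [q [pq lq qX]] := connect_in_walk (connX (base u) au).
    exists q; split=> // e /walk_chain_ends[].
    have sX w : w \in b u :: q -> w \in X u by rewrite inE => /predU1P[->|/qX].
    by move=> /sX e0 /sX e1; rewrite /in_blob e0.
  have [q [pq lq qX]] := link _ _ (start_p k).
  have [r [pr lr rX]] := link _ _ (end_p k).
  pose Q := walk_chain d0 d1 (b (inl k.1)) q; pose S := walk_chain d0 d1 (b (inr k.2)) r.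
  exists (fun e => Q e (+) edge_chain k e (+) S e); split.
  - move=> e; rewrite /minor_edge; have [/existsP[u eu]|/existsPn nb /=] := boolP [exists u, in_blob u e].
      by [].
    have -> : Q e = false by apply/negP => /qX; apply/negP/nb.
    have -> : S e = false by apply/negP => /rX; apply/negP/nb.
    by rewrite addbF /= => ke; apply/existsP; exists k.
  - move=> v; rewrite !degree_parityD !walk_chain_boundary // lq lr.
    by case: eqP; case: eqP; case: eqP; case: eqP.
  - move=> k' e k'e; have nb u : in_blob u e = false by exact: edge_chain_not_blob k'e.
    have -> : Q e = false by apply/negP => /qX; rewrite nb.
    have -> : S e = false by apply/negP => /rX; rewrite nb.
    rewrite addbF /=; apply/idP/eqP => [ke|->//]; exact: edge_chain_inj ke k'e.
exists K => z cz Z.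
have sZ e : Z e -> minor_edge e.
  apply: contraTT => ne; rewrite /Z big1 // => k _; apply/andP => -[_].
  by have [h _ _] := KP k; apply/negP; apply: contraNN ne; apply: h.
have dZ v : degree_parity d0 d1 Z v = false.
  rewrite /degree_parity; under eq_bigr do rewrite big_distrl /=.
  rewrite exchange_big /=.
  transitivity (\big[addb/false]_k \big[addb/false]_u (z k && ends k u && (b u == v))).
    apply: eq_bigr => k _; under eq_bigr do rewrite -andbA.
    rewrite -big_distrr /=; have [_ dK _] := KP k; rewrite -/(degree_parity d0 d1 (K k) v) dK.
    under [RHS]eq_bigr do rewrite -andbA; rewrite -big_distrr /=; congr (_ && _).
    rewrite /ends; under [RHS]eq_bigr do rewrite andb_addl.
    rewrite big_split /= (sum_pred1 (fun u => b u == v)).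
    by rewrite (sum_pred1 (fun u => b u == v)).
  rewrite exchange_big /= big1 // => u _; rewrite -big_distrl /=.
  by rewrite cz.
split=> // k; have [e ke] := marker_exists k.
rewrite -(flow_edge sZ dZ ke) /Z (bigD1 k) //= big1 => [|k' k'k].
  by have [_ _ h] := KP k; rewrite (h k) // eqxx andbT addbF.
by have [_ _ h] := KP k'; rewrite (h k) // (negbTE k'k) andbF.
Qed.

End ThinMinor.

(** * Counting faces *)

Section BipartiteCycles.

(** The handshake argument. *)
Lemma other_odd (T : finType) (P : pred T) t :
  \big[addb/false]_(s : T) P s = false -> P t -> exists2 s, s != t & P s.
Proof.
move=> P0 Pt; have [/existsP[s /andP[? ?]]|/existsPn no] :=
  boolP [exists s, (s != t) && P s]; first by exists s.
move: P0; rewrite (bigD1 t) //= Pt big1 // => s st.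
by apply/negbTE; move: (no s); rewrite st.
Qed.

Lemma sum_ends_left N (z : 'I_3 * 'I_N -> bool) i :
  \big[addb/false]_k (z k && ends k (inl i)) = \big[addb/false]_j z (i, j).
Proof.
transitivity (\big[addb/false]_i' \big[addb/false]_j (z (i', j) && ends (i', j) (inl i))).
  by rewrite pair_bigA; apply: eq_bigr => -[].
rewrite (bigD1 i) //= [X in _ (+) X]big1 ?addbF => [|i' /negbTE ii'].
  by apply: eq_bigr => j _; rewrite /ends /= (inj_eq inl_inj) eqxx andbT.
by rewrite big1 // => j _; rewrite /ends /= (inj_eq inl_inj) eq_sym ii' andbF.
Qed.

Lemma sum_ends_right N (z : 'I_3 * 'I_N -> bool) j :
  \big[addb/false]_k (z k && ends k (inr j)) = \big[addb/false]_i z (i, j).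
Proof.
transitivity (\big[addb/false]_i \big[addb/false]_j' (z (i, j') && ends (i, j') (inr j))).
  by rewrite pair_bigA; apply: eq_bigr => -[].
apply: eq_bigr => i _; rewrite (bigD1 j) //= big1 ?addbF => [|j' /negbTE jj'].
  by rewrite /ends /= (inj_eq inr_inj) eqxx andbT.
by rewrite /ends /= (inj_eq inr_inj) eq_sym jj' andbF.
Qed.

(** A bipartite graph has no cycle of length less than four. *)
Lemma cycle_of_card N (z : 'I_3 * 'I_N -> bool) k : cycle_of z -> z k ->
  (4 <= #|[set k | z k]|)%N.
Proof.
case: k => i1 j cz zk.
have [i2 i21 z2] := @other_odd _ (fun i => z (i, j)) i1 (etrans (esym (sum_ends_right z j)) (cz _)) zk.
have [j' jj' z1] := @other_odd _ (fun j => z (i1, j)) j (etrans (esym (sum_ends_left z i1)) (cz _)) zk.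
have [i3 i31 z3] := @other_odd _ (fun i => z (i, j')) i1 (etrans (esym (sum_ends_right z j')) (cz _)) z1.
apply: (@leq_trans (size [:: (i1, j); (i2, j); (i1, j'); (i3, j')])) => //.
rewrite cardE; apply: uniq_leq_size => [|k].
  rewrite /= !inE !xpair_eqE (eq_sym i1 i2) (eq_sym i1 i3) (eq_sym j j').
  by rewrite (negbTE i21) (negbTE i31) (negbTE jj') !andbF.
by rewrite !inE mem_enum inE => /or4P[]/eqP->.
Qed.

(** Two even subsets A and B of the N = n + 1 right vertices give the cycle that
joins A to vertex 1, B to vertex 2 and their symmetric difference to vertex 0;
an even subset is determined by its n elements other than the first. *)
Lemma many_cycles n : exists z : {set 'I_n} * {set 'I_n} -> 'I_3 * 'I_n.+1 -> bool,
  (forall t, cycle_of (z t)) /\ (forall t t', z t =1 z t' -> t = t').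
Proof.
pose a (A : {set 'I_n}) (j : 'I_n.+1) := if unlift ord0 j is Some j' then j' \in A
  else \big[addb/false]_j' (j' \in A).
pose z (t : {set 'I_n} * {set 'I_n}) (k : 'I_3 * 'I_n.+1) :=
  if val k.1 == 1%N then a t.1 k.2 else
  if val k.1 == 2%N then a t.2 k.2 else a t.1 k.2 (+) a t.2 k.2.
have sa A : \big[addb/false]_j a A j = false.
  rewrite big_ord_recl /a unlift_none.
  by under [X in _ (+) X]eq_bigr do rewrite liftK; rewrite addbb.
exists z; split=> [t [i|j]|[A B] [A' B'] eqz].
- rewrite sum_ends_left; case: i => [[|[|[|//]]] i3]; rewrite /z /=.
  - by rewrite big_split /= !sa.
  - exact: sa.
  - exact: sa.
- rewrite sum_ends_right /z !big_ord_recl big_ord0 /=.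
  by case: (a t.1 j); case: (a t.2 j).
have lt1 : (1 < 3)%N by []. have lt2 : (2 < 3)%N by [].
congr (_, _); apply/setP => j.
  by have := eqz (Ordinal lt1, lift ord0 j); rewrite /z /= /a liftK.
by have := eqz (Ordinal lt2, lift ord0 j); rewrite /z /= /a liftK.
Qed.

End BipartiteCycles.

Section FaceCount.
Variables (F E Q : finType) (bd : F -> E -> bool) (phi : Q -> E -> bool).
Variables (n : nat).
Let I := ('I_3 * 'I_n.+1)%type.
Variables (H : pred E) (w : I -> E) (K : I -> E -> bool).
Implicit Types (f : F) (C G : {set F}) (e : E) (k : I).

Definition boundary G e := \big[addb/false]_(f in G) bd f e.

Let lift (z : I -> bool) e := \big[addb/false]_k (z k && K k e).

Hypothesis two_faces : forall e, (#|[set f | bd f e]| <= 2)%N.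
Hypothesis boundary_cycle : forall G, (forall e, boundary G e -> H e) ->
  cycle_of (fun k => boundary G (w k)).
Hypothesis lift_support : forall z, cycle_of z -> forall e, lift z e -> H e.
Hypothesis lift_marker : forall z, cycle_of z -> forall k, lift z (w k) = z k.
Hypothesis fill : forall z, cycle_of z ->
  (forall q, \big[addb/false]_e (lift z e && phi q e) = false) ->
  exists G, lift z =1 boundary G.

(** Two faces are in the same region when one passes from one to the other without
crossing the minor H. *)
Definition share f f' := [exists e, [&& ~~ H e, bd f e & bd f' e]].

Definition region f := [set f' | connect share f f'].

Lemma shareC f f' : share f f' = share f' f.
Proof. by apply: eq_existsb => e; rewrite [bd f e && _]andbC. Qed.

Lemma region_eq f f' : (f' \in region f) = (region f' == region f).
Proof.
have sym : connect_sym share by apply: sym_connect_sym; exact: shareC.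
rewrite inE; apply/idP/eqP => [ff'|/setP/(_ f')]; last by rewrite !inE connect0.
by apply/setP => g; rewrite !inE (same_connect sym ff').
Qed.

Lemma boundary_closed G : (forall e, boundary G e -> H e) ->
  forall f f', share f f' -> f \in G -> f' \in G.
Proof.
move=> GH f f' /existsP[e /and3P[eH fe f'e]] fG; apply: contraTT eH => f'G.
rewrite negbK GH // /boundary.
have ff' : f' != f by apply: contraNneq f'G => ->.
have all2 g : bd g e -> (g == f) || (g == f').
  move=> ge; apply: contraTT (two_faces e) => /norP[gf gf']; rewrite -ltnNge.
  apply: (@leq_trans (size [:: g; f; f'])) => //.
  rewrite cardE; apply: uniq_leq_size => [|h].
    by rewrite /= !inE (negbTE gf) (negbTE gf') eq_sym ff'.
  by rewrite !inE mem_enum inE => /or3P[]/eqP->.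
rewrite (bigD1 f) //= fe big1 // => g /andP[gG gf]; apply/negP => /all2.
by rewrite (negbTE gf) /= => /eqP gf'; rewrite gf' (negbTE f'G) in gG.
Qed.

Lemma region_sub G f : (forall e, boundary G e -> H e) -> f \in G ->
  region f \subset G.
Proof.
move=> GH fG; apply/fintype.subsetP => f'; rewrite inE => /connectP[p].
elim: p f fG => [|g p IH] f fG /= => [_ ->//|/andP[fg gp]].
by apply: IH gp; apply: boundary_closed fg fG.
Qed.

Lemma region_boundary G f : (forall e, boundary G e -> H e) -> f \in G ->
  forall e, boundary (region f) e -> H e.
Proof.
move=> GH fG e; apply: contraTT => eH.
have [/existsP[g /andP[gf ge]]|/existsPn no] :=
    boolP [exists g, (g \in region f) && bd g e]; last first.
  rewrite /boundary big1 // => g gf; apply/negbTE.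
  by move: (no g); rewrite gf.
suff -> : boundary (region f) e = boundary G e.
  by apply: contra eH => /GH.
rewrite /boundary !(big_mkcond (fun g => g \in _)) /=; apply: eq_bigr => h _.
case he: (bd h e); last by rewrite !if_same.
have hf : h \in region f.
  rewrite region_eq -(eqP (_ : region g == region f)) -?region_eq //.
  by rewrite inE connect1 //; apply/existsP; exists e; rewrite eH ge he.
by rewrite hf (fintype.subsetP (region_sub GH fG) _ hf).
Qed.

(** The regions bounded by the minor that have a marker [w k] of some path on
their boundary. *)
Definition essential := [set C in region @: F |
  [forall e, boundary C e ==> H e] && [exists k, boundary C (w k)]].

(** Count the pairs of an essential region and a marker on its boundary: the
boundary of a region is a cycle of K_(3,N), so it has at least four markers, and
each of the 3N markers belongs to at most two faces. *)
Lemma essential_card : (4 * #|essential| <= 6 * n.+1)%N.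
Proof.
have -> : (6 * n.+1 = \sum_(k : I) 2)%N.
  by rewrite sum_nat_const card_prod !card_ord mulnC; lia.
rewrite mulnC -sum_nat_const.
apply: (@leq_trans (\sum_(C in essential) \sum_(k : I) boundary C (w k))).
  apply: leq_sum => C; rewrite inE => /and3P[_ /forallP CH /existsP[k Ck]].
  have CH' e : boundary C e -> H e by apply/implyP.
  rewrite -big_mkcond /= sum1_card.
  apply: leq_trans (cycle_of_card (boundary_cycle CH') Ck) _.
  by apply: eq_leq; apply: eq_card => k'; rewrite inE.
rewrite exchange_big /=; apply: leq_sum => k _.
apply: leq_trans (two_faces (w k)).
apply: leq_trans (leq_imset_card region _).
rewrite -big_mkcondr /= sum1_card; apply: subset_leq_card.
apply/fintype.subsetP => C; rewrite unfold_in => /andP[]; rewrite inE => /andP[/imsetP[f _ ->] _].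
case: (boolP [exists g, (g \in region f) && bd g (w k)]).
  case/existsP=> g /andP[gf gw] _; apply/imsetP; exists g; first by rewrite inE.
  by apply/esym/eqP; rewrite -region_eq.
move/existsPn=> no; rewrite /boundary big1 // => g gf; apply/negbTE.
by move: (no g); rewrite gf.
Qed.

Lemma boundary_essential G : (forall e, boundary G e -> H e) ->
  exists2 S : {set {set F}}, S \subset essential &
    forall k, boundary G (w k) = \big[addb/false]_(C in S) boundary C (w k).
Proof.
move=> GH; exists (essential :&: region @: G); first exact: finset.subsetIl.
move=> k; rewrite {1}/boundary (partition_big region (fun C => C \in region @: G)) /=;
  last by move=> f fG; apply: imset_f.
rewrite [LHS]big_mkcond [RHS]big_mkcond /=; apply: eq_bigr => C _.
rewrite inE andbC; case: ifP => // /imsetP[f fG ->].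
have -> : \big[addb/false]_(g in G | region g == region f) bd g (w k) =
          boundary (region f) (w k).
  apply: eq_bigl => g; rewrite -region_eq andb_idl //.
  by apply/fintype.subsetP; apply: region_sub.
rewrite /=; case: ifP => // /negbT; rewrite inE imset_f //= negb_and.
case/orP=> [/forallPn[e]|/existsPn no]; last by apply/negbTE/no.
by rewrite negb_imply => /andP[/(region_boundary GH fG)->].
Qed.

(** There are 2 ^ (2n) cycles of K_(3,n+1).  Those with the same parities phi differ
by boundaries, and a boundary is determined by a set of essential regions; so
2n is at most the number of parities plus 3(n+1)/2. *)
Theorem face_count : (n <= 2 * #|Q| + 3)%N.
Proof.
have [z [cz injz]] := many_cycles n.
pose val t : {ffun Q -> bool} := [ffun q => \big[addb/false]_e (lift (z t) e && phi q e)].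
have fibre t0 : (#|[set t | val t == val t0]| <= 2 ^ #|essential|)%N.
  have /boolp.choice[S SP] t : exists S : {set {set F}}, val t = val t0 ->
      S \subset essential /\
      forall k, z t k (+) z t0 k = \big[addb/false]_(C in S) boundary C (w k).
    have [vt|ne] := eqVneq (val t) (val t0); last first.
      by exists finset.set0 => /eqP; rewrite (negbTE ne).
    have cd : cycle_of (fun k => z t k (+) z t0 k).
      move=> u; under eq_bigr do rewrite andb_addl.
      by rewrite big_split /= !cz.
    have liftD e : lift (fun k => z t k (+) z t0 k) e = lift (z t) e (+) lift (z t0) e.
      by rewrite /lift -big_split /=; apply: eq_bigr => k _; rewrite andb_addl.
    have [G eG] : exists G, lift (fun k => z t k (+) z t0 k) =1 boundary G.
      apply: fill => // q; under eq_bigr do rewrite liftD andb_addl.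
      rewrite big_split /=; have := congr1 (fun h : {ffun Q -> bool} => h q) vt.
      by rewrite !ffunE => ->; rewrite addbb.
    have [|S Se SP] := @boundary_essential G.
      by move=> e; rewrite -eG; apply: lift_support.
    by exists S => _; split=> // k; rewrite -SP -eG lift_marker.
  rewrite -card_powerset.
  have inj : {in [set t | val t == val t0] &, injective S}.
    move=> t t'; rewrite !inE => /eqP/SP[_ St] /eqP/SP[_ St'] SS.
    apply: injz => k; have := St k; rewrite SS -St'.
    by case: (z t k); case: (z t' k); case: (z t0 k).
  rewrite -(card_in_imset inj); apply: subset_leq_card; apply/fintype.subsetP => _ /imsetP[t vt ->].
  by move: vt; rewrite !inE => /eqP/SP[].
have : (2 ^ (n + n) <= 2 ^ #|Q| * 2 ^ #|essential|)%N.
  have -> : (2 ^ (n + n) = #|{: {set 'I_n} * {set 'I_n}}|)%N.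
    by rewrite card_prod -cardsT -powersetT card_powerset cardsT card_ord expnD.
  have -> : (2 ^ #|Q| = #|{ffun Q -> bool}|)%N by rewrite card_ffun card_bool.
  have -> : (#|{: {set 'I_n} * {set 'I_n}}| = \sum_c #|[set t | val t == c]|)%N.
    rewrite -sum1_card (partition_big val xpredT) //=; apply: eq_bigr => c _.
    by rewrite -sum1_card; apply: eq_bigl => t; rewrite inE.
  rewrite -sum_nat_const; apply: leq_sum => c _.
  have [/existsP[t0 /eqP<-]|/existsPn no] := boolP [exists t, val t == c].
    exact: fibre.
  by rewrite (eq_card0 (A := [set t | val t == c])) // => t; rewrite inE (negbTE (no t)).
rewrite -expnD leq_exp2l //; have := essential_card; lia.
Qed.

End FaceCount.

(** * Bipartite minors of a finite complex *)

(** A finite complex in which cycles with trivial parities [phi] bound has no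
K_(3,N) minor for large N.  The minor is given by blobs X for its vertices and M
for its edges. *)
Theorem bounded_bipartite_minor (V E F Q : finType) (d0 d1 : E -> V)
    (bd : F -> E -> bool) (phi : Q -> E -> bool)
    (two_faces : forall e, (#|[set f | bd f e]| <= 2)%N)
    (closed_faces : forall f v, degree_parity d0 d1 (bd f) v = false)
    (fill : forall Z : E -> bool, (forall v, degree_parity d0 d1 Z v = false) ->
      (forall q, \big[addb/false]_e (Z e && phi q e) = false) ->
      exists G, Z =1 boundary bd G)
    (n : nat) (X : 'I_3 + 'I_n.+1 -> {set V}) (M : 'I_3 * 'I_n.+1 -> {set V})
    (connX : forall u, {in X u &, forall a b, connect (neighbour_in d0 d1 (X u)) a b})
    (connM : forall k, {in M k &, forall a b, connect (neighbour_in d0 d1 (M k)) a b})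
    (meet_left : forall k, exists a, a \in X (inl k.1) :&: M k)
    (meet_right : forall k, exists a, a \in X (inr k.2) :&: M k)
    (disjX : forall u v, u != v -> [disjoint X u & X v])
    (disjM : forall k k', k != k' -> [disjoint M k & M k'])
    (disjMX : forall k u, u != inl k.1 -> u != inr k.2 -> [disjoint M k & X u]) :
  (n <= 2 * #|Q| + 3)%N.
Proof.
have /boolp.choice[xp xpP] k : exists xp : V * seq V,
    [/\ path (neighbour d0 d1) xp.1 xp.2, uniq (xp.1 :: xp.2),
       {subset xp.1 :: xp.2 <= M k}, xp.1 \in X (inl k.1) &
       last xp.1 xp.2 \in X (inr k.2)] /\
    ({in xp.2, forall y, y \notin X (inl k.1)} /\
     {in belast xp.1 xp.2, forall y, y \notin X (inr k.2)}).
  have [a aX] := meet_left k; have [b bX] := meet_right k.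
  have [||x [p xp]] := @thin_path _ _ d0 d1 (X (inl k.1)) (X (inr k.2)) (M k) a b _ aX bX.
  - exact: disjX.
  - by have /setIP[_ aM] := aX; have /setIP[_ bM] := bX; exact: connM.
  by exists (x, p).
pose x k := (xp k).1; pose p k := (xp k).2.
have path_p k : path (neighbour d0 d1) (x k) (p k) by have [[]] := xpP k.
have uniq_p k : uniq (x k :: p k) by have [[]] := xpP k.
have sub_p k : {subset x k :: p k <= M k} by have [[]] := xpP k.
have start_p k : x k \in X (inl k.1) by have [[]] := xpP k.
have end_p k : last (x k) (p k) \in X (inr k.2) by have [[]] := xpP k.
have disj_p k k' y : y \in x k :: p k -> y \in x k' :: p k' -> k = k'.
  move=> /sub_p yk /sub_p yk'; apply/eqP; apply: contraTT yk' => /disjM dk.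
  by rewrite (disjointFr dk).
have inner_p k y u : y \in p k -> y != last (x k) (p k) -> y \notin X u.
  move=> yp yl; have [_ [nl nr]] := xpP k.
  have [->|ul] := eqVneq u (inl k.1); first exact: nl.
  have [->|ur] := eqVneq u (inr k.2).
    apply: nr; have : y \in x k :: p k by rewrite inE yp orbT.
    by rewrite lastI mem_rcons inE (negbTE yl).
  by rewrite (disjointFr (disjMX k u ul ur)) // sub_p // inE yp orbT.
have /boolp.choice[b base] u : exists v, v \in X u.
  case: u => [i|j].
    by have [a /setIP[aX _]] := meet_left (i, ord0); exists a.
  by have [a /setIP[aX _]] := meet_right (ord0, j); exists a.
have /boolp.choice[w wP] k : exists e, edge_chain d0 d1 x p k e.
  exact: (marker_exists disjX path_p uniq_p start_p end_p).
have [K KP] := lift_cycles disjX path_p uniq_p disj_p start_p end_p inner_p connX base.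
apply: (@face_count F E Q bd phi n (minor_edge d0 d1 X x p) w K two_faces).
- move=> G GH.
  have dG v : degree_parity d0 d1 (boundary bd G) v = false.
    rewrite /degree_parity /boundary; under eq_bigr do rewrite big_distrl /=.
    rewrite exchange_big /= big1 // => f _; exact: closed_faces.
  have := flow_cycle disjX path_p uniq_p disj_p start_p end_p inner_p GH dG.
  move=> cG u; rewrite -[RHS](cG u); apply: eq_bigr => k _.
  by rewrite -(flow_edge path_p uniq_p disj_p inner_p GH dG (wP k)).
- by move=> z /KP[].
- move=> z cz k; have [sZ dZ fl] := KP z cz.
  by rewrite (flow_edge path_p uniq_p disj_p inner_p sZ dZ (wP k)).
- by move=> z /KP[_ dZ _] phi0; apply: fill.
Qed.

(** * Rectangular grids glued along seams *)

Section Xor.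
Lemma sum_hit (T : finType) (g P : pred T) x0 : P x0 ->
  (forall x, P x -> x = x0) -> \big[addb/false]_x (g x && P x) = g x0.
Proof.
move=> Px0 uP; rewrite -[RHS](sum_pred1 g); apply: eq_bigr => x _.
rewrite andbC; congr (_ && _); apply/idP/eqP => [/uP//|->//].
Qed.

Lemma sum_miss (T : finType) (g P : pred T) :
  (forall x, P x = false) -> \big[addb/false]_x (g x && P x) = false.
Proof. by move=> no; rewrite big1 // => x _; rewrite no andbF. Qed.

Lemma card_le2 (T : finType) (A : {set T}) (g : T -> bool) :
  {in A &, injective g} -> (#|A| <= 2)%N.
Proof. by move=> /card_in_imset<-; rewrite -card_bool max_card. Qed.

Lemma degree_parity1 (V E : finType) (d0 d1 : E -> V) e v :
  degree_parity d0 d1 (fun e' => e' == e) v = incident d0 d1 e v.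
Proof. exact: (sum_pred1 (fun e => incident d0 d1 e v)). Qed.

End Xor.

Section Grid.
(** Each sheet has h unit intervals of m columns, and b rows. *)
Variables (h m b : nat) (hole : 'I_h -> bool).
Hypotheses (b_gt0 : (0 < b)%N).
Let a := (h * m)%N.
(** A sheet is named by the signs of y and z.  The seam (n, top, s) glues, over the
unit interval n, the bottom or top rows of two of the sheets by a strip of
squares whose rungs are the edges [sedge]. *)
Definition sheet : finType := (bool * bool)%type.
Definition gvertex : finType := (sheet * 'I_a.+1 * 'I_b.+1)%type.
Definition seam : finType := ('I_h * bool * bool)%type.
Definition gedge : finType :=
  ((sheet * 'I_a * 'I_b.+1) + (sheet * 'I_a.+1 * 'I_b) + (seam * 'I_m.+1))%type.
Definition gface : finType := ((sheet * 'I_a * 'I_b) + (seam * 'I_m))%type.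

Definition hedge (s : sheet) i j : gedge := inl (inl (s, i, j)).
Definition vedge (s : sheet) i j : gedge := inl (inr (s, i, j)).
Definition sedge (q : seam) t : gedge := inr (q, t).
Definition cell (s : sheet) i j : gface := inl (s, i, j).
Definition strip (q : seam) t : gface := inr (q, t).

Definition below n (i : 'I_n) : 'I_n.+1 := widen_ord (leqnSn n) i.
Definition above n (i : 'I_n) : 'I_n.+1 := lift ord0 i.

Fact column_proof (n : 'I_h) (t : 'I_m.+1) : (n * m + t < a.+1)%N.
Proof.
rewrite ltnS /a; apply: (@leq_trans (n.+1 * m)); last by rewrite leq_mul2r ltn_ord orbT.
by rewrite mulSn addnC leq_add2r -ltnS.
Qed.
Definition column n t := Ordinal (column_proof n t).

Fact cell_column_proof (n : 'I_h) (t : 'I_m) : (n * m + t < a)%N.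
Proof.
rewrite /a; apply: (@leq_trans (n.+1 * m)); last by rewrite leq_mul2r ltn_ord orbT.
by rewrite mulSn addnC ltn_add2r.
Qed.
Definition cell_column n t := Ordinal (cell_column_proof n t).

Lemma column_below n t : column n (below t) = below (cell_column n t).
Proof. exact: val_inj. Qed.
Lemma column_above n t : column n (above t) = above (cell_column n t).
Proof. by apply: val_inj; rewrite /= !/bump /= !add1n addnS. Qed.

Definition seam_row (q : seam) : 'I_b.+1 := if q.1.2 then ord_max else ord0.
(** Which sheets a seam glues.  At the top row z = 0, so the two signs of z are glued
for each sign s of y; at the bottom row this holds over a hole, and elsewhere
y = 0 and the two signs of y are glued. *)
Definition seam_sheet (q : seam) (side : bool) : sheet :=
  if q.1.2 || hole q.1.1 then (q.2, side) else (side, q.2).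

Definition gd0 (e : gedge) : gvertex :=
  match e with
  | inl (inl (s, i, j)) => (s, below i, j)
  | inl (inr (s, i, j)) => (s, i, below j)
  | inr (q, t) => (seam_sheet q false, column q.1.1 t, seam_row q)
  end.
Definition gd1 (e : gedge) : gvertex :=
  match e with
  | inl (inl (s, i, j)) => (s, above i, j)
  | inl (inr (s, i, j)) => (s, i, above j)
  | inr (q, t) => (seam_sheet q true, column q.1.1 t, seam_row q)
  end.

Definition gbd (f : gface) (e : gedge) : bool :=
  match f with
  | inl (s, i, j) => (e == hedge s i (below j)) (+) (e == hedge s i (above j))
       (+) (e == vedge s (below i) j) (+) (e == vedge s (above i) j)
  | inr (q, t) => (e == sedge q (below t)) (+) (e == sedge q (above t))
       (+) (e == hedge (seam_sheet q false) (cell_column q.1.1 t) (seam_row q))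
       (+) (e == hedge (seam_sheet q true) (cell_column q.1.1 t) (seam_row q))
  end.

Definition seam_parity (q : seam) (e : gedge) :=
  if e is inr (q', t) then q' == q else false.

Lemma gfaces_closed f v : degree_parity gd0 gd1 (gbd f) v = false.
Proof.
case: f => [[[s i] j]|[q t]]; rewrite /gbd !degree_parityD !degree_parity1 /incident /=.
  by do 4 case: (_ == v).
rewrite !column_below !column_above.
by do 4 case: (_ == v).
Qed.

Lemma below_neq_above n (i : 'I_n) : (below i == above i) = false.
Proof. by apply/negbTE; rewrite -val_eqE /= neq_ltn /bump /= add1n ltnSn. Qed.

Lemma below_inj n : injective (@below n).
Proof. by move=> i j /(congr1 val) /= ij; apply: val_inj. Qed.

Lemma above_inj n : injective (@above n).
Proof. exact: lift_inj. Qed.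

Lemma cell_column_inj n t n' t' : cell_column n t = cell_column n' t' -> n = n' /\ t = t'.
Proof.
move=> /(congr1 val) /= eq.
have m0 : (0 < m)%N by rewrite (leq_ltn_trans (leq0n t)).
have nn' : n = n' :> nat.
  have := congr1 (fun k => k %/ m)%N eq.
  by rewrite !divnMDl // !divn_small // !addn0.
by split; apply: val_inj => //; move: eq; rewrite nn' => /addnI.
Qed.

Lemma seam_sheet_inj n top k k' x x' : seam_sheet (n, top, k) x = seam_sheet (n, top, k') x' ->
  k = k' /\ x = x'.
Proof. by rewrite /seam_sheet /=; case: ifP => _ [-> ->]. Qed.

Lemma xor4 (c1 c2 c3 c4 : bool) : c1 (+) c2 (+) c3 (+) c4 -> [|| c1, c2, c3 | c4].
Proof. by case: c1; case: c2; case: c3; case: c4. Qed.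

Lemma cell_hedge s' i' j' s i j : gbd (cell s' i' j') (hedge s i j) ->
  [/\ s = s', i = i' & j = below j' \/ j = above j'].
Proof. by move/xor4 => /or4P[]// /eqP[-> -> ->]; split; auto. Qed.

Lemma cell_vedge s' i' j' s i j : gbd (cell s' i' j') (vedge s i j) ->
  [/\ s = s', j = j' & i = below i' \/ i = above i'].
Proof. by move/xor4 => /or4P[]// /eqP[-> -> ->]; split; auto. Qed.

Lemma strip_hedge q t s i j : gbd (strip q t) (hedge s i j) ->
  [/\ s = seam_sheet q false \/ s = seam_sheet q true,
      i = cell_column q.1.1 t & j = seam_row q].
Proof. by move/xor4 => /or4P[]// /eqP[-> -> ->]; split; auto. Qed.

Lemma strip_sedge q' t' q t : gbd (strip q' t') (sedge q t) ->
  q = q' /\ (t = below t' \/ t = above t').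
Proof. by move/xor4 => /or4P[]// /eqP[-> ->]; split; auto. Qed.

Lemma seam_row_top q : (seam_row q == ord_max) = q.1.2.
Proof.
rewrite /seam_row; case: q.1.2; first by rewrite eqxx.
by rewrite -val_eqE /= ltn_eqF.
Qed.

Lemma below_not_max n (i : 'I_n) : (below i == ord_max) = false.
Proof. by rewrite -val_eqE /= ltn_eqF. Qed.

Lemma above_not_0 n (i : 'I_n) : (above i == ord0) = false.
Proof. by rewrite -val_eqE. Qed.

Lemma cell_strip_sides (q : seam) (j1 : 'I_b) j : j = below j1 \/ j = above j1 ->
  j = seam_row q -> (j == below j1) = q.1.2 -> False.
Proof.
move=> [->|->] jq; rewrite ?eqxx.
  by rewrite -seam_row_top -jq below_not_max.
rewrite eq_sym below_neq_above => top; have := above_not_0 j1.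
by rewrite jq /seam_row -top eqxx.
Qed.

Lemma below_or_above n (i1 i2 : 'I_n) i :
  i = below i1 \/ i = above i1 -> i = below i2 \/ i = above i2 ->
  (i == below i1) = (i == below i2) -> i1 = i2.
Proof.
move=> [->|->] [] E.
- by rewrite (below_inj E).
- by rewrite eqxx E eq_sym below_neq_above.
- by rewrite {2}E eqxx eq_sym below_neq_above.
- by rewrite (above_inj E).
Qed.

(** The function g tells on which side of the edge a face lies; it separates the
faces at a given edge. *)
Lemma gtwo_faces e : (#|[set f | gbd f e]| <= 2)%N.
Proof.
pose g (f : gface) := match f, e with
  | inl (s', i', j'), inl (inl (s, i, j)) => j == below j'
  | inl (s', i', j'), inl (inr (s, i, j)) => i == below i'
  | inr (q', t'), inr (q, t) => t == below t'
  | inr (q', t'), _ => q'.1.2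
  | _, _ => true
  end.
apply: (@card_le2 gface _ g) => f f'; rewrite !inE /g.
case: e g => [[[[s i] j]|[[s i] j]]|[q t]] _.
- case: f => [[[s1 i1] j1]|[q1 t1]] => [/cell_hedge[<- <- hj]|/strip_hedge[hs hi hj]];
  case: f' => [[[s2 i2] j2]|[q2 t2]] => [/cell_hedge[<- <- hj']|/strip_hedge[hs' hi' hj']].
  + by move/(below_or_above hj hj')->.
  + by move/(cell_strip_sides hj hj').
  + by move/esym/(cell_strip_sides hj' hj).
  + case: q1 hs hi hj => [[n1 o1] k1] hs hi hj.
    case: q2 hs' hi' hj' => [[n2 o2] k2] hs' hi' hj' /= oo.
    move: hi; rewrite hi' => /cell_column_inj[nn tt]; rewrite /= in nn.
    rewrite tt oo nn in hs hs' *; congr (inr (_, _, _, _)).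
    by case: hs hs' => -> [] /seam_sheet_inj[].
- case: f => [[[s1 i1] j1]|[q1 t1]] => [/cell_vedge[<- <- hi]|//].
  case: f' => [[[s2 i2] j2]|[q2 t2]] => [/cell_vedge[<- <- hi']|//].
  by move/(below_or_above hi hi')->.
- case: f => [[[s1 i1] j1]|[q1 t1]] => [//|/strip_sedge[<- ht]].
  case: f' => [[[s2 i2] j2]|[q2 t2]] => [//|/strip_sedge[<- ht']].
  by move/(below_or_above ht ht')->.
Qed.


Definition cells_of (g : sheet -> nat -> nat -> bool) : {set gface} :=
  [set f : gface | if f is inl (s, i, j) then g s i j else false].

Definition strips_of (g : seam -> nat -> bool) : {set gface} :=
  [set f : gface | if f is inr (q, t) then g q t else false].

Lemma boundary_cells g e : boundary gbd (cells_of g) e =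
  \big[addb/false]_(c : sheet * 'I_a * 'I_b) (g c.1.1 c.1.2 c.2 && gbd (inl c) e).
Proof.
rewrite /boundary big_mkcond big_sumType /= [X in _ (+) X]big1 ?addbF; last first.
  by move=> [q t] _; rewrite inE.
by apply: eq_bigr => -[[s i] j] _; rewrite inE /=; case: (g s i j).
Qed.

Lemma boundary_strips g e : boundary gbd (strips_of g) e =
  \big[addb/false]_(c : seam * 'I_m) (g c.1 c.2 && gbd (inr c) e).
Proof.
rewrite /boundary big_mkcond big_sumType /= [X in X (+) _]big1 ?addFb; last first.
  by move=> [[s i] j] _; rewrite inE.
by apply: eq_bigr => -[q t] _; rewrite inE /=; case: (g q t).
Qed.

Lemma sum_below n (T : finType) (g : T -> nat -> bool) x (j : 'I_n.+1) :
  \big[addb/false]_(c : T * 'I_n) (g c.1 c.2 && ((x == c.1) && (j == below c.2))) =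
  (j < n)%N && g x j.
Proof.
case: ltnP => jn.
  rewrite (@sum_hit _ (fun c : T * 'I_n => g c.1 c.2) _ (x, Ordinal jn)) //=.
    by rewrite eqxx -val_eqE /= eqxx.
  by move=> [y k] /= /andP[/eqP-> /eqP jk]; congr (_, _); apply: val_inj; rewrite /= jk.
rewrite (@sum_miss _ (fun c : T * 'I_n => g c.1 c.2)) // => -[y k] /=.
by rewrite -(val_eqE j) /= gtn_eqF ?andbF // (leq_trans _ jn).
Qed.

Lemma sum_above n (T : finType) (g : T -> nat -> bool) x (j : 'I_n.+1) :
  \big[addb/false]_(c : T * 'I_n) (g c.1 c.2 && ((x == c.1) && (j == above c.2))) =
  (0 < j)%N && g x j.-1.
Proof.
case: (posnP j) => j0.
  rewrite (@sum_miss _ (fun c : T * 'I_n => g c.1 c.2)) // => -[y k] /=.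
  by rewrite -(val_eqE j) /= j0 andbF.
have jn : (j.-1 < n)%N by rewrite prednK // -ltnS.
rewrite (@sum_hit _ (fun c : T * 'I_n => g c.1 c.2) _ (x, Ordinal jn)) //=.
  by rewrite eqxx -val_eqE /= /bump /= add1n prednK ?eqxx.
move=> [y k] /= /andP[/eqP-> /eqP jk]; congr (_, _); apply: val_inj.
by rewrite /= jk.
Qed.

Lemma boundary_cells_hedge g s i j : boundary gbd (cells_of g) (hedge s i j) =
  (j < b)%N && g s i j (+) (0 < j)%N && g s i j.-1.
Proof.
rewrite boundary_cells.
rewrite -(sum_below (fun c : sheet * 'I_a => g c.1 c.2) (s, i)).
rewrite -(sum_above (fun c : sheet * 'I_a => g c.1 c.2) (s, i)).
rewrite -big_split /=; apply: eq_bigr => -[[s' i'] j'] _ /=.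
by rewrite !addbF andb_addr.
Qed.

Lemma boundary_cells_vedge g s i j : boundary gbd (cells_of g) (vedge s i j) =
  (i < a)%N && g s i j (+) (0 < i)%N && g s i.-1 j.
Proof.
rewrite boundary_cells.
rewrite -(sum_below (fun (c : sheet * 'I_b) (k : nat) => g c.1 k c.2) (s, j)).
rewrite -(sum_above (fun (c : sheet * 'I_b) (k : nat) => g c.1 k c.2) (s, j)).
rewrite -big_split /= (reindex (fun c : sheet * 'I_b * 'I_a => (c.1.1, c.2, c.1.2))) /=.
  apply: eq_bigr => -[[s' j'] i'] _ /=; rewrite andb_addr; congr (_ && _ (+) _ && _).
    by rewrite /vedge -[LHS]/((s, i, j) == (s', below i', j')) !xpair_eqE andbAC.
  by rewrite /vedge -[LHS]/((s, i, j) == (s', above i', j')) !xpair_eqE andbAC.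
by exists (fun c => (c.1.1, c.2, c.1.2)) => -[[]].
Qed.

Lemma boundary_cells_sedge g q t : boundary gbd (cells_of g) (sedge q t) = false.
Proof. by rewrite boundary_cells big1 // => -[[s i] j] _; rewrite andbF. Qed.

Lemma boundary_strips_sedge g q t : boundary gbd (strips_of g) (sedge q t) =
  (t < m)%N && g q t (+) (0 < t)%N && g q t.-1.
Proof.
rewrite boundary_strips -sum_below -sum_above.
rewrite -big_split /=; apply: eq_bigr => -[q' t'] _ /=.
by rewrite !addbF andb_addr.
Qed.

Lemma partial_sum_step n (z : 'I_n.+1 -> bool) (j : 'I_n.+1) :
  \big[addb/false]_(i : 'I_n.+1 | (i <= j)%N) z i (+)
  (0 < j)%N && \big[addb/false]_(i : 'I_n.+1 | (i <= j.-1)%N) z i = z j.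
Proof.
rewrite (bigD1 j) //=; case: posnP => j0.
  by rewrite big1 ?addbF // => i; rewrite j0 leqn0 -val_eqE /= j0 andbN.
rewrite [X in _ (+) X (+) _](eq_bigl (fun i : 'I_n.+1 => (i <= j.-1)%N)).
  by rewrite -addbA addbb addbF.
by move=> i; rewrite -val_eqE /= andbC -ltn_neqAle -{1}(prednK j0) ltnS.
Qed.

(** A cycle that crosses every seam an even number of times is pushed off the seams
by the boundary of strips, and then off the horizontal edges by the boundary of
cells; no cycle is left on the vertical edges alone. *)
Theorem grid_fill (Z : gedge -> bool) :
  (forall v, degree_parity gd0 gd1 Z v = false) ->
  (forall q, \big[addb/false]_e (Z e && seam_parity q e) = false) ->
  exists G, Z =1 boundary gbd G.
Proof.
move=> dZ sZ.
(* The strips before k along q are those at which an odd number of crossings has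
   been met. *)
pose g1 (q : seam) (k : nat) := \big[addb/false]_(t : 'I_m.+1 | (t <= k)%N) Z (sedge q t).
pose Z1 e := Z e (+) boundary gbd (strips_of g1) e.
have full q : \big[addb/false]_(t : 'I_m.+1) Z (sedge q t) = false.
  rewrite -[RHS](sZ q) big_sumType /= [X in _ = X (+) _]big1 ?addFb => [|e _]; last exact: andbF.
  transitivity (\big[addb/false]_q' \big[addb/false]_t (Z (sedge q' t) && (q' == q))); last first.
    by rewrite pair_bigA; apply: eq_bigr => -[].
  rewrite [RHS](bigD1 q) //= [X in _ = _ (+) X]big1 ?addbF => [|q' /negbTE qq'].
    by apply: eq_bigr => t _; rewrite eqxx andbT.
  by rewrite big1 // => t _; rewrite qq' andbF.
have Z1s q t : Z1 (sedge q t) = false.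
  have := partial_sum_step (fun t => Z (sedge q t)) t.
  rewrite -/(g1 q t) -/(g1 q t.-1) /Z1 boundary_strips_sedge => <-.
  case: (ltnP t m) => tm; first by rewrite andTb addbb.
  have -> : g1 q t = false.
    by rewrite -[RHS](full q); apply: eq_bigl => t'; rewrite (leq_trans _ tm) // -ltnS.
  by rewrite addbb.
have dZ1 v : degree_parity gd0 gd1 Z1 v = false.
  rewrite degree_parityD dZ /degree_parity /boundary.
  under eq_bigr do rewrite big_distrl /=.
  rewrite exchange_big /= big1 // => f _; exact: gfaces_closed.
(* The same partial sums, up each column. *)
pose g2 (s : sheet) (i j : nat) := if insub i is Some i' then
  \big[addb/false]_(j' : 'I_b.+1 | (j' <= j)%N) Z1 (hedge s i' j') else false.
have g2E s (i : 'I_a) j : g2 s i j = \big[addb/false]_(j' : 'I_b.+1 | (j' <= j)%N) Z1 (hedge s i j').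
  by rewrite /g2 valK.
have cut (P : pred gvertex) :
    \big[addb/false]_(c : sheet * 'I_a * 'I_b.+1) (Z1 (hedge c.1.1 c.1.2 c.2) &&
       (P (c.1.1, below c.1.2, c.2) (+) P (c.1.1, above c.1.2, c.2))) (+)
    \big[addb/false]_(c : sheet * 'I_a.+1 * 'I_b) (Z1 (vedge c.1.1 c.1.2 c.2) &&
       (P (c.1, below c.2) (+) P (c.1, above c.2))) = false.
  have : \big[addb/false]_(v | P v) degree_parity gd0 gd1 Z1 v = false by rewrite big1.
  rewrite degree_parity_sum big_sumType /= [X in _ (+) X]big1 ?addbF => [|[q t] _].
    rewrite big_sumType /= => cut0; rewrite -[RHS]cut0; congr (_ (+) _);
      by apply: eq_bigr => -[[s i] j].
  by rewrite [Z1 _]Z1s.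
have column_cut s i : \big[addb/false]_j Z1 (hedge s i j) = false.
  have := cut (fun v => (v.1.1 == s) && (v.1.2 <= i)%N).
  rewrite [X in _ (+) X]big1 ?addbF => [|c _]; last by rewrite addbb andbF.
  move=> cut0; rewrite -[RHS]cut0 -(pair_bigA _ (fun c j => Z1 (hedge c.1 c.2 j) &&
    ((c.1 == s) && (below c.2 <= i) (+) (c.1 == s) && (above c.2 <= i)))%N) /=.
  rewrite exchange_big /=; apply: eq_bigr => j _.
  rewrite (@sum_hit _ (fun c : sheet * 'I_a => Z1 (hedge c.1 c.2 j)) _ (s, i)) //=.
    by rewrite eqxx leqnn /bump /= add1n ltnn.
  move=> [s' i'] /=; case: eqP => //= ->; rewrite /bump /= add1n => ii.
  by congr (_, _); apply: val_inj; move: ii; rewrite /=; case: (ltngtP i' i).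
exists [set f | (f \in cells_of g2) (+) (f \in strips_of g1)] => e.
have -> : boundary gbd [set f | (f \in cells_of g2) (+) (f \in strips_of g1)] e =
          boundary gbd (cells_of g2) e (+) boundary gbd (strips_of g1) e.
  rewrite /boundary !(big_mkcond (fun f => f \in _)) -big_split /=.
  apply: eq_bigr => f _; rewrite inE.
  by case: (f \in cells_of g2); case: (f \in strips_of g1); rewrite ?addbb ?addbF.
suff : Z1 e = boundary gbd (cells_of g2) e.
  by rewrite /Z1 => <-; rewrite -addbA addbb addbF.
case: e => [[[[s i] j]|[[s i] j]]|[q t]]; last first.
- by rewrite [LHS]Z1s; apply/esym; exact: boundary_cells_sedge.
- rewrite [RHS]boundary_cells_vedge.
  have := cut (fun v => (v.1 == (s, i)) && (v.2 <= j)%N); rewrite addbC.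
  rewrite (@sum_hit _ (fun c : sheet * 'I_a.+1 * 'I_b => Z1 (vedge c.1.1 c.1.2 c.2)) _ (s, i, j)) /=; first last.
  + move=> [c j'] /=; case: eqP => //= ->; rewrite /bump /= add1n => jj.
    by congr (_, _); apply: val_inj; move: jj; rewrite /=; case: (ltngtP j' j).
  + by rewrite eqxx leqnn /bump /= add1n ltnn.
  move/(canRL (addbK _)); rewrite addFb => ->.
  rewrite -(sum_below (fun s k => g2 s k j) s) -(sum_above (fun s k => g2 s k j) s).
  rewrite -big_split /= -(pair_bigA _ (fun c k => Z1 (hedge c.1 c.2 k) &&
    (((c.1, below c.2) == (s, i)) && (k <= j) (+) ((c.1, above c.2) == (s, i)) && (k <= j)))%N) /=.
  apply: eq_bigr => -[s' i'] _ /=; rewrite g2E.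
  rewrite -andb_addr !xpair_eqE (eq_sym s) !(eq_sym i) big_distrl /=.
  rewrite [RHS]big_mkcond /=; apply: eq_bigr => k _.
  rewrite -andb_addl; case: leqP; rewrite ?andbT ?andbF //.
- rewrite [RHS]boundary_cells_hedge /= !g2E -(partial_sum_step (fun j => Z1 (hedge s i j)) j).
  congr (_ (+) _); case: (ltnP j b) => jb //=.
  rewrite -[RHS](column_cut s i); apply: eq_bigl => j'.
  by rewrite (leq_trans _ jb) // -ltnS.
Qed.

End Grid.

Local Open Scope classical_set_scope.
Local Open Scope ring_scope.

(** * Compactness and connectedness in metric form *)

Section Metric.
Variables (K : realType) (V W : normedModType K).

Lemma compact_separated (A B : set V) : compact A -> compact B ->
  A `&` B = set0 -> exists2 e : K, 0 < e & forall p q, A p -> B q -> e <= `|p - q|.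
Proof.
move=> cA cB AB0.
have [->|/set0P A0] := eqVneq A set0; first by exists 1.
have [->|/set0P B0] := eqVneq B set0; first by exists 1.
have [p0 Ap0] := A0; have [q0 Bq0] := B0.
have cont : {within A `*` B, continuous (fun r : V * V => `|r.1 - r.2|)}.
  apply: continuous_subspaceT => r; apply: cvg_norm.
  by apply: cvgB; [exact: cvg_fst|exact: cvg_snd].
have AB : A `*` B !=set0 by exists (p0, q0).
have [[p q]] := compact_EVT_min AB (compact_setX cA cB) cont.
rewrite inE /= => -[Ap Bq] min; exists `|p - q|.
  rewrite normr_gt0 subr_eq0; apply/eqP => pq.
  have : (A `&` B) p by split; rewrite //= pq.
  by rewrite AB0.
by move=> p' q' Ap' Bq'; apply: (min (p', q')); rewrite inE.
Qed.

Lemma compact_uniform (A : set V) (f : V -> W) (e : K) : compact A -> continuous f ->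
  0 < e -> exists2 d : K, 0 < d & forall p q, A p -> A q -> `|p - q| < d -> `|f p - f q| < e.
Proof.
move=> cA cf e0; pose D := [set r : V * V | e <= `|f r.1 - f r.2|].
have clD : closed D.
  apply: (@preimage_closed _ _ (fun r : V * V => `|f r.1 - f r.2|) [set x | e <= x]).
    move=> r _; apply: cvg_norm; apply: cvgB.
      by apply: cvg_comp; [exact: cvg_fst|exact: cf].
    by apply: cvg_comp; [exact: cvg_snd|exact: cf].
  exact: closed_ge.
have cAD : compact ((A `*` A) `&` D) by apply: compact_closedI => //; exact: compact_setX.
have cont : {within (A `*` A) `&` D, continuous (fun r : V * V => `|r.1 - r.2|)}.
  apply: continuous_subspaceT => r; apply: cvg_norm.
  by apply: cvgB; [exact: cvg_fst|exact: cvg_snd].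
have [AD0|/set0P AD0] := eqVneq ((A `*` A) `&` D) set0.
  exists 1 => // p q Ap Aq _; rewrite ltNge; apply/negP => epq.
  by have : ((A `*` A) `&` D) (p, q) by []; rewrite AD0.
have [[p q]] := compact_EVT_min AD0 cAD cont.
rewrite inE /= => -[[Ap Aq] Dpq] min; exists `|p - q|.
  rewrite normr_gt0 subr_eq0; apply/eqP => /= pq; move: Dpq; rewrite /D /= pq subrr normr0.
  by rewrite leNgt e0.
move=> p' q' Ap' Aq'; rewrite !ltNge; apply: contra => Dp'.
by apply: (min (p', q')); rewrite inE.
Qed.

(** A property that propagates at a fixed small distance within C defines a subset
of C that is open together with its complement. *)
Lemma connected_chain (C : set V) (U : V -> Prop) (d : K) p0 : connected C -> 0 < d ->
  (forall p q, C p -> C q -> `|p - q| < d -> U p -> U q) ->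
  C p0 -> U p0 -> forall p, C p -> U p.
Proof.
move=> cC d0 step Cp0 Up0.
have clopen (P : V -> Prop) : (forall p q, C p -> C q -> `|p - q| < d -> P p -> P q) ->
    exists2 O, open O & C `&` P = C `&` O.
  move=> stepP; exists (\bigcup_(p in C `&` P) ball p d).
    by apply: bigcup_open => p _; exact: ball_open.
  apply/seteqP; split=> [p [Cp Pp]|q [Cq [p [Cp Pp] pq]]]; split=> //.
    by exists p => //; exact: ballxx.
  by apply: stepP Pp => //; rewrite -ball_normE in pq.
suff : C `&` U = C by move=> CU p; rewrite -CU => -[].
apply: cC; first by exists p0.
  exact: clopen.
have [|O oO CO] := clopen (fun p => ~ U p).
  by move=> p q Cp Cq pq nUp Uq; apply: nUp; apply: step Uq => //; rewrite distrC.
exists (~` O); first exact: open_closedC.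
apply/seteqP; split=> p [Cp Hp]; split=> //.
  by move=> Op; have : (C `&` O) p by []; rewrite -CO => -[_]; apply.
apply: contrapT => nUp; have : (C `&` (fun p => ~ U p)) p by [].
by rewrite CO => -[].
Qed.

End Metric.

(** * The four sheets of the surface *)

Section SurfaceSheets.
Variables (K : realType) (g : nat).
Implicit Types (x y e : K) (k : 'I_g).

Definition radius : K := (4 * g + 1)%:R.

Definition outer x y : K := radius ^+ 2 - x ^+ 2 - y ^+ 2.

Definition inner k x y : K := (x - (4 * k)%:R) ^+ 2 + y ^+ 2 - 1.

Definition height2 x y : K := outer x y * \prod_(k < g) inner k x y.

Lemma surfaceP (p : K * K * K) :
  surface g p <-> p.2 ^+ 2 = height2 p.1.1 p.1.2.
Proof. by []. Qed.

Definition in_domain x y := 0 <= outer x y /\ forall k, 0 <= inner k x y.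

Lemma center_bounds k : (0 : K) <= (4 * k)%:R <= radius - 5.
Proof.
rewrite ler0n /= /radius lerBrDr -(natrD _ _ 5) ler_nat; have := ltn_ord k; lia.
Qed.

Lemma center_gap k k' : k != k' -> 4 <= `|(4 * k)%:R - (4 * k')%:R : K|.
Proof.
rewrite -val_eqE /= neq_ltn => /orP[] kk; rewrite ler_normr; apply/orP; [right|left].
  by rewrite opprB lerBrDr -(natrD _ 4) ler_nat; lia.
by rewrite lerBrDr -(natrD _ 4) ler_nat; lia.
Qed.

Lemma height2_ge0 x y : in_domain x y -> 0 <= height2 x y.
Proof. by move=> [outg inn]; rewrite mulr_ge0 // prodr_ge0. Qed.

(** The factors of the height are never negative at the same place: the discs are
pairwise disjoint and far from the outer circle.  Hence the height is
nonnegative exactly on the domain. *)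
Lemma inner_gt0_outside k x y : outer x y < 0 -> 0 < inner k x y.
Proof.
rewrite /outer /inner => outg; have /andP[k0 kr] := center_bounds k.
move: ((4 * k)%:R) k0 kr => c c0 cr.
have r2 : 0 <= x ^+ 2 + y ^+ 2 by rewrite addr_ge0 ?sqr_ge0.
pose r := Num.sqrt (x ^+ 2 + y ^+ 2).
have r0 : 0 <= r by rewrite sqrtr_ge0.
have rE : r ^+ 2 = x ^+ 2 + y ^+ 2 by rewrite sqr_sqrtr.
have xr : x <= r.
  rewrite (le_trans (ler_norm x)) // -sqrtr_sqr /r ler_sqrt ?r2 //.
  by rewrite lerDl sqr_ge0.
have Rr : radius < r.
  rewrite -ltr_sqr ?nnegrE ?ler0n // rE; lra.
have : 25 <= (r - c) ^+ 2 by nra.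
nra.
Qed.

Lemma inner_gt0_other k k' x y : k != k' -> inner k x y < 0 -> 0 < inner k' x y.
Proof.
move=> /center_gap; rewrite /inner.
move: ((4 * k)%:R) ((4 * k')%:R) => c c' cc ik.
have y2 := sqr_ge0 y.
have x1 : `|x - c| < 1.
  by rewrite -(@ltr_sqr _ `|x - c|) ?nnegrE // expr1n real_normK ?num_real //; lra.
have : 3 < `|x - c'|.
  have := ler_normD (c - x) (x - c'); rewrite addrA subrK [`|c - x|]distrC; lra.
rewrite -(@ltr_sqr _ 3) ?nnegrE // real_normK ?num_real //; lra.
Qed.

Lemma outer_gt0_inside k x y : inner k x y < 0 -> 0 < outer x y.
Proof.
rewrite /inner /outer => ik; have /andP[k0 kr] := center_bounds k.
move: ((4 * k)%:R) k0 kr ik => c c0 cr ik.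
have y2 := sqr_ge0 y.
have x1 : `|x - c| < 1.
  by rewrite -(@ltr_sqr _ `|x - c|) ?nnegrE // expr1n real_normK ?num_real //; lra.
move: x1; rewrite ltr_norml => /andP[x1 x2].
nra.
Qed.

Lemma height2_domain x y : 0 <= height2 x y -> in_domain x y.
Proof.
move=> h0; split=> [|k]; rewrite leNgt; apply/negP => neg; move: h0; rewrite leNgt => /negP[].
  rewrite /height2 nmulr_rlt0 // prodr_gt0 // => k _; exact: inner_gt0_outside.
rewrite /height2 pmulr_rlt0; last exact: outer_gt0_inside neg.
rewrite (bigD1 k) //= nmulr_rlt0 // prodr_gt0 // => k' k'k.
by apply: inner_gt0_other neg; rewrite eq_sym.
Qed.

(** Over x the domain is the set of y with [low x <= `|y| <= high x], which [level]
parametrises by the unit interval. *)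
Definition low2 x : K := \big[Num.max/0]_(k < g) (1 - (x - (4 * k)%:R) ^+ 2).
Definition low x : K := Num.sqrt (low2 x).
Definition high x : K := Num.sqrt (radius ^+ 2 - x ^+ 2).

Lemma low2_ge0 x : 0 <= low2 x.
Proof. exact: bigmax_ge_id. Qed.

Lemma low_sqr x : low x ^+ 2 = low2 x.
Proof. by rewrite sqr_sqrtr ?low2_ge0. Qed.

Lemma radius_ge1 : 1 <= radius.
Proof. by rewrite /radius ler1n; lia. Qed.

Lemma radius_ge0 : 0 <= radius.
Proof. exact: ler0n. Qed.

Lemma high_sqr x : `|x| <= radius -> high x ^+ 2 = radius ^+ 2 - x ^+ 2.
Proof.
move=> xr; rewrite sqr_sqrtr // subr_ge0 -[x ^+ 2]real_normK ?num_real //.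
by rewrite ler_sqr ?nnegrE // radius_ge0.
Qed.

Lemma low2_high x : `|x| <= radius -> low2 x <= radius ^+ 2 - x ^+ 2.
Proof.
rewrite ler_norml => /andP[x1 x2]; apply: bigmax_le => [|k _].
  nra.
have /andP[k0 kr] := center_bounds k; move: ((4 * k)%:R) k0 kr => c c0 cr.
nra.
Qed.

Lemma low_high x : `|x| <= radius -> low x <= high x.
Proof. by move=> xr; rewrite ler_wsqrtr // low2_high. Qed.

Lemma domainP x y : in_domain x y <-> `|x| <= radius /\ low x <= `|y| <= high x.
Proof.
have r1 := radius_ge1; split=> [[outg inn]|[xr /andP[ly yh]]].
  have xr : `|x| <= radius.
    rewrite -ler_sqr ?nnegrE ?radius_ge0 //.
    rewrite real_normK ?num_real //; move: outg; rewrite /outer; have := sqr_ge0 y; lra.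
  split=> //; apply/andP; split.
    rewrite -ler_sqr ?nnegrE ?sqrtr_ge0 // low_sqr real_normK ?num_real //.
    apply: bigmax_le => [|k _]; first exact: sqr_ge0.
    by have := inn k; rewrite /inner; lra.
  rewrite -ler_sqr ?nnegrE ?sqrtr_ge0 // high_sqr // real_normK ?num_real //.
  by move: outg; rewrite /outer; lra.
move: ly yh; rewrite -[low x <= _]ler_sqr ?nnegrE ?sqrtr_ge0 // low_sqr.
rewrite -[_ <= high x]ler_sqr ?nnegrE ?sqrtr_ge0 // high_sqr // real_normK ?num_real //.
move=> ly yh; split; first by rewrite /outer; lra.
move=> k; have := le_trans (le_bigmax 0 _ k) ly; rewrite /inner; lra.
Qed.

Definition level x (t : K) : K := (1 - t) * low x + t * high x.

Lemma level_bounds x t : `|x| <= radius -> 0 <= t <= 1 -> low x <= level x t <= high x.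
Proof. by move=> /low_high lh /andP[t0 t1]; rewrite /level; apply/andP; split; nra. Qed.

Lemma level_ge0 x t : `|x| <= radius -> 0 <= t <= 1 -> 0 <= level x t.
Proof. by move=> xr /(level_bounds xr)/andP[+ _]; apply: le_trans; exact: sqrtr_ge0. Qed.

Lemma level_domain x t : `|x| <= radius -> 0 <= t <= 1 -> in_domain x (level x t).
Proof.
move=> xr t01; apply/domainP; split=> //.
by rewrite ger0_norm ?level_ge0 //; exact: level_bounds.
Qed.

Lemma level_onto x y : `|x| <= radius -> low x <= y <= high x ->
  exists2 t, 0 <= t <= 1 & y = level x t.
Proof.
move=> xr /andP[ly yh]; have [lh|lh] := eqVneq (low x) (high x).
  by exists 0; rewrite ?lexx ?ler01 // /level; lra.
have lh0 : 0 < high x - low x by rewrite subr_gt0 lt_neqAle lh low_high.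
exists ((y - low x) / (high x - low x)).
  apply/andP; split; first by rewrite divr_ge0 ?subr_ge0 // low_high.
  by rewrite ler_pdivrMr // mul1r lerB.
by rewrite /level; field; rewrite gt_eqF.
Qed.

Definition signed (s : bool) y : K := if s then - y else y.

Definition sheet_point (s : bool * bool) x t : K * K * K :=
  (x, signed s.1 (level x t), signed s.2 (Num.sqrt (height2 x (level x t)))).

Lemma height2N x y : height2 x (- y) = height2 x y.
Proof. by rewrite /height2 /outer /inner sqrrN. Qed.

Lemma sheet_point_onto (p : K * K * K) : surface g p ->
  exists s x t, [/\ `|x| <= radius, 0 <= t <= 1 & p = sheet_point s x t].
Proof.
case: p => [[x y] z] /surfaceP /= zE.
have [xr yb] : `|x| <= radius /\ low x <= `|y| <= high x.
  by apply/domainP/height2_domain; rewrite -zE sqr_ge0.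
have [t t01 yt] := level_onto xr yb.
exists (y < 0, z < 0), x, t; split=> //; rewrite /sheet_point -yt /signed /=.
have -> : height2 x `|y| = z ^+ 2.
  by rewrite zE; case: ler0P => // _; rewrite height2N.
rewrite sqrtr_sqr; congr (_, _, _).
  by case: ltrP => [/ltr0_norm->|/ger0_norm->//]; rewrite opprK.
by case: ltrP => [/ltr0_norm->|/ger0_norm->//]; rewrite opprK.
Qed.

End SurfaceSheets.

(** * Uniform continuity on the sheets *)

Lemma dist3_lt (K : realType) (p q : K * K * K) e :
  (`|p - q| < e) = [&& `|p.1.1 - q.1.1| < e, `|p.1.2 - q.1.2| < e & `|p.2 - q.2| < e].
Proof. by rewrite !prod_normE /= !gt_max andbA. Qed.

Section Moduli.
Variables (K : realType) (g : nat).
Implicit Types (x y e t : K) (k : 'I_g).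
Local Notation r := (radius K g).

Lemma height2_continuous : continuous (fun p : K * K => height2 g p.1 p.2).
Proof.
have c1 : continuous (fun p : K * K => p.1) by move=> p; exact: cvg_fst.
have c2 : continuous (fun p : K * K => p.2) by move=> p; exact: cvg_snd.
move=> p; apply: cvgM.
  by apply: cvgB; [apply: cvgB; [exact: cvg_cst|apply: cvgM; exact: c1]|apply: cvgM; exact: c2].
apply: cvg_big => [|k _]; first exact: mul_continuous.
apply: cvgB; last exact: cvg_cst.
apply: cvgD; last by apply: cvgM; exact: c2.
by apply: cvgM; (apply: cvgB; [exact: c1|exact: cvg_cst]).
Qed.

Lemma low_continuous : continuous (@low K g).
Proof.
move=> x; apply: (@cvg_comp _ _ _ (@low2 K g) Num.sqrt); last exact: sqrt_continuous.
apply: cvg_big => [|k _].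
  move=> p; apply: continuous_max; [exact: cvg_fst|exact: cvg_snd].
apply: cvgB; first exact: cvg_cst.
by apply: cvgM; (apply: cvgB; [exact: cvg_id|exact: cvg_cst]).
Qed.

Lemma high_continuous : continuous (@high K g).
Proof.
move=> x; apply: (@cvg_comp _ _ _ (fun x : K => r ^+ 2 - x ^+ 2) Num.sqrt); last exact: sqrt_continuous.
by apply: cvgB; [exact: cvg_cst|apply: cvgM; exact: cvg_id].
Qed.

Lemma level_continuous : continuous (fun p : K * K => level g p.1 p.2).
Proof.
move=> p; have c1 : p.1 @[p --> p] --> p.1 by exact: cvg_fst.
have c2 : p.2 @[p --> p] --> p.2 by exact: cvg_snd.
apply: cvgD; apply: cvgM => //.
- by apply: cvgB => //; exact: cvg_cst.
- by apply: cvg_comp c1 _; exact: low_continuous.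
- by apply: cvg_comp c1 _; exact: high_continuous.
Qed.

Lemma sqrt_height2_continuous : continuous (fun p : K * K => Num.sqrt (height2 g p.1 p.2)).
Proof.
move=> p; apply: (@cvg_comp _ _ _ (fun p : K * K => height2 g p.1 p.2) Num.sqrt).
  exact: height2_continuous.
exact: sqrt_continuous.
Qed.

Lemma sheet_point_continuous : continuous (fun p : K * K => sheet_point g (false, false) p.1 p.2).
Proof.
move=> p; have c1 : p.1 @[p --> p] --> p.1 by exact: cvg_fst.
have cl := @level_continuous p.
have cl2 : (q.1, level g q.1 q.2) @[q --> p] --> (p.1, level g p.1 p.2) by exact: (cvg_pair c1 cl).
have c3 : Num.sqrt (height2 g q.1 (level g q.1 q.2)) @[q --> p] -->
    Num.sqrt (height2 g p.1 (level g p.1 p.2)).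
  exact: (cvg_comp _ _ cl2 (@sqrt_height2_continuous _)).
exact: (cvg_pair cl2 c3).
Qed.

Lemma sheet_dist s x t x' t' :
  `|sheet_point g s x t - sheet_point g s x' t'| =
  `|sheet_point g (false, false) x t - sheet_point g (false, false) x' t'|.
Proof.
rewrite !prod_normE /= /signed; congr (Num.max (Num.max _ _) _).
  by case: s.1 => //; rewrite -opprD normrN.
by case: s.2 => //; rewrite -opprD normrN.
Qed.

Definition box := [set p : K * K | `|p.1| <= r /\ 0 <= p.2 <= 1].

Lemma box_compact : compact box.
Proof.
have -> : box = `[- r, r] `*` `[0, 1].
  by apply/seteqP; split=> p; rewrite /box /= !in_itv /= ler_norml.
by apply: compact_setX; exact: segment_compact.
Qed.

Lemma sheet_modulus e : 0 < e -> exists2 d, 0 < d &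
  forall s x x' t t', `|x| <= r -> `|x'| <= r -> 0 <= t <= 1 -> 0 <= t' <= 1 ->
  `|x - x'| < d -> `|t - t'| < d -> `|sheet_point g s x t - sheet_point g s x' t'| < e.
Proof.
move=> e0; have [d d0 dP] := compact_uniform box_compact sheet_point_continuous e0.
exists d => // s x x' t t' xr xr' t01 t01' xx tt; rewrite sheet_dist.
by apply: (dP (x, t) (x', t')); rewrite //= prod_normE /= gt_max xx.
Qed.

Lemma level_norm x t : `|x| <= r -> 0 <= t <= 1 -> `|level g x t| <= r.
Proof.
move=> xr t01; rewrite ger0_norm ?level_ge0 //.
have /andP[_ /le_trans->//] := level_bounds xr t01.
rewrite -ler_sqr ?nnegrE ?sqrtr_ge0 ?radius_ge0 // high_sqr // gerBl; exact: sqr_ge0.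
Qed.

(** On a fine grid the points of a column are controlled by their height y alone,
although the parametrisation by the ratio degenerates where low x = high x. *)
Lemma level_modulus e : 0 < e -> exists2 d, 0 < d &
  forall s x t t', `|x| <= r -> 0 <= t <= 1 -> 0 <= t' <= 1 ->
  `|level g x t - level g x t'| < d -> `|sheet_point g s x t - sheet_point g s x t'| < e.
Proof.
move=> e0.
have cS : compact (`[- r, r] `*` `[- r, r]) by apply: compact_setX; exact: segment_compact.
have [d d0 dP] := compact_uniform cS sqrt_height2_continuous e0.
exists (Num.min d e); first by rewrite lt_min d0.
move=> s x t t' xr t01 t01'; rewrite lt_min => /andP[ld le].
rewrite sheet_dist dist3_lt /= subrr normr0 e0 le /=.
have inr y : `|y| <= r -> [set` `[- r, r]] y by rewrite /= in_itv /= ler_norml.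
apply: (dP (x, level g x t) (x, level g x t')).
- by split; apply: inr => //; exact: level_norm.
- by split; apply: inr => //; exact: level_norm.
- by rewrite prod_normE /= subrr normr0 gt_max d0.
Qed.

Lemma low_near_side k x e : 0 < e -> e <= 1 -> `|x - (4 * k)%:R| <= 1 -> low g x < e ->
  1 - `|x - (4 * k)%:R| < e.
Proof.
move=> e0 e1; set u := `|_| => u1 le.
have : low2 g x < e ^+ 2.
  by rewrite -low_sqr ltr_sqr ?nnegrE ?sqrtr_ge0 // ltW.
have := le_bigmax 0 (fun k : 'I_g => 1 - (x - (4 * k)%:R) ^+ 2) k.
rewrite -/(low2 g x) -[(x - _) ^+ 2]real_normK ?num_real // -/u.
have : 0 <= u by exact: normr_ge0.
nra.
Qed.

Lemma low_eq0 x : (forall k : 'I_g, 1 <= `|x - (4 * k)%:R|) -> low g x = 0.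
Proof.
move=> far; apply/eqP; rewrite sqrtr_eq0; apply: bigmax_le => // k _.
rewrite subr_le0 -[(x - _) ^+ 2]real_normK ?num_real //.
by rewrite -[X in X <= _](expr1n _ 2) ler_sqr ?nnegrE.
Qed.

Lemma low2_hole k x : `|x - (4 * k)%:R| <= 1 -> low2 g x = 1 - (x - (4 * k)%:R) ^+ 2.
Proof.
move=> xk; apply/le_anti/andP; split; last exact: le_bigmax.
have ge0 : 0 <= 1 - (x - (4 * k)%:R) ^+ 2.
  by rewrite subr_ge0 -[(x - _) ^+ 2]real_normK ?num_real // expr_le1.
apply: bigmax_le => // k' _; have [->//|kk'] := eqVneq k' k.
apply: le_trans ge0; rewrite subr_le0 -[(x - _) ^+ 2]real_normK ?num_real //.
have gap := center_gap K kk'; have := ler_normD ((4 * k')%:R - x) (x - (4 * k)%:R).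
rewrite addrA subrK [`|_ - x|]distrC => tri.
rewrite -[X in X <= _](expr1n _ 2) ler_sqr ?nnegrE //; lra.
Qed.

Lemma prod_small n (f : 'I_n -> K) e : 0 < e -> (forall i, 0 <= f i) ->
  \prod_(i < n) f i < e ^+ n -> exists i, f i < e.
Proof.
move=> e0 f0 small; have [/existsP//|/existsPn large] := boolP [exists i, f i < e].
move: small; rewrite ltNge -[e ^+ n](_ : \prod_(i < n) e = _).
  by rewrite ler_prod // => i _; rewrite (ltW e0) leNgt large.
by rewrite prodr_const card_ord.
Qed.

(** If a product of g + 1 nonnegative factors is small then so is a factor. *)
Lemma height2_near_boundary x y e : 0 < e -> in_domain g x y ->
  height2 g x y < e ^+ g.+1 -> outer g x y < e \/ exists k : 'I_g, inner k x y < e.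
Proof.
move=> e0 [outg inn]; rewrite /height2 => small.
pose f (i : 'I_g.+1) := if unlift ord0 i is Some k then inner k x y else outer g x y.
have [i||i] := @prod_small g.+1 f e e0.
- by rewrite /f; case: unliftP.
- by rewrite big_ord_recl /f unlift_none; under eq_bigr do rewrite liftK.
- by rewrite /f; case: unliftP => [k _|_]; [right; exists k|left].
Qed.

End Moduli.

(** * Fine grids on the surface *)

Section LineWalk.
Variables (V E : finType) (d0 d1 : E -> V).

Lemma neighbour_in_sym (S : {set V}) : connect_sym (neighbour_in d0 d1 S).
Proof.
apply: sym_connect_sym => x y.
by rewrite /neighbour_in (neighbourC _ _ x) [(x \in S) && _]andbCA.
Qed.

Lemma line_walk n (c : 'I_n.+1 -> V) (S : {set V}) (i i' : 'I_n.+1) :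
  (forall k, neighbour d0 d1 (c (below k)) (c (above k))) ->
  (forall k : 'I_n.+1, (minn i i' <= k <= maxn i i')%N -> c k \in S) ->
  connect (neighbour_in d0 d1 S) (c i) (c i').
Proof.
move=> cn; wlog ii : i i' / (i <= i')%N => [hw cS|].
  case/orP: (leq_total i i') => [/hw|/hw h]; first exact.
  rewrite neighbour_in_sym; apply: h => k.
  by rewrite minnC maxnC; exact: cS.
rewrite (minn_idPl ii) (maxn_idPr ii) => cS.
have [d] := ubnP (i' - i)%N; elim: d i ii cS => // d IH i ii cS; rewrite ltnS => id.
have [/val_inj->|ne] := eqVneq (i : nat) i'; first exact: connect0.
have lt : (i < i')%N by rewrite ltn_neqAle ne.
have iN : (i < n)%N by rewrite (leq_trans lt) // -ltnS.
pose k := Ordinal iN.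
have ik : below k = i by exact: val_inj.
have ak : above k = i.+1 :> nat by [].
apply: (@connect_trans _ _ (c (above k))).
  apply: connect1; rewrite /neighbour_in -{2}ik cn !andbT !cS ?ak ?leqnn //.
  by rewrite leqnSn.
apply: IH; rewrite ?ak //; last by lia.
by move=> k' /andP[ik' ki']; apply: cS; rewrite ki' andbT ltnW.
Qed.

End LineWalk.

Definition row_modulus (K : realType) (g : nat) (e d : K) :=
  forall s x x' t, `|x| <= radius K g -> `|x'| <= radius K g -> 0 <= t <= 1 ->
  `|x - x'| < d -> `|sheet_point g s x t - sheet_point g s x' t| < e.

Definition column_modulus (K : realType) (g : nat) (e d : K) :=
  forall s x t t', `|x| <= radius K g -> 0 <= t <= 1 -> 0 <= t' <= 1 ->
  `|level g x t - level g x t'| < d -> `|sheet_point g s x t - sheet_point g s x t'| < e.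

Lemma sqr_gap (K : realType) (a b d : K) : 0 <= b -> b <= a -> 0 < d ->
  a ^+ 2 - b ^+ 2 < d ^+ 2 -> a - b < d.
Proof.
move=> b0 ba d0; apply: contraTT; rewrite -!leNgt => dab.
have : d ^+ 2 <= (a - b) ^+ 2 by rewrite ler_sqr ?nnegrE ?subr_ge0 // ltW.
by move/le_trans; apply; rewrite sqrrB; nra.
Qed.

Section FineGrid.
Variables (K : realType) (g m : nat).
Hypothesis m_gt0 : (0 < m)%N.
Local Notation r := (radius K g).

(** The abscissa runs through [- r, r] in unit steps from -r = -(4g + 1), so the
holes, which occupy [4k - 1, 4k + 1], are the units 4(g + k) and 4(g + k) + 1. *)
Definition units : nat := (4 * g + 1) * 2.
Definition hole (n : 'I_units) : bool :=
  [exists k : 'I_g, ((n : nat) == 4 * (g + k))%N || ((n : nat) == (4 * (g + k)).+1)%N].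

Local Notation vertex := (gvertex units m m).
Local Notation e0 := (@gd0 units m m hole).
Local Notation e1 := (@gd1 units m m hole).
Local Notation colT := 'I_(units * m).+1.
Local Notation rowT := 'I_m.+1.

Definition abscissa (i : nat) : K := i%:R / m%:R - r.
Definition ratio (j : nat) : K := j%:R / m%:R.
Definition place (v : vertex) : K * K * K :=
  sheet_point g v.1.1 (abscissa v.1.2) (ratio v.2).

Lemma m0 : (0 : K) < m%:R. Proof. by rewrite ltr0n. Qed.

Lemma ratio01 (j : rowT) : 0 <= ratio j <= 1.
Proof.
rewrite divr_ge0 ?ler0n //= ler_pdivrMr ?m0 // mul1r ler_nat.
by rewrite -ltnS.
Qed.

Lemma abscissa_bound (i : colT) : `|abscissa i| <= r.
Proof.
rewrite ler_norml /abscissa; apply/andP; split.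
  by rewrite lerBrDr addNr divr_ge0 ?ler0n.
rewrite lerBlDr ler_pdivrMr ?m0 // /radius -natrD -natrM ler_nat.
by have := ltn_ord i; rewrite ltnS /units; nia.
Qed.

Lemma abscissa_mono (i i' : nat) : (abscissa i <= abscissa i') = (i <= i')%N.
Proof. by rewrite lerD2r ler_pM2r ?invr_gt0 ?m0 // ler_nat. Qed.

Lemma ratio_mono (i i' : nat) : (ratio i <= ratio i') = (i <= i')%N.
Proof. by rewrite ler_pM2r ?invr_gt0 ?m0 // ler_nat. Qed.

(** Linked by a walk that stays within e of its start. *)
Definition near_link (e : K) (v v' : vertex) :=
  connect (neighbour_in e0 e1 [set w : vertex | `|place w - place v| < e]%SET) v v'.

Lemma near_link_last e v v' : 0 < e -> near_link e v v' -> `|place v' - place v| < e.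
Proof.
move=> e_gt0 /connect_in_walk[p [_ <- pS]].
case/lastP: p pS => [_|p w pS]; first by rewrite subrr normr0.
have := pS w; rewrite mem_rcons mem_head last_rcons => /(_ isT).
by rewrite inE.
Qed.

Lemma near_link_trans e e' v v1 v' : 0 < e -> 0 < e' -> near_link e v v1 ->
  near_link e' v1 v' -> near_link (e + e') v v'.
Proof.
move=> e_gt0 e'_gt0 l1 l2; have vv1 := near_link_last e_gt0 l1.
apply: (@connect_trans _ _ v1).
  apply: connect_sub l1 => a c /and3P[aS cS ac]; apply: connect1.
  by move: aS cS; rewrite /neighbour_in !inE ac andbT => aS cS; apply/andP; split; lra.
apply: connect_sub l2 => a c /and3P[aS cS ac]; apply: connect1.
move: aS cS; rewrite /neighbour_in !inE ac andbT => aS cS; apply/andP; split.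
  by have := ler_normD (place a - place v1) (place v1 - place v); rewrite addrA subrK; lra.
by have := ler_normD (place c - place v1) (place v1 - place v); rewrite addrA subrK; lra.
Qed.

Lemma row_walk (e : K) s (i i' : colT) (j : rowT) :
  (forall k : colT, (minn i i' <= k <= maxn i i')%N ->
     `|place (s, k, j) - place (s, i, j)| < e) ->
  near_link e (s, i, j) (s, i', j).
Proof.
move=> close; apply: (@line_walk _ _ e0 e1 _ (fun k : colT => (s, k, j))).
  by move=> k; apply/existsP; exists (@hedge units m m s k j); rewrite /joins /= !eqxx.
by move=> k /close; rewrite inE.
Qed.

Lemma column_walk (e : K) s (i : colT) (j j' : rowT) :
  (forall k : rowT, (minn j j' <= k <= maxn j j')%N ->
     `|place (s, i, k) - place (s, i, j)| < e) ->
  near_link e (s, i, j) (s, i, j').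
Proof.
move=> close; apply: (@line_walk _ _ e0 e1 _ (fun k : rowT => (s, i, k))).
  by move=> k; apply/existsP; exists (@vedge units m m s i k); rewrite /joins /= !eqxx.
by move=> k /close; rewrite inE.
Qed.

(** The two ends of a rung are placed at the same point of the surface. *)
Lemma seam_walk (e : K) (q : seam units) (t : rowT) x : 0 < e ->
  place (seam_sheet hole q x, column q.1.1 t, seam_row m q) =
  place (seam_sheet hole q (~~ x), column q.1.1 t, seam_row m q) ->
  near_link e (seam_sheet hole q x, column q.1.1 t, seam_row m q)
              (seam_sheet hole q (~~ x), column q.1.1 t, seam_row m q).
Proof.
move=> e_gt0 same; apply: connect1; rewrite /neighbour_in !inE same subrr normr0 e_gt0 /=.
by apply/existsP; exists (@sedge units m m q t); rewrite /joins /=; case: x {same}; rewrite !eqxx ?orbT.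
Qed.

Lemma between_dist (x y z d : K) : Num.min x y <= z <= Num.max x y -> `|x - y| < d -> `|z - x| < d.
Proof. by rewrite !ltr_norml; case: (leP x y) => _ /andP[? ?] /andP[? ?]; apply/andP; split; lra. Qed.


Lemma abscissa_ge (c i : nat) : (c * m <= i)%N -> c%:R - r <= abscissa i.
Proof. by move=> ci; rewrite lerD2r ler_pdivlMr ?m0 // -natrM ler_nat. Qed.

Lemma abscissa_le (c i : nat) : (i <= c * m)%N -> abscissa i <= c%:R - r.
Proof. by move=> ci; rewrite lerD2r ler_pdivrMr ?m0 // -natrM ler_nat. Qed.

Lemma abscissa_unit (c : nat) : abscissa (c * m) = c%:R - r.
Proof. by rewrite /abscissa natrM mulfK // gt_eqF ?m0. Qed.

Lemma unit_column (c : nat) (i : colT) : (c < units)%N -> (c * m <= i)%N ->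
  (i <= c.+1 * m)%N -> exists (n : 'I_units) (t : rowT), n = c :> nat /\ column n t = i.
Proof.
move=> cu ci ic; have tm : (i - c * m < m.+1)%N.
  by rewrite ltnS leq_subLR; rewrite mulSn addnC in ic.
exists (Ordinal cu), (Ordinal tm); split=> //; apply: val_inj => /=.
by rewrite subnKC.
Qed.

Lemma center_unit (k : 'I_g) : ((4 * (g + k)).+1)%:R - r = (4 * k)%:R :> K.
Proof. by rewrite /radius -natrB; [congr (_%:R); lia|lia]. Qed.

Lemma nonhole_low (n : 'I_units) (t : rowT) : ~~ hole n ->
  low g (abscissa (column n t)) = 0.
Proof.
move=> /existsPn no; apply: low_eq0 => k; have := no k.
rewrite negb_or => /andP[n1 n2]; have tm : (t <= m)%N by rewrite -ltnS.
rewrite -center_unit ler_normr; apply/orP.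
have [lt|ge] := ltnP n (4 * (g + k)); [right|left].
  have : abscissa (column n t) <= (4 * (g + k))%:R - r.
    apply: abscissa_le => /=; apply: (@leq_trans (n.+1 * m)); last by rewrite leq_mul2r lt orbT.
    by rewrite mulSn addnC leq_add2r.
  rewrite -(natr1 (4 * (g + k))); lra.
have : (4 * (g + k)).+2%:R - r <= abscissa (column n t).
  apply: abscissa_ge => /=; apply: (@leq_trans (n * m)); last exact: leq_addr.
  by rewrite leq_mul2r; apply/orP; right; lia.
rewrite -(natr1 (4 * (g + k)).+1); lra.
Qed.

Lemma level0 x : level g x (ratio 0) = low g x.
Proof. by rewrite /level /ratio mul0r subr0 mul1r mul0r addr0. Qed.

Lemma level1 x : level g x (ratio m) = high g x.
Proof. by rewrite /level /ratio divff ?gt_eqF ?m0 // subrr mul0r add0r mul1r. Qed.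

Lemma level_mono x t t' : `|x| <= r -> t <= t' -> level g x t <= level g x t'.
Proof. by move=> /low_high lh tt; rewrite /level; nra. Qed.

Lemma column_move e d s (i : colT) (j j' : rowT) : column_modulus g e d ->
  `|level g (abscissa i) (ratio j) - level g (abscissa i) (ratio j')| < d ->
  near_link e (s, i, j) (s, i, j').
Proof.
move=> mod lj; apply: column_walk => k /andP[kmin kmax].
apply: mod; rewrite ?abscissa_bound ?ratio01 //.
apply: between_dist lj; rewrite ge_min le_max.
have mono (a c : nat) : (a <= c)%N -> level g (abscissa i) (ratio a) <= level g (abscissa i) (ratio c).
  by move=> ac; apply: level_mono; rewrite ?abscissa_bound ?ratio_mono.
move: kmin kmax; rewrite geq_min leq_max => /orP[] /mono-> /orP[] /mono->; by rewrite ?orbT.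
Qed.

Lemma row_move e d s (i i' : colT) (j : rowT) : row_modulus g e d ->
  `|abscissa i - abscissa i'| < d -> near_link e (s, i, j) (s, i', j).
Proof.
move=> mod xi; apply: row_walk => k /andP[kmin kmax].
apply: mod; rewrite ?abscissa_bound ?ratio01 //.
apply: between_dist xi; rewrite ge_min le_max !abscissa_mono.
by move: kmin kmax; rewrite geq_min leq_max => -> ->.
Qed.

(** Move along the row to the new abscissa, then along the column; the heights differ
little because both the two points and the row move are short. *)
Lemma same_sheet_link e d1 d2 v v' : 0 < e -> column_modulus g e d1 ->
  row_modulus g (Num.min e (d1 / 2)) d2 -> v.1.1 = v'.1.1 ->
  `|place v - place v'| < Num.min d2 (d1 / 2) -> near_link (e + e) v v'.
Proof.
case: v => [[s i] j]; case: v' => [[s' i'] j'] e_gt0 cm rm /= <-.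
rewrite dist3_lt !lt_min /= => /and3P[/andP[xd xd1] /andP[yd yd1] _].
have rm' : row_modulus g e d2.
  by move=> s0 x x' t xr xr' t01 xx; have := rm s0 x x' t xr xr' t01 xx; rewrite lt_min => /andP[].
apply: (@near_link_trans e e _ (s, i', j)) => //; first exact: row_move rm' xd.
apply: column_move cm _.
have := rm s _ _ _ (abscissa_bound i) (abscissa_bound i') (ratio01 j) xd.
rewrite lt_min !dist3_lt => /andP[_ /and3P[_ yy _]].
have unsign a b : `|signed s.1 a - signed s.1 b| = `|a - b| :> K.
  by rewrite /signed; case: s.1 => //; rewrite -opprD normrN.
rewrite unsign in yy; rewrite unsign in yd1.
set A := level g (abscissa i) (ratio j) in yy yd1.
set B := level g (abscissa i') (ratio j) in yy *.
set C := level g (abscissa i') (ratio j') in yd1 *.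
have := ler_normD (B - A) (A - C); rewrite addrA subrK [`|B - A|]distrC; lra.
Qed.

Lemma near_link_weak e e' v v' : e <= e' -> near_link e v v' -> near_link e' v v'.
Proof.
move=> ee; apply: connect_sub => a c /and3P[aS cS ac]; apply: connect1.
by move: aS cS; rewrite /neighbour_in !inE ac andbT => aS cS; apply/andP; split; lra.
Qed.

Lemma units_gt0 : (0 < units)%N. Proof. by rewrite /units; lia. Qed.

Lemma column_onto (i : colT) : exists (n : 'I_units) (t : rowT), column n t = i.
Proof.
have [iu|iu] := ltnP i (units * m).
  have cu : (i %/ m < units)%N by rewrite ltn_divLR.
  have [||n [t [_ E]]] := @unit_column (i %/ m) i cu.
  - exact: leq_trunc_div.
  - by rewrite ltnW // ltn_ceil.
  by exists n, t.
have nu : (units.-1 < units)%N by rewrite prednK ?units_gt0.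
have [||n [t [_ E]]] := @unit_column units.-1 i nu.
- by rewrite (leq_trans _ iu) // leq_mul2r leq_pred orbT.
- by rewrite prednK ?units_gt0 // -ltnS.
by exists n, t.
Qed.

Lemma hole_bounds (n : 'I_units) (t : rowT) (k : 'I_g) :
  ((n : nat) == 4 * (g + k))%N || ((n : nat) == (4 * (g + k)).+1)%N ->
  `|abscissa (column n t) - (4 * k)%:R| <= 1.
Proof.
have tm : (t <= m)%N by rewrite -ltnS.
rewrite -center_unit => nk; have [n1 n2] : (4 * (g + k) <= n)%N /\ (n.+1 <= (4 * (g + k)).+2)%N.
  by case/orP: nk => /eqP->; split; lia.
have ge : (4 * (g + k))%:R - r <= abscissa (column n t).
  apply: abscissa_ge => /=; apply: (@leq_trans (n * m)); last exact: leq_addr.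
  by rewrite leq_mul2r n1 orbT.
have le : abscissa (column n t) <= (4 * (g + k)).+2%:R - r.
  apply: abscissa_le => /=; apply: (@leq_trans (n.+1 * m)); last by rewrite leq_mul2r n2 orbT.
  by rewrite mulSn addnC leq_add2r.
move: ge le; rewrite -(natr1 (4 * (g + k)).+1) -(natr1 (4 * (g + k))) ler_norml => ge le.
by apply/andP; split; lra.
Qed.

Lemma center_units (k : 'I_g) : [/\ (4 * (g + k) < units)%N,
  ((4 * (g + k)).+1 < units)%N & ((4 * (g + k)).+2 < units)%N].
Proof. by have := ltn_ord k; split; rewrite /units; lia. Qed.

(** If low x is small over a hole, then x is near one end of the hole. *)
Lemma near_nonhole (i : colT) d : 0 < d -> d <= 1 -> low g (abscissa i) < d ->
  exists (n : 'I_units) (t : rowT), ~~ hole n /\ `|abscissa i - abscissa (column n t)| < d.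
Proof.
move=> d_gt0 d1 ld; have [n [t cE]] := column_onto i.
have [/existsP[k nk]|nh] := boolP (hole n); last first.
  by exists n, t; rewrite cE subrr normr0.
have xk := hole_bounds t nk; rewrite cE in xk.
have side := low_near_side d_gt0 d1 xk ld.
have kg := ltn_ord k.
have [neg|pos] := lerP (abscissa i - (4 * k)%:R) 0.
  have cu : ((4 * (g + k)).-1 < units)%N by rewrite /units; lia.
  exists (Ordinal cu), ord_max; split; first by apply/existsPn => k' /=; lia.
  have -> : abscissa (column (Ordinal cu) (ord_max : rowT)) = abscissa (4 * (g + k) * m).
    by congr (abscissa _); rewrite /= -mulSnr prednK //; lia.
  rewrite abscissa_unit; move: side xk; rewrite ler0_norm // -center_unit.
  rewrite -(natr1 (4 * (g + k))) => side xk; rewrite ltr_norml; apply/andP; split; lra.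
have [_ _ cu] := center_units k.
exists (Ordinal cu), ord0; split; first by apply/existsPn => k' /=; lia.
have -> : abscissa (column (Ordinal cu) (ord0 : rowT)) = abscissa ((4 * (g + k)).+2 * m).
  by congr (abscissa _); rewrite /= addn0.
rewrite abscissa_unit; move: side xk; rewrite gtr0_norm // -center_unit.
rewrite -(natr1 (4 * (g + k)).+1) => side xk; rewrite ltr_norml; apply/andP; split; lra.
Qed.

(** A point of the domain close to a circle is close to that circle in the vertical
direction, up to a square root. *)
Lemma near_hole (i : colT) y d (k : 'I_g) : 0 < d -> d <= 1 -> in_domain g (abscissa i) y ->
  low g (abscissa i) <= y -> inner k (abscissa i) y < d ^+ 2 ->
  exists (n : 'I_units) (t : rowT), [/\ hole n,
    `|abscissa i - abscissa (column n t)| < d, `|abscissa (column n t) - (4 * k)%:R| <= 1 &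
    y - low g (abscissa i) < d].
Proof.
set x := abscissa i => d_gt0 d1 [_ /(_ k) inn] ly; rewrite /inner in inn *.
have low0 : 0 <= low g x by exact: sqrtr_ge0.
have y0 : 0 <= y by exact: le_trans ly.
have kg := ltn_ord k.
have xE : (x - (4 * k)%:R) ^+ 2 = `|x - (4 * k)%:R| ^+ 2 by rewrite real_normK ?num_real.
have [xk|xk] := lerP `|x - (4 * k)%:R| 1 => small.
  have yd : y - low g x < d.
    apply: sqr_gap => //; rewrite low_sqr (low2_hole xk); lra.
  suff [n [t [nk cE]]] : exists (n : 'I_units) (t : rowT),
      (((n : nat) == 4 * (g + k))%N || ((n : nat) == (4 * (g + k)).+1)%N) /\ column n t = i.
    exists n, t; split=> //; first by apply/existsP; exists k.
      by rewrite cE subrr normr0.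
    exact: hole_bounds.
  have ilo : (4 * (g + k) * m <= i)%N.
    rewrite -abscissa_mono abscissa_unit -/x; move: xk; rewrite -center_unit ler_norml.
    by rewrite -(natr1 (4 * (g + k))) => /andP[]; lra.
  have ihi : (i <= (4 * (g + k)).+2 * m)%N.
    rewrite -abscissa_mono abscissa_unit -/x; move: xk; rewrite -center_unit ler_norml.
    by rewrite -(natr1 (4 * (g + k)).+1) => /andP[]; lra.
  have [im|im] := leqP i ((4 * (g + k)).+1 * m).
    have [cu _ _] := center_units k.
    have [n [t [nE cE]]] := unit_column cu ilo im.
    by exists n, t; rewrite nE eqxx.
  have [_ cu _] := center_units k.
  have [n [t [nE cE]]] := unit_column cu (ltnW im) ihi.
  by exists n, t; rewrite nE eqxx orbT.
have x1 : 1 <= `|x - (4 * k)%:R| ^+ 2 by rewrite -[X in X <= _](expr1n K 2) ler_sqr ?nnegrE // ltW.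
have yd : y - low g x < d.
  suff : y - 0 < d by lra.
  by apply: sqr_gap => //; rewrite expr0n /=; lra.
have xd : `|x - (4 * k)%:R| - 1 < d.
  apply: sqr_gap => //; [exact: ltW|rewrite expr1n; have := sqr_ge0 y; lra].
have [neg|pos] := lerP (x - (4 * k)%:R) 0.
  have [cu _ _] := center_units k.
  have nk : ((Ordinal cu : nat) == 4 * (g + k))%N || ((Ordinal cu : nat) == (4 * (g + k)).+1)%N.
    by rewrite eqxx.
  exists (Ordinal cu), ord0; split=> //; first by apply/existsP; exists k.
    have -> : abscissa (column (Ordinal cu) (ord0 : rowT)) = abscissa (4 * (g + k) * m).
      by congr (abscissa _); rewrite /= addn0.
    rewrite abscissa_unit; move: xk xd; rewrite ler0_norm // -center_unit.
    rewrite -(natr1 (4 * (g + k))) => xk xd; rewrite ltr_norml; apply/andP; split; lra.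
  exact: hole_bounds.
have [_ cu _] := center_units k.
have nk : ((Ordinal cu : nat) == 4 * (g + k))%N || ((Ordinal cu : nat) == (4 * (g + k)).+1)%N.
  by rewrite eqxx orbT.
exists (Ordinal cu), ord_max; split=> //; first by apply/existsP; exists k.
  have -> : abscissa (column (Ordinal cu) (ord_max : rowT)) = abscissa ((4 * (g + k)).+2 * m).
    by congr (abscissa _); rewrite /= -mulSnr.
  rewrite abscissa_unit; move: xk xd; rewrite gtr0_norm // -center_unit.
  rewrite -(natr1 (4 * (g + k)).+1) => xk xd; rewrite ltr_norml; apply/andP; split; lra.
exact: hole_bounds.
Qed.

(** A vertex with small y reaches the sheet with the opposite sign of y: go down
the column to the bottom row, along it to a unit outside the holes, where low
vanishes, and across the seam. *)
Lemma flip_y e d v : 0 < e -> 0 < d <= 1 -> column_modulus g e d -> row_modulus g e d ->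
  `|(place v).1.2| < d ->
  exists v1, v1.1.1 = (~~ v.1.1.1, v.1.1.2) /\ near_link (e + e + e) v v1.
Proof.
case: v => [[s i] j] e_gt0 /andP[d_gt0 d1] cm rm /=.
have xr := abscissa_bound i; have /andP[t0 t1] := ratio01 j.
have -> : `|signed s.1 (level g (abscissa i) (ratio j))| = level g (abscissa i) (ratio j).
  rewrite /signed; case: s.1; rewrite ?normrN ger0_norm // level_ge0 //; exact/andP.
move=> ld; have low0 : 0 <= low g (abscissa i) by exact: sqrtr_ge0.
have /andP[ll _] := level_bounds xr (ratio01 j).
have c1 : near_link e (s, i, j) (s, i, ord0).
  apply: (@column_move e d s i j ord0 cm); rewrite level0 ger0_norm ?subr_ge0 //; lra.
have [n [t [nh xd]]] := near_nonhole d_gt0 d1 (le_lt_trans ll ld).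
have c2 : near_link e (s, i, ord0) (s, column n t, ord0) by apply: row_move rm xd.
pose q : seam units := (n, false, s.2).
have sh x : seam_sheet hole q x = (x, s.2) by rewrite /seam_sheet /= (negbTE nh).
have c3 : near_link e (s, column n t, ord0) ((~~ s.1, s.2), column n t, ord0).
  have := @seam_walk e q t s.1 e_gt0; rewrite !sh /= -surjective_pairing; apply.
  rewrite /place /sheet_point /= level0 nonhole_low // /signed.
  by case: s.1; rewrite oppr0.
exists ((~~ s.1, s.2), column n t, ord0); split=> //.
by apply: near_link_trans c3; rewrite ?addr_gt0 //; apply: near_link_trans c2.
Qed.

(** A vertex with small z is close to one of the circles bounding the domain; cross
the seam of that circle. *)
Lemma flip_z e d v : 0 < e -> 0 < d <= 1 -> column_modulus g e d -> row_modulus g e d ->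
  `|(place v).2| < d ^+ g.+1 ->
  exists v1, v1.1.1 = (v.1.1.1, ~~ v.1.1.2) /\ near_link (e + e + e) v v1.
Proof.
case: v => [[s i] j] e_gt0 /andP[d_gt0 d1] cm rm /=.
have xr := abscissa_bound i; have t01 := ratio01 j.
set x := abscissa i in xr *; set y := level g x (ratio j).
have dom : in_domain g x y by exact: level_domain.
have /andP[ly yh] : low g x <= y <= high g x by exact: level_bounds.
have low0 : 0 <= low g x by exact: sqrtr_ge0.
have -> : `|signed s.2 (Num.sqrt (height2 g x y))| = Num.sqrt (height2 g x y).
  by rewrite /signed; case: s.2; rewrite ?normrN ger0_norm ?sqrtr_ge0.
rewrite -ltr_sqr ?nnegrE ?sqrtr_ge0 ?exprn_ge0 ?(ltW d_gt0) //.
rewrite sqr_sqrtr ?height2_ge0 // -exprM mulnC exprM => small.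
have d2_gt0 : 0 < d ^+ 2 by rewrite exprn_gt0.
have flip q t x' : seam_sheet hole q s.2 = s -> seam_sheet hole q (~~ s.2) = (s.1, ~~ s.2) ->
    x' = abscissa (column q.1.1 t) -> height2 g x' (level g x' (ratio (seam_row m q))) = 0 ->
    near_link e (s, column q.1.1 t, seam_row m q) ((s.1, ~~ s.2), column q.1.1 t, seam_row m q).
  move=> s1 s2 x'E h0; have := @seam_walk e q t s.2 e_gt0; rewrite s1 s2; apply.
  rewrite /place /sheet_point /= -x'E h0 sqrtr0 /signed.
  by case: s.2; rewrite oppr0.
have [outs|[k inns]] := height2_near_boundary d2_gt0 dom small.
  have [n [t cE]] : exists (n : 'I_units) (t : rowT), column n t = i by exact: column_onto.
  have c1 : near_link e (s, i, j) (s, i, ord_max).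
    apply: (@column_move e d s i j ord_max cm); rewrite level1 -/x -/y.
    rewrite distrC ger0_norm ?subr_ge0 //.
    apply: sqr_gap => //; last by rewrite high_sqr.
    exact: le_trans ly.
  have := flip (n, true, s.1) t x; rewrite /seam_sheet /= -surjective_pairing cE => c2.
  exists ((s.1, ~~ s.2), i, ord_max); split=> //.
  have {}c2 : near_link e (s, i, ord_max) ((s.1, ~~ s.2), i, ord_max).
    apply: c2 => [//|//||]; first by rewrite /x -cE.
    rewrite level1 /height2 /outer high_sqr //.
    by rewrite subrr mul0r.
  have : near_link (e + e) (s, i, j) ((s.1, ~~ s.2), i, ord_max) by apply: near_link_trans c2.
  by move=> c; apply: near_link_weak c; rewrite lerDl ltW.
have [n [t [nh xd tk yd]]] : exists (n : 'I_units) (t : rowT), [/\ hole n,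
    `|x - abscissa (column n t)| < d, `|abscissa (column n t) - (4 * k)%:R| <= 1 &
    y - low g x < d].
  exact: near_hole.
have c1 : near_link e (s, i, j) (s, i, ord0).
  by apply: (@column_move e d s i j ord0 cm); rewrite level0 ger0_norm ?subr_ge0.
have c2 : near_link e (s, i, ord0) (s, column n t, ord0) by apply: row_move rm xd.
have c3 : near_link e (s, column n t, ord0) ((s.1, ~~ s.2), column n t, ord0).
  have := flip (n, false, s.1) t (abscissa (column n t)).
  rewrite /seam_sheet /= nh -surjective_pairing; apply=> //.
  rewrite /seam_row /= level0 /height2 (bigD1 k) //= {1}/inner low_sqr (low2_hole tk).
  by rewrite addrCA subrr addr0 subrr mul0r mulr0.
exists ((s.1, ~~ s.2), column n t, ord0); split=> //.
by apply: near_link_trans c3; rewrite ?addr_gt0 //; apply: near_link_trans c2.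
Qed.

End FineGrid.

Section FineModel.
Variables (K : realType) (g : nat).
Local Notation r := (radius K g).

Lemma moduli e : 0 < e -> exists d, [/\ 0 < d <= 1, @column_modulus K g e d & @row_modulus K g e d].
Proof.
move=> e0; have [d1 d10 m1] := @sheet_modulus K g e e0.
have [d2 d20 m2] := @level_modulus K g e e0.
exists (Num.min 1 (Num.min d1 d2)); split.
- by rewrite !lt_min ltr01 d10 d20 ge_min lexx.
- by move=> s x t t' xr t01 t01'; rewrite !lt_min => /and3P[_ _]; exact: m2.
- move=> s x x' t xr xr' t01; rewrite !lt_min => /and3P[_ xx _].
  by apply: m1 => //; rewrite subrr normr0.
Qed.

Lemma opposite_signs (b b' : bool) (y y' d : K) : 0 <= y -> 0 <= y' -> b != b' ->
  `|signed b y - signed b' y'| < d -> `|signed b y| < d.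
Proof.
by case: b; case: b' => //= y0 y'0 _; rewrite ltr_norml => /andP[? ?];
  rewrite ltr_norml; apply/andP; split; lra.
Qed.

(** Close vertices on sheets with different signs of y have small y, and similarly
for z; so flip y, then z, and finish within a sheet.  The tolerances are chosen
backwards: each step must leave the distance within the reach of the next. *)
Theorem fine_links e : 0 < e -> exists2 d, 0 < d & forall m, (0 < m)%N ->
  forall v v', `|place K v - place K v'| < d -> @near_link K g m e v v'.
Proof.
move=> e0.
(* e = e/3 + e/3 + e/3, each flip using three steps of e/9 and the last walk two
   steps of e/6. *)
have e6 : 0 < e / 6 by rewrite divr_gt0.
have [d1 [/andP[d10 _] cm1 _]] := moduli e6.
have e2 : 0 < Num.min (e / 6) (d1 / 2) by rewrite lt_min e6 divr_gt0.
have [d2 [/andP[d20 _] _ rm2]] := moduli e2.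
pose ds := Num.min d2 (d1 / 2).
have ds0 : 0 < ds by rewrite lt_min d20 divr_gt0.
have ez : 0 < Num.min (e / 9) (ds / 9) by rewrite lt_min !divr_gt0.
have [dz [dz01 cmz rmz]] := moduli ez.
pose zz := dz ^+ g.+1.
have zz0 : 0 < zz by rewrite exprn_gt0 //; case/andP: dz01.
have ey : 0 < Num.min (Num.min (e / 9) (ds / 9)) (zz / 6) by rewrite lt_min ez divr_gt0.
have [dy [dy01 cmy rmy]] := moduli ey.
have dy0 : 0 < dy by case/andP: dy01.
pose d := Num.min (ds / 3) (Num.min dy (zz / 2)).
exists d => [|m m0 v v' vv]; first by rewrite !lt_min dy0 !divr_gt0.
have ly_ge0 (w : gvertex (units g) m m) : 0 <= level g (abscissa K g m w.1.2) (ratio K m w.2).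
  by rewrite level_ge0 ?abscissa_bound ?ratio01.
have [v1 [sv1 l1]] : exists v1, v1.1.1 = (v'.1.1.1, v.1.1.2) /\
    near_link (Num.min (Num.min (e / 9) (ds / 9)) (zz / 6) *+ 3) v v1.
  have [sy|sy] := eqVneq v.1.1.1 v'.1.1.1.
    by exists v; rewrite -sy -surjective_pairing; split=> //; exact: connect0.
  have [|v1 [sv1 l1]] := flip_y m0 ey dy01 cmy rmy (v := v).
    move: vv; rewrite dist3_lt => /and3P[_ vy _].
    apply: lt_le_trans (_ : d <= dy); last by rewrite !ge_min lexx !orbT.
    by apply: opposite_signs vy; rewrite ?ly_ge0.
  exists v1; split; last by rewrite mulrS mulr2n addrA.
  by rewrite sv1; move: sy; case: v.1.1.1; case: v'.1.1.1.
have ey3 : 0 < Num.min (Num.min (e / 9) (ds / 9)) (zz / 6) *+ 3 by rewrite pmulrn_lgt0.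
have v1v := near_link_last ey3 l1.
have [v2 [sv2 l2]] : exists v2, v2.1.1 = v'.1.1 /\
    near_link (Num.min (e / 9) (ds / 9) *+ 3) v1 v2.
  have [sz|sz] := eqVneq v.1.1.2 v'.1.1.2.
    by exists v1; rewrite sv1 sz -surjective_pairing; split=> //; exact: connect0.
  have [|v2 [sv2 l2]] := flip_z m0 ez dz01 cmz rmz (v := v1).
    have vz : `|(place K v).2| < d.
      move: vv; rewrite dist3_lt => /and3P[_ _ vz].
      by apply: opposite_signs vz; rewrite ?sqrtr_ge0.
    move: v1v; rewrite dist3_lt => /and3P[_ _ v1z].
    have dzz : d <= zz / 2 by rewrite !ge_min lexx !orbT.
    have ezz : Num.min (Num.min (e / 9) (ds / 9)) (zz / 6) *+ 3 <= zz / 2.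
      have : Num.min (Num.min (e / 9) (ds / 9)) (zz / 6) <= zz / 6 by rewrite ge_min lexx orbT.
      lra.
    have := ler_normD ((place K v1).2 - (place K v).2) (place K v).2; rewrite subrK -/zz; lra.
  exists v2; split; last by rewrite mulrS mulr2n addrA.
  rewrite sv2 sv1; move: sz; case: v.1.1.2; case: v'.1.1 => a [] //.
have ez3 : 0 < Num.min (e / 9) (ds / 9) *+ 3 by rewrite pmulrn_lgt0.
have v2v1 := near_link_last ez3 l2.
have l3 : near_link (e / 6 + e / 6) v2 v'.
  apply: (same_sheet_link m0 e6 cm1 rm2 sv2); rewrite -/ds.
  have a1 : Num.min (e / 9) (ds / 9) <= ds / 9 by rewrite ge_min lexx orbT.
  have a2 : Num.min (Num.min (e / 9) (ds / 9)) (zz / 6) <= ds / 9.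
    by rewrite !ge_min lexx !orbT.
  have a3 : d <= ds / 3 by rewrite ge_min lexx.
  have t1 := ler_normD (place K v2 - place K v1) (place K v1 - place K v').
  have t2 := ler_normD (place K v1 - place K v) (place K v - place K v').
  rewrite !addrA !subrK in t1 t2; lra.
have := near_link_trans _ _ (near_link_trans ey3 ez3 l1 l2) l3.
have e66 : 0 < e / 6 + e / 6 by lra.
move=> /(_ (addr_gt0 ey3 ez3) e66); apply: near_link_weak.
have a1 : Num.min (e / 9) (ds / 9) <= e / 9 by rewrite ge_min lexx.
have a2 : Num.min (Num.min (e / 9) (ds / 9)) (zz / 6) <= e / 9 by rewrite !ge_min lexx.
lra.
Qed.

Theorem dense_places d : 0 < d -> exists2 m, (0 < m)%N & forall p : K * K * K, surface g p ->
  exists v : gvertex (units g) m m, `|place K v - p| < d.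
Proof.
move=> d0; have [d' d'0 mod] := @sheet_modulus K g d d0.
pose m := (Num.truncn (d'^-1)).+1.
have mP : (m%:R)^-1 < d'.
  rewrite invf_plt ?posrE ?ltr0n //; exact: truncnS_gt.
have m0 : (0 < m)%N by [].
exists m => // p /sheet_point_onto[s [x [t [xr t01 ->]]]].
have approx (u : K) (n : nat) : 0 <= u <= (n * m)%:R -> exists i : 'I_(n * m).+1, `|i%:R - u| < 1.
  move=> /andP[u0 un]; have tn : (Num.truncn u < (n * m).+1)%N.
    by rewrite ltnS truncn_le_nat // (le_lt_trans un) // ltr_nat.
  exists (Ordinal tn) => /=; have /andP[] := truncn_itv u0; rewrite ltr_norml -natr1.
  by move=> ? ?; apply/andP; split; lra.
have scale (u v : K) : `|u - v * m%:R| < 1 -> `|u / m%:R - v| < d'.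
  move=> uv; apply: lt_trans mP.
  have -> : u / m%:R - v = (u - v * m%:R) / m%:R by field; rewrite pnatr_eq0 -lt0n.
  by rewrite normrM normfV normr_nat -[X in _ < X]mul1r ltr_pM2r ?invr_gt0 ?ltr0n.
have [i iP] : exists i : 'I_(units g * m).+1, `|i%:R - (x + r) * m%:R| < 1.
  apply: approx; move: xr; rewrite ler_norml natrM => /andP[x1 x2].
  rewrite mulr_ge0 ?ler0n //=; last lra.
  rewrite ler_pM2r ?ltr0n // /units natrM -/r; rewrite /radius in x1 x2 *; lra.
have [j jP] : exists j : 'I_(1 * m).+1, `|j%:R - t * m%:R| < 1.
  apply: approx; move: t01 => /andP[t0 t1].
  by rewrite mul1n mulr_ge0 ?ler0n //= ger_pMl // ltr0n.
have jm : (j < m.+1)%N by rewrite -[X in (_ < X.+1)%N]mul1n.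
exists (s, i, Ordinal jm); rewrite /place /=; apply: mod => //.
- exact: abscissa_bound.
- exact: (@ratio01 K m m0 (Ordinal jm)).
- by have := scale _ _ iP; rewrite /abscissa -addrA (addrC (- r)) opprD.
- exact: scale.
Qed.

End FineModel.

(** * No large bipartite system of continua *)

Lemma common_lower_bound (K : realType) (T : finType) (P : T -> K -> Prop) :
  (forall t, exists2 e, 0 < e & P t e) ->
  (forall t e e', e' <= e -> P t e -> P t e') ->
  exists2 e, 0 < e & forall t, P t e.
Proof.
move=> ex mono; have /boolp.choice[f fP] t : exists e, 0 < e /\ P t e.
  by have [e e0 Pe] := ex t; exists e.
exists (\big[Num.min/1]_t f t).
  by apply/bigmin_gtP; split=> // t _; have [] := fP t.
by move=> t; have [_] := fP t; apply: mono; exact: bigmin_le.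
Qed.

Section Continua.
Variables (K : realType) (g : nat).

Definition node_set n (A : 'I_3 -> set (K * K * K)) (B : 'I_n -> set (K * K * K)) u :=
  match u with inl i => A i | inr j => B j end.

(** A copy of K_(3,n) whose vertices and edges are thickened to continua. *)
Definition bipartite_continua n (A : 'I_3 -> set (K * K * K))
    (B : 'I_n -> set (K * K * K)) (C : 'I_3 -> 'I_n -> set (K * K * K)) : Prop :=
  [/\ forall u, [/\ node_set A B u `<=` surface g, compact (node_set A B u) & connected (node_set A B u)],
      forall i j, [/\ C i j `<=` surface g, compact (C i j) & connected (C i j)],
      forall u v, u <> v -> node_set A B u `&` node_set A B v = set0,
      forall i j i' j', (i, j) <> (i', j') -> C i j `&` C i' j' = set0 &
      forall i j u, C i j `&` node_set A B u !=set0 <-> u = inl i \/ u = inr j].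

(** The vertices reachable from one vertex near S while staying within e / 2 of S;
connectedness of S makes this set contain all vertices very close to S. *)
Lemma blob m (e d : K) (S : set (K * K * K)) : (0 < m)%N -> 0 < d ->
  d <= e / 4 ->
  (forall v v', `|place K v - place K v'| < 3 * d -> @near_link K g m (e / 4) v v') ->
  (forall p, surface g p -> exists v : gvertex (units g) m m, `|place K v - p| < d) ->
  S `<=` surface g -> connected S -> S !=set0 ->
  exists X : {set gvertex (units g) m m}, [/\
    forall v, v \in X -> exists2 p, S p & `|place K v - p| < e / 2,
    {in X &, forall a b, connect (neighbour_in (@gd0 _ m m (@hole g)) (@gd1 _ m m (@hole g)) X) a b} &
    forall p v, S p -> `|place K v - p| < d -> v \in X].
Proof.
move=> m0 d0 de links dense SS cS [p0 Sp0].
pose Big := [set v : gvertex (units g) m m | `[< exists2 p, S p & `|place K v - p| < e / 2 >] ]%SET.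
pose nb Y := neighbour_in (@gd0 _ m m (@hole g)) (@gd1 _ m m (@hole g)) Y.
have [v0 v0p] := dense p0 (SS _ Sp0).
pose X := [set w | connect (nb Big) v0 w]%SET.
have XB v : v \in X -> exists2 p, S p & `|place K v - p| < e / 2.
  rewrite inE => /connect_in_walk[p [_ <- pB]].
  case/lastP: p pB => [_|p w pB]; first by exists p0 => //; rewrite /=; lra.
  by have := pB w; rewrite mem_rcons mem_head last_rcons inE => /(_ isT)/asboolP.
have sym := neighbour_in_sym (@gd0 _ m m (@hole g)) (@gd1 _ m m (@hole g)).
have step p q v w : S p -> `|place K w - p| < d -> S q -> `|place K v - q| < d ->
    `|p - q| < d -> w \in X -> v \in X.
  move=> Sp wp Sq vq pq; rewrite !inE => /connect_trans; apply.
  have : near_link (e / 4) w v.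
    apply: links; have := ler_normD (place K w - p) (p - place K v).
    have := ler_normD (p - q) (q - place K v).
    rewrite !addrA !subrK [`|q - _|]distrC; lra.
  apply: connect_sub => a b /and3P[aw bw ab]; apply: connect1; rewrite /nb /neighbour_in ab andbT.
  have inB c : c \in [set w0 : gvertex (units g) m m | `|place K w0 - place K w| < e / 4]%SET -> c \in Big.
    rewrite inE => cw; rewrite inE; apply/asboolP; exists p => //.
    have := ler_normD (place K c - place K w) (place K w - p); rewrite !addrA !subrK; lra.
  by rewrite !inB.
exists X; split=> //.
  move=> a b aX bX; have into c : c \in X -> connect (nb X) v0 c.
    rewrite inE => /connectP[p]; elim/last_ind: p c => [c _ ->//|p w IH c].
    rewrite rcons_path last_rcons => /andP[pp lw] ->.
    have pl := IH _ pp erefl.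
    apply: connect_trans pl (connect1 _); case/and3P: lw => lB wB lw.
    have lX : last v0 p \in X by rewrite inE; apply/connectP; exists p.
    rewrite /nb /neighbour_in lw andbT lX /= inE.
    rewrite inE in lX; apply: connect_trans lX (connect1 _).
    by rewrite /nb /neighbour_in lB wB.
  apply: connect_trans (into b bX); rewrite sym; exact: into.
suff all : forall p, S p -> (forall v, `|place K v - p| < d -> v \in X).
  by move=> p v /all; apply.
apply: (@connected_chain K (K * K * K)%type S (fun p => forall v, `|place K v - p| < d -> v \in X) d p0) => //.
  move=> p q Sp Sq pq Xp v vq; have [w wp] := dense p (SS _ Sp).
  exact: (step p q v w Sp wp Sq vq pq (Xp w wp)).
move=> v vp; apply: (step p0 p0 v v0) => //; first by rewrite subrr normr0.
by rewrite inE connect0.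
Qed.

(** With a tolerance smaller than all the distances between disjoint members, the
blobs of the continua form a bipartite minor of a fine grid. *)
Theorem no_bipartite_continua n A B C : @bipartite_continua n.+1 A B C ->
  (n <= 16 * (4 * g + 1) + 3)%N.
Proof.
case; set X := node_set A B => XP CP disjX disjC CX.
pose Cs k := C k.1 k.2.
have CsE k u : u != inl k.1 -> u != inr k.2 -> Cs k `&` X u = set0.
  move=> /eqP ul /eqP ur; apply/eqP/negPn/negP => /set0P/CX[]//.
have [e1 e10 e1P] : exists2 e : K, 0 < e & forall uv : ('I_3 + 'I_n.+1) * ('I_3 + 'I_n.+1),
    uv.1 != uv.2 -> forall p q, X uv.1 p -> X uv.2 q -> e <= `|p - q|.
  apply: common_lower_bound => [[u v]|uv e e' ee Pe uv' p q Xp Xq]; last first.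
    exact: le_trans ee (Pe uv' p q Xp Xq).
  have [->|uv] := eqVneq u v; first by exists 1; rewrite //= eqxx.
  have [_ cu _] := XP u; have [_ cv _] := XP v.
  have [e e0 eP] := compact_separated cu cv (disjX _ _ (elimN eqP uv)).
  by exists e.
have [e2 e20 e2P] : exists2 e : K, 0 < e & forall kk : ('I_3 * 'I_n.+1) * ('I_3 * 'I_n.+1),
    kk.1 != kk.2 -> forall p q, Cs kk.1 p -> Cs kk.2 q -> e <= `|p - q|.
  apply: common_lower_bound => [[[i j] [i' j']]|uv e e' ee Pe uv' p q Xp Xq]; last first.
    exact: le_trans ee (Pe uv' p q Xp Xq).
  have [->|uv] := eqVneq (i, j) (i', j'); first by exists 1; rewrite //= eqxx.
  have [_ cu _] := CP i j; have [_ cv _] := CP i' j'.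
  have [e e0 eP] := compact_separated cu cv (disjC _ _ _ _ (elimN eqP uv)).
  by exists e.
have [e3 e30 e3P] : exists2 e : K, 0 < e & forall ku : ('I_3 * 'I_n.+1) * ('I_3 + 'I_n.+1),
    (ku.2 != inl ku.1.1) && (ku.2 != inr ku.1.2) ->
    forall p q, Cs ku.1 p -> X ku.2 q -> e <= `|p - q|.
  apply: common_lower_bound => [[[i j] u]|uv e e' ee Pe uv' p q Xp Xq]; last first.
    exact: le_trans ee (Pe uv' p q Xp Xq).
  have [/andP[ul ur]|no] := boolP ((u != inl i) && (u != inr j)); last first.
    by exists 1; rewrite //= (negbTE no).
  have [_ cu _] := CP i j; have [_ cv _] := XP u.
  have [e e0 eP] := compact_separated cu cv (CsE (i, j) u ul ur).
  by exists e.
pose e := Num.min e1 (Num.min e2 e3).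
have e0 : 0 < e by rewrite !lt_min e10 e20 e30.
have e4 : 0 < e / 4 by rewrite divr_gt0.
have [d d0 links] := @fine_links K g _ e4.
pose d' := Num.min (d / 3) (e / 4).
have d'0 : 0 < d' by rewrite lt_min e4 divr_gt0.
have [m m0 dense] := @dense_places K g _ d'0.
have links' v v' : `|place K v - place K v'| < 3 * d' -> @near_link K g m (e / 4) v v'.
  move=> vv; apply: links => //; apply: lt_le_trans vv _.
  have : d' <= d / 3 by rewrite ge_min lexx.
  lra.
have d'e : d' <= e / 4 by rewrite ge_min lexx orbT.
have blobs S := @blob m e d' S m0 d'0 d'e links' dense.
have meetl i j : C i j `&` X (inl i) !=set0 := (CX i j (inl i)).2 (or_introl erefl).
have meetr i j : C i j `&` X (inr j) !=set0 := (CX i j (inr j)).2 (or_intror erefl).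
have /boolp.choice[XX XXP] u : exists Y : {set gvertex (units g) m m}, [/\
    forall v, v \in Y -> exists2 p, X u p & `|place K v - p| < e / 2,
    {in Y &, forall a b, connect (neighbour_in (@gd0 _ m m (@hole g)) (@gd1 _ m m (@hole g)) Y) a b} &
    forall p v, X u p -> `|place K v - p| < d' -> v \in Y].
  have [Xs _ Xc] := XP u; apply: blobs => //.
  case: u {Xs Xc} => [i|j]; first by have [p []] := meetl i ord0; exists p.
  by have [p []] := meetr ord0 j; exists p.
have /boolp.choice[MM MMP] k : exists Y : {set gvertex (units g) m m}, [/\
    forall v, v \in Y -> exists2 p, Cs k p & `|place K v - p| < e / 2,
    {in Y &, forall a b, connect (neighbour_in (@gd0 _ m m (@hole g)) (@gd1 _ m m (@hole g)) Y) a b} &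
    forall p v, Cs k p -> `|place K v - p| < d' -> v \in Y].
  have [Xs _ Xc] := CP k.1 k.2; apply: blobs => //.
  by have [p []] := meetl k.1 k.2; exists p.
have apart (Y Z : {set gvertex (units g) m m}) (S T : set (K * K * K)) :
    (forall v, v \in Y -> exists2 p, S p & `|place K v - p| < e / 2) ->
    (forall v, v \in Z -> exists2 p, T p & `|place K v - p| < e / 2) ->
    (forall p q, S p -> T q -> e <= `|p - q|) -> [disjoint Y & Z]%B.
  move=> YS ZT ST; apply/pred0Pn => -[v /andP[/YS[p Sp vp] /ZT[q Tq vq]]].
  have := ST p q Sp Tq; have := ler_normD (p - place K v) (place K v - q).
  rewrite addrA subrK [`|p - place K v|]distrC; lra.
have meet (S T : set (K * K * K)) (Y Z : {set gvertex (units g) m m}) :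
    S `<=` surface g -> S `&` T !=set0 ->
    (forall p v, S p -> `|place K v - p| < d' -> v \in Y) ->
    (forall p v, T p -> `|place K v - p| < d' -> v \in Z) -> exists a, a \in Z :&: Y.
  move=> Ss [p [Sp Tp]] SY TZ; have [v vp] := dense p (Ss _ Sp).
  by exists v; rewrite inE (SY p) // (TZ p).
have -> : (16 * (4 * g + 1) = 2 * #|seam (units g)|)%N.
  rewrite !card_prod card_ord card_bool /units; lia.
apply: (@bounded_bipartite_minor _ _ _ _ (@gd0 _ m m (@hole g)) (@gd1 _ m m (@hole g))
  (@gbd _ m m (@hole g)) (@seam_parity _ m m) _ _ _ n XX MM).
- exact: gtwo_faces.
- exact: gfaces_closed.
- exact: grid_fill.
- by move=> u; have [_ h _] := XXP u.
- by move=> k; have [_ h _] := MMP k.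
- move=> k; have [_ _ h] := MMP k; have [_ _ h'] := XXP (inl k.1).
  by have [Cs' _ _] := CP k.1 k.2; apply: meet h h' => //; exact: meetl.
- move=> k; have [_ _ h] := MMP k; have [_ _ h'] := XXP (inr k.2).
  by have [Cs' _ _] := CP k.1 k.2; apply: meet h h' => //; exact: meetr.
- move=> u v uv; have [h _ _] := XXP u; have [h' _ _] := XXP v.
  apply: apart h h' _ => p q Xp Xq; apply: le_trans (e1P (u, v) uv p q Xp Xq).
  by rewrite ge_min lexx.
- move=> u v uv; have [h _ _] := MMP u; have [h' _ _] := MMP v.
  apply: apart h h' _ => p q Xp Xq; apply: le_trans (e2P (u, v) uv p q Xp Xq).
  by rewrite !ge_min lexx orbT.
- move=> k u ul ur; have [h _ _] := MMP k; have [h' _ _] := XXP u.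
  have kP : (u != inl k.1) && (u != inr k.2) by rewrite ul.
  apply: apart h h' _ => p q Xp Xq; apply: le_trans (e3P (k, u) kP p q Xp Xq).
  by rewrite !ge_min lexx !orbT.
Qed.

End Continua.

(** * Obstructions to drawings *)

Lemma compact_bigcup_fin (X : topologicalType) (T : finType) (F : T -> set X) :
  (forall t, compact (F t)) -> compact (\bigcup_t F t).
Proof.
move=> cF; have -> : \bigcup_t F t = \big[setU/set0]_(t <- enum T) F t.
  by rewrite -bigcup_seq; apply: eq_bigcupl; split=> t //= _; rewrite mem_enum.
exact: bigsetU_compact.
Qed.

Section Drawings.
Variables (K : realType) (T : Type) (G : sgraph T) (g : nat).
Variables (pos : T -> K * K * K) (edge : T -> T -> set (K * K * K)).
Hypothesis drawing : is_drawing G (@surface K g) pos edge.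
Local Notation P := (K * K * K)%type.

Definition arc_map u v (f : K -> P) :=
  [/\ {within `[0, 1], continuous f}, set_inj `[0, 1] f,
      f 0 = pos u, f 1 = pos v & edge u v = f @` `[0, 1]].

Lemma arc_map_exists u v : adj G u v -> exists f, arc_map u v f.
Proof. by case: drawing => _ arcs _ _ /arcs[[f [? ? ? ? ?]] _ _]; exists f. Qed.

Definition piece (f : K -> P) lo hi : set P := f @` `[lo, hi].

Lemma piece_compact u v f lo hi : arc_map u v f -> 0 <= lo -> hi <= 1 -> compact (piece f lo hi).
Proof.
move=> [cf _ _ _ _] l0 h1; apply: continuous_compact; last exact: segment_compact.
apply: continuous_subspaceW cf => s; rewrite /= !in_itv /= => /andP[ls sh].
by rewrite (le_trans l0 ls) (le_trans sh h1).
Qed.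

Lemma piece_connected u v f lo hi : arc_map u v f -> 0 <= lo -> hi <= 1 -> connected (piece f lo hi).
Proof.
move=> [cf _ _ _ _] l0 h1; apply: connected_continuous_connected; first exact: segment_connected.
apply: continuous_subspaceW cf => s; rewrite /= !in_itv /= => /andP[ls sh].
by rewrite (le_trans l0 ls) (le_trans sh h1).
Qed.

Lemma piece_edge u v f lo hi : arc_map u v f -> 0 <= lo -> hi <= 1 -> piece f lo hi `<=` edge u v.
Proof.
move=> [_ _ _ _ ->] l0 h1 p [s]; rewrite /= in_itv /= => /andP[ls sh] <-.
by exists s; rewrite //= in_itv /= (le_trans l0 ls) (le_trans sh h1).
Qed.

Lemma piece_surface u v f lo hi : adj G u v -> arc_map u v f -> 0 <= lo -> hi <= 1 ->
  piece f lo hi `<=` surface g.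
Proof.
move=> uv fP l0 h1 p /(piece_edge fP l0 h1); case: drawing => _ arcs _ _.
by have [_ h _] := arcs u v uv; exact: h.
Qed.

Lemma arc_map_inj u v f s s' : arc_map u v f -> 0 <= s <= 1 -> 0 <= s' <= 1 ->
  f s = f s' -> s = s'.
Proof. by move=> [_ inj _ _ _] s01 s01'; apply: inj; rewrite inE /= in_itv. Qed.

Lemma pos_inj u v : verts G u -> verts G v -> pos u = pos v -> u = v.
Proof. by case: drawing => -[_ inj] _ _ _ Gu Gv; apply: inj; rewrite inE. Qed.

Lemma adj_neq u v : adj G u v -> u <> v.
Proof. by move=> uv e; rewrite e in uv; exact: adj_irrefl uv. Qed.

Lemma adj_vertsr u v : adj G u v -> verts G v.
Proof. by move=> uv; apply: adj_vertsl (adj_sym uv). Qed.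

Lemma edges_meet u v u' v' p : adj G u v -> adj G u' v' -> [set u; v] <> [set u'; v'] ->
  edge u v p -> edge u' v' p -> exists w, [/\ p = pos w, w = u \/ w = v & w = u' \/ w = v'].
Proof.
move=> uv uv' ne up up'; case: drawing => _ _ _ /(_ u v u' v' uv uv' ne) sub.
by have [w [wu wu'] <-] := sub p (conj up up'); exists w; split.
Qed.

Lemma arc_end u v f s w : adj G u v -> arc_map u v f -> 0 <= s <= 1 -> f s = pos w ->
  w = u \/ w = v -> s = 0 /\ w = u \/ s = 1 /\ w = v.
Proof.
move=> uv fP s01 fs; have [_ _ f0 f1 _] := fP.
case=> wE; [left|right]; split=> //; apply: (arc_map_inj fP) => //.
- by rewrite lexx ler01.
- by rewrite fs wE f0.
- by rewrite lexx ler01.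
- by rewrite fs wE f1.
Qed.

Section ThirdLeg.
Variables (n : nat) (a : bool -> T) (t : 'I_n.+1 -> T).
Hypotheses (n_large : (16 * (4 * g + 1) + 3 < n)%N).
Hypotheses (a_neq : a false <> a true) (t_inj : injective t).
Hypothesis at_adj : forall b j, adj G (a b) (t j).
Variables (A2 : set P) (D E : 'I_n.+1 -> set P).
Hypothesis A2P : [/\ A2 `<=` surface g, compact A2 & connected A2].
Hypothesis DP : forall j, [/\ D j `<=` surface g, compact (D j) & connected (D j)].
Hypothesis EP : forall j, [/\ E j `<=` surface g, compact (E j) & connected (E j)].
Hypothesis EtP : forall j, E j (pos (t j)).
Hypothesis DA2 : forall j, D j `&` A2 !=set0.
Hypothesis DE : forall j, D j `&` E j !=set0.
Hypothesis A2E : forall j, A2 `&` E j = set0.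
Hypothesis DD : forall j j', j <> j' -> D j `&` D j' = set0.
Hypothesis DE' : forall j j', j <> j' -> D j `&` E j' = set0.
Hypothesis EE : forall j j', j <> j' -> E j `&` E j' = set0.
Hypothesis A2arm : forall b j, A2 `&` edge (a b) (t j) = set0.
Hypothesis Darm : forall b j j', D j `&` edge (a b) (t j') = set0.
Hypothesis Earm : forall b j j', E j `&` edge (a b) (t j') `<=` [set pos (t j)].

(** Two vertices a of the graph with N common neighbours t, and an abstract third
vertex A2 of K_(3,N): the sets D j lead from A2 to the sets E j, which touch the
arms only in t j.  Cutting the arms in thirds gives the members of a bipartite
system of continua. *)
Lemma third_leg : False.
Proof.
have a_inj : injective a by case=> -[] // /esym // /a_neq.
have neq b j : a b <> t j by exact: adj_neq.
have /boolp.choice[f0 fP0] (bj : bool * 'I_n.+1) : exists f, arc_map (a bj.1) (t bj.2) f.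
  by apply: arc_map_exists; exact: at_adj.
pose f b j := f0 (b, j); have fP b j : arc_map (a b) (t j) (f b j) by exact: (fP0 (b, j)).
have meet b j s b' j' s' : 0 <= s <= 1 -> 0 <= s' <= 1 -> f b j s = f b' j' s' ->
    [\/ [/\ b = b', j = j' & s = s'], [/\ b = b', s = 0 & s' = 0] |
        [/\ j = j', s = 1 & s' = 1]].
  move=> s01 s01' ss; have [[bb jj]|ne] := eqVneq (b, j) (b', j').
    by rewrite -bb -jj in ss *; constructor 1; split=> //; exact: (arc_map_inj (fP b j)) ss.
  have ne' : [set a b; t j] <> [set a b'; t j'].
    move=> eq; case/eqP: ne; congr (_, _).
      have : [set a b'; t j'] (a b) by rewrite -eq; left.
      by case=> [/a_inj//|/neq].
    have : [set a b'; t j'] (t j) by rewrite -eq; right.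
    by case=> [/esym/neq//|/t_inj].
  have in1 : edge (a b) (t j) (f b j s).
    by have [_ _ _ _ ->] := fP b j; exists s; rewrite //= in_itv.
  have in2 : edge (a b') (t j') (f b j s).
    by have [_ _ _ _ ->] := fP b' j'; exists s'; rewrite ?ss //= in_itv.
  have [w [pw w1 w2]] := edges_meet (at_adj b j) (at_adj b' j') ne' in1 in2.
  have := arc_end (at_adj b j) (fP b j) s01 pw w1.
  rewrite ss in pw; have := arc_end (at_adj b' j') (fP b' j') s01' pw w2.
  case=> -[s0' w'E] [] [s0 wE]; rewrite wE in w'E.
  - by constructor 2; split=> //; exact: a_inj.
  - by case: (neq b' j); rewrite w'E.
  - by case: (neq b j').
  - by constructor 3; split=> //; exact: t_inj.
pose leg (i : 'I_3) : option bool := match val i with 0%N => Some false | 1%N => Some true | _ => None end.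
have leg_inj : injective leg.
  by move=> [[|[|[|//]]] i3] [[|[|[|//]]] i3'] //= _; exact: val_inj.
have itv (lo hi s : K) : [set` `[lo, hi]] s -> lo <= s <= hi by rewrite /= in_itv.
have ends : [/\ (0 : K) <= 1 / 3, (1 / 3 : K) <= 1, (0 : K) <= 2 / 3 & (2 / 3 : K) <= 1] by split; lra.
case: ends => t0 t1 tt0 tt1.
have o01 : (0 : K) <= (1 : K) <= 1 by apply/andP; split; lra.
pose A i := match leg i with Some b => \bigcup_j piece (f b j) 0 (1 / 3) | None => A2 end.
pose B j := (\bigcup_b piece (f b j) (2 / 3) 1) `|` E j.
pose C i j := match leg i with Some b => piece (f b j) (1 / 3) (2 / 3) | None => D j end.
have third (i : 'I_3) : leg i = None \/ exists b, leg i = Some b.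
  by case: (leg i) => [b|]; [right; exists b|left].
have pieceE b j lo hi p : 0 <= lo -> hi <= 1 -> piece (f b j) lo hi p ->
    exists s, [/\ lo <= s <= hi, 0 <= s <= 1, p = f b j s & edge (a b) (t j) p].
  move=> l0 h1 pp; have ep := piece_edge (fP b j) l0 h1 pp.
  case: pp => s /itv/andP[ls sh] pE; exists s; split=> //; first by rewrite ls.
  by rewrite (le_trans l0 ls) (le_trans sh h1).
have AB i j : A i `&` B j = set0.
  rewrite -subset0 /A /B => p [].
  case: (leg i) => [b [j1 _ /pieceE[]// s [s1 s01 pE pe]]|Ap].
    case=> [[b' _ /pieceE[]// s' [s1' s01' pE' _]]|Ep].
      rewrite pE' in pE; case: (meet _ _ _ _ _ _ s01' s01 pE) => -[? ? ?]; lra.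
    have /= := Earm (conj Ep pe); have [_ _ _ f1 _] := fP b j.
    move=> pt; have [_ _ _ f1' _] := fP b j1.
    have s1E : s <> 1 by lra.
    have : f b j1 s = f b j 1 by rewrite -pE f1.
    by case/(meet _ _ _ _ _ _ s01 o01) => -[? ? ?]; lra.
  case=> [[b' _ /pieceE[]// s' [s1' s01' pE' pe]]|Ep].
    by rewrite -(A2arm b' j).
  by rewrite -(A2E j).
have AA i i' : i <> i' -> A i `&` A i' = set0.
  move=> ii; rewrite -subset0 /A => p [].
  case: (leg i) (leg_inj i) => [b|] linj; case E' : (leg i') => [b'|].
  - move=> [j _ /pieceE[]// s [s1 s01 pE pe]] [j' _ /pieceE[]// s' [s1' s01' pE' _]].
    have bb : b <> b' by move=> bb; case: ii; apply: linj; rewrite E' bb.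
    rewrite pE' in pE; case: (meet _ _ _ _ _ _ s01' s01 pE) => -[? ? ?]; first by case: bb.
      by case: bb.
    lra.
  - by move=> [j _ /pieceE[]// s [s1 s01 pE pe]] Ap; rewrite -(A2arm b j).
  - by move=> Ap [j _ /pieceE[]// s [s1 s01 pE pe]]; rewrite -(A2arm b' j).
  - by case: ii; apply: linj; rewrite E'.
have BB j j' : j <> j' -> B j `&` B j' = set0.
  move=> jj; rewrite -subset0 /B => p [].
  case=> [[b _ /pieceE[]// s [s1 s01 pE pe]]|Ep] [[b' _ /pieceE[]// s' [s1' s01' pE' pe']]|Ep'].
  - rewrite pE' in pE; case: (meet _ _ _ _ _ _ s01' s01 pE) => -[? ? ?].
    + by case: jj.
    + lra.
    + by case: jj.
  - have /= pt := Earm (conj Ep' pe); have [_ _ _ f1 _] := fP b j'.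
    have : f b j s = f b j' 1 by rewrite -pE f1.
    case/(meet _ _ _ _ _ _ s01 o01) => -[? ? ?]; [by case: jj|lra|by case: jj].
  - have /= pt := Earm (conj Ep pe'); have [_ _ _ f1 _] := fP b' j.
    have : f b' j' s' = f b' j 1 by rewrite -pE' f1.
    case/(meet _ _ _ _ _ _ s01' o01) => -[? ? ?]; [by case: jj|lra|by case: jj].
  - by rewrite -(EE jj).
have CA i j i' : i <> i' -> C i j `&` A i' = set0.
  move=> ii; rewrite -subset0 /C /A => p [].
  case: (leg i) (leg_inj i) => [b|] linj; case E' : (leg i') => [b'|].
  - move=> /pieceE[]// s [s1 s01 pE pe] [j' _ /pieceE[]// s' [s1' s01' pE' _]].
    have bb : b <> b' by move=> bb; case: ii; apply: linj; rewrite E' bb.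
    rewrite pE' in pE; case: (meet _ _ _ _ _ _ s01' s01 pE) => -[? ? ?]; first by case: bb.
      by case: bb.
    lra.
  - by move=> /pieceE[]// s [s1 s01 pE pe] Ap; rewrite -(A2arm b j).
  - by move=> Dp [j' _ /pieceE[]// s [s1 s01 pE pe]]; rewrite -(Darm b' j j').
  - by case: ii; apply: linj; rewrite E'.
have CB i j j' : j <> j' -> C i j `&` B j' = set0.
  move=> jj; rewrite -subset0 /C /B => p [].
  case: (leg i) => [b /pieceE[]// s [s1 s01 pE pe]|Dp].
    case=> [[b' _ /pieceE[]// s' [s1' s01' pE' pe']]|Ep'].
      rewrite pE' in pE; case: (meet _ _ _ _ _ _ s01' s01 pE) => -[? ? ?]; [by case: jj|lra|by case: jj].
    have /= pt := Earm (conj Ep' pe); have [_ _ _ f1 _] := fP b j'.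
    have : f b j s = f b j' 1 by rewrite -pE f1.
    case/(meet _ _ _ _ _ _ s01 o01) => -[? ? ?]; [by case: jj|lra|by case: jj].
  case=> [[b' _ /pieceE[]// s' [s1' s01' pE' pe']]|Ep'].
    by rewrite -(Darm b' j j').
  by rewrite -(DE' jj).
have CC i j i' j' : (i, j) <> (i', j') -> C i j `&` C i' j' = set0.
  move=> ij; rewrite -subset0 /C => p [].
  case: (leg i) (leg_inj i) => [b|] linj; case E' : (leg i') => [b'|].
  - move=> /pieceE[]// s [s1 s01 pE pe] /pieceE[]// s' [s1' s01' pE' _].
    rewrite pE' in pE; case: (meet _ _ _ _ _ _ s01' s01 pE) => -[? ? ?]; try lra.
    by case: ij; congr (_, _) => //; apply: linj; rewrite E'; congr Some.
  - by move=> /pieceE[]// s [s1 s01 pE pe] Dp; rewrite -(Darm b j' j).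
  - by move=> Dp /pieceE[]// s [s1 s01 pE pe]; rewrite -(Darm b' j j').
  - have jj : j <> j' by move=> jj; case: ij; congr (_, _) => //; apply: linj; rewrite E'.
    by rewrite -(DD jj).
suff /no_bipartite_continua : bipartite_continua g A B C by rewrite leqNgt n_large.
split.
- case=> [i|j] /=.
    rewrite /A; case: (leg i) => [b|//]; split.
    + by move=> p [j _]; apply: (piece_surface (at_adj b j) (fP b j)) => //.
    + by apply: compact_bigcup_fin => j; apply: (piece_compact (fP b j)) => //.
    + apply: bigcup_connected => [|j _]; last apply: (piece_connected (fP b j)) => //.
      exists (pos (a b)) => j _; have [_ _ f0E _ _] := fP b j; exists 0 => //=.
      by rewrite in_itv /= lexx.
  have [Es Ec Econn] := EP j; split.
  + move=> p [[b _]|/Es//]; apply: (piece_surface (at_adj b j) (fP b j)) => //.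
  + by apply: compactU => //; apply: compact_bigcup_fin => b; apply: (piece_compact (fP b j)) => //.
  + have tin b : piece (f b j) (2 / 3) 1 (pos (t j)).
      by have [_ _ _ f1 _] := fP b j; exists 1 => //=; rewrite in_itv /= lexx tt1.
    apply: connectedU => //; first by exists (pos (t j)); split=> //; exists true.
    apply: bigcup_connected => [|b _]; last apply: (piece_connected (fP b j)) => //.
    by exists (pos (t j)) => b _.
- move=> i j; rewrite /C; case: (leg i) => [b|//]; split.
  + apply: (piece_surface (at_adj b j) (fP b j)) => //.
  + apply: (piece_compact (fP b j)) => //.
  + apply: (piece_connected (fP b j)) => //.
- move=> [i|j] [i'|j'] uv /=.
  + by apply: AA => ii; case: uv; rewrite ii.
  + exact: AB.
  + by rewrite setIC AB.
  + by apply: BB => jj; case: uv; rewrite jj.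
- exact: CC.
- move=> i j u; split.
    case: u => [i'|j'] [p Xp] /=.
      left; congr inl; apply/esym; apply: contrapT => ii.
      by have := CA i j i' ii; rewrite -subset0 => /(_ p Xp).
    right; congr inr; apply/esym; apply: contrapT => jj.
    by have := CB i j j' jj; rewrite -subset0 => /(_ p Xp).
  case=> -> /=; rewrite /C.
    rewrite /A; case: (leg i) => [b|//]; exists (f b j (1 / 3)); split.
      by exists (1 / 3) => //=; rewrite in_itv /= lexx; lra.
    by exists j => //; exists (1 / 3) => //=; rewrite in_itv /= lexx; lra.
  rewrite /B; case: (leg i) => [b|].
    exists (f b j (2 / 3)); split.
      by exists (2 / 3) => //=; rewrite in_itv /= lexx andbT; lra.
    by left; exists b => //; exists (2 / 3) => //=; rewrite in_itv /= lexx; lra.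
  by have [p [Dp Ep]] := DE j; exists p; split=> //; right.
Qed.

End ThirdLeg.

Lemma arc_meets u v f s u' v' : adj G u v -> arc_map u v f -> adj G u' v' -> 0 <= s <= 1 ->
  (u <> u' /\ u <> v') \/ (v <> u' /\ v <> v') -> edge u' v' (f s) ->
  s = 0 /\ (u = u' \/ u = v') \/ s = 1 /\ (v = u' \/ v = v').
Proof.
move=> uv fP uv' s01 ne e'; have ne' : [set u; v] <> [set u'; v'].
  move=> eq; case: ne => -[n1 n2].
    by have : [set u'; v'] u by [rewrite -eq; left]; case=> /=.
  by have : [set u'; v'] v by [rewrite -eq; right]; case=> /=.
have e : edge u v (f s) by have [_ _ _ _ ->] := fP; exists s; rewrite //= in_itv.
have [w [fs w1 w2]] := edges_meet uv uv' ne' e e'.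
by case: (arc_end uv fP s01 fs w1) => -[-> wE]; rewrite -wE; [left|right].
Qed.

Lemma pieceP u v f lo hi p : arc_map u v f -> 0 <= lo -> hi <= 1 -> piece f lo hi p ->
  exists s, [/\ lo <= s <= hi, 0 <= s <= 1, p = f s & edge u v p].
Proof.
move=> fP l0 h1 pp; have ep := piece_edge fP l0 h1 pp.
case: pp => s; rewrite /= in_itv /= => /andP[ls sh] pE; exists s; split=> //.
  by rewrite ls.
by rewrite (le_trans l0 ls) (le_trans sh h1).
Qed.

Lemma piece_mem (f : K -> P) lo hi s : lo <= s <= hi -> piece f lo hi (f s).
Proof. by move=> ls; exists s; rewrite //= in_itv. Qed.


Section Consequences.
Let n := (16 * (4 * g + 1) + 4)%N.
Variables (a : bool -> T) (a2 : T) (t : nat -> T).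
Hypotheses (a_neq : a false <> a true) (t_inj : injective t).
Hypothesis at_adj : forall b j, adj G (a b) (t j).

Let n_large : (16 * (4 * g + 1) + 3 < n)%N. Proof. by rewrite /n; lia. Qed.
Let tn (j : 'I_n.+1) := t j.
Let tn_inj : injective tn. Proof. by move=> i j /t_inj/val_inj. Qed.
Let tn_adj b j : adj G (a b) (tn j). Proof. exact: at_adj. Qed.
Let tn_neq i j : i <> j -> tn i <> tn j. Proof. by move=> ij /tn_inj. Qed.

(** The initial thirds of the edges at a2 form the third vertex, the middle thirds
its legs. *)
Theorem no_infinite_K3 : (forall b, a b <> a2) -> (forall j, adj G a2 (t j)) -> False.
Proof.
move=> aa2 a2t.
have /boolp.choice[f fP] (j : 'I_n.+1) : exists f, arc_map a2 (tn j) f.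
  by apply: arc_map_exists; exact: a2t.
have a2tn j : adj G a2 (tn j) by exact: a2t.
have [t0 t1 tt0 tt1] : [/\ (0 : K) <= 1 / 3, (1 / 3 : K) <= 1, (0 : K) <= 2 / 3 & (2 / 3 : K) <= 1].
  by split; lra.
have arm b j j' s : 0 <= s <= 1 -> edge (a b) (tn j') (f j s) -> s = 1 /\ j = j'.
  move=> s01 /(arc_meets (a2tn j) (fP j) (tn_adj b j') s01) [].
  - left; split; [by move/esym/aa2|exact: adj_neq].
  - by case=> _ [/esym/aa2//|/(adj_neq (a2tn j'))].
  - by case=> -> [/esym/(adj_neq (tn_adj b j))//|/tn_inj].
have other j j' s : j <> j' -> 0 <= s <= 1 -> edge a2 (tn j') (f j s) -> s = 0.
  move=> jj s01 /(arc_meets (a2tn j) (fP j) (a2tn j') s01) [].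
  - by right; split; [move/esym/(adj_neq (a2tn j))|exact: tn_neq].
  - by case.
  - by case=> -> [/esym/(adj_neq (a2tn j))//|/(tn_neq jj)].
have inj j s s' : 0 <= s <= 1 -> 0 <= s' <= 1 -> f j s = f j s' -> s = s'.
  exact: arc_map_inj (fP j).
apply: (@third_leg n a tn n_large a_neq tn_inj tn_adj
  (\bigcup_j piece (f j) 0 (1 / 3)) (fun j => piece (f j) (1 / 3) (2 / 3))
  (fun j => piece (f j) (2 / 3) 1)).
- split.
  + by move=> p [j _]; apply: (piece_surface (a2tn j) (fP j)).
  + by apply: compact_bigcup_fin => j; apply: (piece_compact (fP j)).
  + apply: bigcup_connected => [|j _]; last by apply: (piece_connected (fP j)).
    exists (pos a2) => j _; have [_ _ <- _ _] := fP j; apply: piece_mem; rewrite lexx; lra.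
- move=> j; split; [apply: (piece_surface (a2tn j) (fP j))|
    apply: (piece_compact (fP j))|apply: (piece_connected (fP j))] => //.
- move=> j; split; [apply: (piece_surface (a2tn j) (fP j))|
    apply: (piece_compact (fP j))|apply: (piece_connected (fP j))] => //.
- by move=> j; have [_ _ _ <- _] := fP j; apply: piece_mem; rewrite lexx andbT.
- move=> j; exists (f j (1 / 3)); split; [apply: piece_mem; rewrite lexx; lra|].
  by exists j => //; apply: piece_mem; rewrite lexx; lra.
- by move=> j; exists (f j (2 / 3)); split; apply: piece_mem; rewrite lexx; lra.
- move=> j; rewrite -subset0 => p [[j' _ /(pieceP (fP j'))[]// s [s1 s01 pE pe]]].
  move=> /(pieceP (fP j))[]// s' [s1' s01' pE' _].
  have [jj|jj] := eqVneq j j'; first by rewrite -jj in pE; have := inj j s s' s01 s01' (etrans (esym pE) pE'); lra.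
  by rewrite pE' in pe; have := other _ _ _ (elimN eqP jj) s01' pe; lra.
- move=> j j' jj; rewrite -subset0 => p [/(pieceP (fP j))[]// s [s1 s01 pE pe]].
  move=> /(pieceP (fP j'))[]// s' [s1' s01' pE' pe'].
  by rewrite pE in pe'; have := other _ _ _ jj s01 pe'; lra.
- move=> j j' jj; rewrite -subset0 => p [/(pieceP (fP j))[]// s [s1 s01 pE pe]].
  move=> /(pieceP (fP j'))[]// s' [s1' s01' pE' pe'].
  by rewrite pE in pe'; have := other _ _ _ jj s01 pe'; lra.
- move=> j j' jj; rewrite -subset0 => p [/(pieceP (fP j))[]// s [s1 s01 pE pe]].
  move=> /(pieceP (fP j'))[]// s' [s1' s01' pE' pe'].
  by rewrite pE in pe'; have := other _ _ _ jj s01 pe'; lra.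
- move=> b j; rewrite -subset0 => p [[j' _ /(pieceP (fP j'))[]// s [s1 s01 pE pe]]].
  by rewrite pE => /(arm _ _ _ _ s01)[? _]; lra.
- move=> b j j'; rewrite -subset0 => p [/(pieceP (fP j))[]// s [s1 s01 pE pe]].
  by rewrite pE => /(arm _ _ _ _ s01)[? _]; lra.
- move=> b j j' p [/(pieceP (fP j))[]// s [s1 s01 pE pe]].
  by rewrite pE => /(arm _ _ _ _ s01)[-> _] /=; have [_ _ _ ->] := fP j.
Qed.

(** The edges from a2 to the vertices u form the third vertex, and the edges from
u j to t j its legs. *)
Theorem no_subdivided_K3 (u : nat -> T) : (forall b, a b <> a2) -> (forall b i, a b <> u i) ->
  injective u -> (forall i j, u i <> t j) -> (forall i, a2 <> t i) ->
  (forall j, adj G a2 (u j)) -> (forall j, adj G (u j) (t j)) -> False.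
Proof.
move=> aa2 au u_inj ut a2t_neq a2u ut_adj.
pose un (j : 'I_n.+1) := u j.
have un_neq i j : i <> j -> un i <> un j by move=> ij /u_inj/val_inj.
have a2un j : adj G a2 (un j) by exact: a2u.
have utn j : adj G (un j) (tn j) by exact: ut_adj.
have /boolp.choice[f fP] (j : 'I_n.+1) : exists f, arc_map a2 (un j) f.
  exact: arc_map_exists.
have /boolp.choice[h hP] (j : 'I_n.+1) : exists f, arc_map (un j) (tn j) f.
  exact: arc_map_exists.
have [h0 h1] : (0 : K) <= 1 / 2 /\ (1 / 2 : K) <= 1 by split; lra.
have arm1 b j j' s : 0 <= s <= 1 -> ~ edge (a b) (tn j') (f j s).
  move=> s01 /(arc_meets (a2un j) (fP j) (tn_adj b j') s01) [].
  - by left; split; [move/esym/aa2|exact: a2t_neq].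
  - by case=> _ [/esym/aa2//|/a2t_neq].
  - by case=> _ [/esym/au//|/ut].
have arm2 b j j' s : 0 <= s <= 1 -> edge (a b) (tn j') (h j s) -> s = 1 /\ j = j'.
  move=> s01 /(arc_meets (utn j) (hP j) (tn_adj b j') s01) [].
  - by left; split; [move/esym/au|exact: ut].
  - by case=> _ [/esym/au//|/ut].
  - by case=> -> [/esym/(adj_neq (tn_adj b j))//|/tn_inj].
have hf j j' s : 0 <= s <= 1 -> edge a2 (un j') (h j s) -> s = 0.
  move=> s01 /(arc_meets (utn j) (hP j) (a2un j') s01) [].
  - by right; split; [move/esym/a2t_neq|move/esym/ut].
  - by case.
  - by case=> _ [/esym/a2t_neq//|/esym/ut].
have hh j j' s : j <> j' -> 0 <= s <= 1 -> ~ edge (un j') (tn j') (h j s).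
  move=> jj s01 /(arc_meets (utn j) (hP j) (utn j') s01) [].
  - by left; split; [exact: un_neq|exact: ut].
  - by case=> _ [/(un_neq _ _ jj)//|/ut].
  - by case=> _ [/esym/ut//|/(tn_neq jj)].
apply: (@third_leg n a tn n_large a_neq tn_inj tn_adj
  (\bigcup_j piece (f j) 0 1) (fun j => piece (h j) 0 (1 / 2)) (fun j => piece (h j) (1 / 2) 1)).
- split.
  + by move=> p [j _]; apply: (piece_surface (a2un j) (fP j)).
  + by apply: compact_bigcup_fin => j; apply: (piece_compact (fP j)).
  + apply: bigcup_connected => [|j _]; last by apply: (piece_connected (fP j)).
    by exists (pos a2) => j _; have [_ _ <- _ _] := fP j; apply: piece_mem; rewrite lexx ler01.
- move=> j; split; [apply: (piece_surface (utn j) (hP j))|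
    apply: (piece_compact (hP j))|apply: (piece_connected (hP j))] => //.
- move=> j; split; [apply: (piece_surface (utn j) (hP j))|
    apply: (piece_compact (hP j))|apply: (piece_connected (hP j))] => //.
- by move=> j; have [_ _ _ <- _] := hP j; apply: piece_mem; rewrite lexx andbT.
- move=> j; exists (pos (un j)); split.
    by have [_ _ <- _ _] := hP j; apply: piece_mem; rewrite lexx.
  by exists j => //; have [_ _ _ <- _] := fP j; apply: piece_mem; rewrite lexx ler01.
- by move=> j; exists (h j (1 / 2)); split; apply: piece_mem; rewrite lexx ?andbT.
- move=> j; rewrite -subset0 => p [[j' _ /(pieceP (fP j'))[]// s [s1 s01 pE pe]]].
  move=> /(pieceP (hP j))[]// s' [s1' s01' pE' _].
  by rewrite pE' in pe; have := hf _ _ _ s01' pe; lra.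
- move=> j j' jj; rewrite -subset0 => p [/(pieceP (hP j))[]// s [s1 s01 pE pe]].
  move=> /(pieceP (hP j'))[]// s' [s1' s01' pE' pe'].
  by rewrite pE in pe'; have := hh _ _ _ jj s01 pe'.
- move=> j j' jj; rewrite -subset0 => p [/(pieceP (hP j))[]// s [s1 s01 pE pe]].
  move=> /(pieceP (hP j'))[]// s' [s1' s01' pE' pe'].
  by rewrite pE in pe'; have := hh _ _ _ jj s01 pe'.
- move=> j j' jj; rewrite -subset0 => p [/(pieceP (hP j))[]// s [s1 s01 pE pe]].
  move=> /(pieceP (hP j'))[]// s' [s1' s01' pE' pe'].
  by rewrite pE in pe'; have := hh _ _ _ jj s01 pe'.
- move=> b j; rewrite -subset0 => p [[j' _ /(pieceP (fP j'))[]// s [s1 s01 pE pe]]].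
  by rewrite pE => /(arm1 _ _ _ _ s01).
- move=> b j j'; rewrite -subset0 => p [/(pieceP (hP j))[]// s [s1 s01 pE pe]].
  by rewrite pE => /(arm2 _ _ _ _ s01)[? _]; lra.
- move=> b j j' p [/(pieceP (hP j))[]// s [s1 s01 pE pe]].
  by rewrite pE => /(arm2 _ _ _ _ s01)[-> _] /=; have [_ _ _ ->] := hP j.
Qed.

(** The third vertex is the union of W and of the parts of the edges from w j to t j
from w j on until close to t j; near t j the edge avoids the closed set W. *)
Theorem no_hub (w : nat -> T) (W : set P) : (forall b i, a b <> w i) ->
  injective w -> (forall i j, w i <> t j) -> (forall j, adj G (t j) (w j)) ->
  [/\ W `<=` surface g, compact W & connected W] ->
  (forall j, W (pos (w j))) -> (forall b j, W `&` edge (a b) (t j) = set0) -> False.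
Proof.
move=> aw w_inj wt tw [Ws Wc Wconn] Ww Warm.
pose wn (j : 'I_n.+1) := w j.
have wn_neq i j : i <> j -> wn i <> wn j by move=> ij /w_inj/val_inj.
have twn j : adj G (tn j) (wn j) by exact: tw.
have /boolp.choice[h hP] (j : 'I_n.+1) : exists f, arc_map (tn j) (wn j) f.
  exact: arc_map_exists.
have Wt j : ~ W (pos (tn j)).
  move=> Wp; have : (W `&` edge (a true) (tn j)) (pos (tn j)); last by rewrite Warm.
  split=> //; have [f [_ _ _ f1 ->]] := arc_map_exists (tn_adj true j).
  by exists 1 => //=; rewrite in_itv /= ler01 lexx.
have clW : closed W by apply: compact_closed => //; exact: norm_hausdorff.
have /boolp.choice[d dP] (j : 'I_n.+1) : exists d : K, [/\ 0 < d, d <= 1 &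
    forall s, 0 <= s <= d -> ~ W (h j s)].
  have [ch _ h0 _ _] := hP j.
  have /continuous_within_itvP : {within `[0, 1], continuous (h j)} by [].
  move=> /(_ ltr01)[_ c0 _].
  have nW : nbhs (h j 0) (~` W).
    apply: open_nbhs_nbhs; split; first exact: closed_openC.
    by rewrite h0; exact: Wt.
  have /nbhs_ballP[e /= e0 eP] : nbhs (0 : K) [set s | 0 < s -> (~` W) (h j s)] by exact: (c0 _ nW).
  exists (Num.min (e / 2) 1); split; first by rewrite lt_min ltr01 divr_gt0.
    by rewrite ge_min lexx orbT.
  move=> s /andP[s0]; rewrite le_min => /andP[se s1].
  have [->|sn0] := eqVneq s 0; first by rewrite h0; exact: Wt.
  apply: eP; last by rewrite lt_neqAle eq_sym sn0.
  by rewrite -ball_normE /= sub0r normrN ger0_norm //; lra.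
have arm b j j' s : 0 <= s <= 1 -> edge (a b) (tn j') (h j s) -> s = 0 /\ j = j'.
  move=> s01 /(arc_meets (twn j) (hP j) (tn_adj b j') s01) [].
  - by right; split; [move/esym/aw|exact: wt].
  - by case=> -> [/esym/(adj_neq (tn_adj b j))//|/tn_inj].
  - by case=> _ [/esym/aw//|/wt].
have hh j j' s : j <> j' -> 0 <= s <= 1 -> ~ edge (tn j') (wn j') (h j s).
  move=> jj s01 /(arc_meets (twn j) (hP j) (twn j') s01) [].
  - by left; split; [exact: tn_neq|move/esym/wt].
  - by case=> _ [/(tn_neq jj)//|/esym/wt].
  - by case=> _ [/wt//|/(wn_neq _ _ jj)].
have inj j s s' : 0 <= s <= 1 -> 0 <= s' <= 1 -> h j s = h j s' -> s = s'.
  exact: arc_map_inj (hP j).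
have d0 j : 0 <= d j by have [/ltW] := dP j.
have d2 j : 0 <= d j / 2 /\ d j / 2 <= 1 by have [] := dP j; split; lra.
have d1 j : d j <= 1 by have [] := dP j.
apply: (@third_leg n a tn n_large a_neq tn_inj tn_adj
  (W `|` \bigcup_j (W `|` piece (h j) (d j) 1)) (fun j => piece (h j) (d j / 2) (d j))
  (fun j => piece (h j) 0 (d j / 2))).
- split.
  + by move=> p [/Ws//|[j _ [/Ws//|]]]; apply: (piece_surface (twn j) (hP j)).
  + apply: compactU => //; apply: compact_bigcup_fin => j; apply: compactU => //.
    by apply: (piece_compact (hP j)).
  + have conn j : connected (W `|` piece (h j) (d j) 1).
      apply: connectedU => //; last by apply: (piece_connected (hP j)).
      exists (pos (wn j)); split; first exact: Ww.
      by have [_ _ _ <- _] := hP j; apply: piece_mem; rewrite lexx andbT.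
    apply: connectedU => //; first by exists (pos (w 0)); split; [exact: Ww|exists ord0 => //; left; exact: Ww].
    by apply: bigcup_connected => [|j _ //]; exists (pos (w 0)) => j _; left; exact: Ww.
- move=> j; have [? ?] := d2 j; split; [apply: (piece_surface (twn j) (hP j))|
    apply: (piece_compact (hP j))|apply: (piece_connected (hP j))] => //.
- move=> j; have [? ?] := d2 j; split; [apply: (piece_surface (twn j) (hP j))|
    apply: (piece_compact (hP j))|apply: (piece_connected (hP j))] => //.
- by move=> j; have [_ _ <- _ _] := hP j; apply: piece_mem; rewrite lexx; have [->] := d2 j.
- move=> j; have dj := dP j; exists (h j (d j)); split.
    by apply: piece_mem; rewrite lexx andbT; case: dj; lra.
  by right; exists j => //; right; apply: piece_mem; rewrite lexx; case: dj.
- by move=> j; have [d0' _ _] := dP j; exists (h j (d j / 2)); split; apply: piece_mem; rewrite lexx ?andbT; lra.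
- move=> j; have [d0' d1' dW] := dP j; have [? ?] := d2 j; rewrite -subset0 => p [WW].
  move=> /(pieceP (hP j))[]// s' [s1' s01' pE' pe'].
  have nW : ~ W p by rewrite pE'; apply: dW; lra.
  case: WW => [//|[j' _ [//|/(pieceP (hP j'))[]// s [s1 s01 pE pe]]]].
  have [jj|jj] := eqVneq j' j.
    by rewrite jj in pE s1; have := inj j s s' s01 s01' (etrans (esym pE) pE'); lra.
  by rewrite pE in pe'; have := hh _ _ _ (elimN eqP jj) s01 pe'.
- move=> j j' jj; have [? ?] := d2 j; have [? ?] := d2 j'.
  rewrite -subset0 => p [/(pieceP (hP j))[]// s [s1 s01 pE pe]].
  move=> /(pieceP (hP j'))[]// s' [s1' s01' pE' pe'].
  by rewrite pE in pe'; have := hh _ _ _ jj s01 pe'.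
- move=> j j' jj; have [? ?] := d2 j; have [? ?] := d2 j'.
  rewrite -subset0 => p [/(pieceP (hP j))[]// s [s1 s01 pE pe]].
  move=> /(pieceP (hP j'))[]// s' [s1' s01' pE' pe'].
  by rewrite pE in pe'; have := hh _ _ _ jj s01 pe'.
- move=> j j' jj; have [? ?] := d2 j; have [? ?] := d2 j'.
  rewrite -subset0 => p [/(pieceP (hP j))[]// s [s1 s01 pE pe]].
  move=> /(pieceP (hP j'))[]// s' [s1' s01' pE' pe'].
  by rewrite pE in pe'; have := hh _ _ _ jj s01 pe'.
- move=> b j; rewrite -subset0 => p [WW ep].
  have nW : ~ W p.
    by move=> Wp; have : (W `&` edge (a b) (t j)) p by []; rewrite Warm.
  case: WW => [//|[j' _ [//|/(pieceP (hP j'))[]// s [s1 s01 pE pe]]]].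
  by rewrite pE in ep; have [? _] := arm _ _ _ _ s01 ep; have [? _ _] := dP j'; lra.
- move=> b j j'; have [d0' _ _] := dP j; have [? ?] := d2 j.
  rewrite -subset0 => p [/(pieceP (hP j))[]// s [s1 s01 pE pe]].
  by rewrite pE => /(arm _ _ _ _ s01)[? _]; lra.
- move=> b j j' p; have [? ?] := d2 j; case=> /(pieceP (hP j))[]// s [s1 s01 pE pe].
  by rewrite pE => /(arm _ _ _ _ s01)[-> _] /=; have [_ _ ->] := hP j.
Qed.

End Consequences.
End Drawings.

(** * Uncountably many triods *)

Lemma infinite_seq (T : Type) (A : set T) : infinite_set A ->
  exists t : nat -> T, injective t /\ forall n, A (t n).
Proof.
move=> infA; have [x0 _] := infinite_setN0 infA.
elim/Ppointed: T => T in A x0 infA *; first by case: (no x0).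
have /infiniteP /pcard_leP[f] := infA; exists f; split=> [m n fmn|n]; last exact: funS.
by apply: (@inj _ _ _ f); rewrite ?inE.
Qed.

Section Charts.
Variables (K : realType) (g : nat).
Local Notation P := (K * K * K)%type.

(** Over the open domain the surface consists of two graphs, of z and - z.  Its
remaining points lie on the circles where z = 0, which consist of half circles
y = y(x) and their ends; the second kind of chart parametrises these half
circles and is constant in its second variable. *)
Definition chart_kind := (bool + option 'I_g * bool)%type.

Definition circle_center (c : option 'I_g) : K := if c is Some k then (4 * k)%:R else 0.
Definition circle_radius (c : option 'I_g) : K := if c is Some _ then 1 else radius K g.
Definition circle2 (c : option 'I_g) (x : K) := circle_radius c ^+ 2 - (x - circle_center c) ^+ 2.

Definition chart (k : chart_kind) (q : K * K) : P :=
  match k with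
  | inl s => (q.1, q.2, signed s (Num.sqrt (height2 g q.1 q.2)))
  | inr (c, s) => (q.1, signed s (Num.sqrt (circle2 c q.1)), 0)
  end.

Definition chart_gauge (k : chart_kind) (q : K * K) : K :=
  match k with inl _ => height2 g q.1 q.2 | inr (c, _) => circle2 c q.1 end.

Lemma signed_sqr s (y : K) : signed s y ^+ 2 = y ^+ 2.
Proof. by case: s; rewrite /= ?sqrrN. Qed.

Lemma height2_circle c (x y : K) : y ^+ 2 = circle2 c x -> height2 g x y = 0.
Proof.
rewrite /circle2 /height2; case: c => [k|] /= e.
  rewrite (bigD1 k) //= [inner k x y](_ : _ = 0) ?mul0r ?mulr0 // /inner e; ring.
by rewrite [outer _ _ _](_ : _ = 0) ?mul0r // /outer e; ring.
Qed.

Lemma chart_surface k q : 0 < chart_gauge k q -> surface g (chart k q).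
Proof.
case: k => [s|[c s]] /= h0; apply/surfaceP => /=.
  by rewrite signed_sqr sqr_sqrtr // ltW.
by rewrite expr0n /= (@height2_circle c) // signed_sqr sqr_sqrtr // ltW.
Qed.

Lemma circle2_continuous c : continuous (fun q : K * K => circle2 c q.1).
Proof.
move=> q; apply: cvgB; first exact: cvg_cst.
by apply: cvgM; (apply: cvgB; [exact: cvg_fst|exact: cvg_cst]).
Qed.

Lemma chart_gauge_continuous k : continuous (chart_gauge k).
Proof. case: k => [s|[c s]]; [exact: height2_continuous|exact: circle2_continuous]. Qed.

Lemma signed_continuous (X : topologicalType) s (f : X -> K) :
  continuous f -> continuous (fun x => signed s (f x)).
Proof. by case: s => //= cf x; apply: cvgN; exact: cf. Qed.

Lemma chart_continuous k : continuous (chart k).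
Proof.
case: k => [s|[c s]] q.
  have f1 : r.1 @[r --> q] --> q.1 by exact: cvg_fst.
  have f2 : r.2 @[r --> q] --> q.2 by exact: cvg_snd.
  have c1 : (r.1, r.2) @[r --> q] --> (q.1, q.2) by exact: (cvg_pair f1 f2).
  have c2 := @signed_continuous _ s _ (@sqrt_height2_continuous K g) q.
  rewrite /continuous_at /=.
  apply: (cvg_pair c1 c2).
have c2 : continuous (fun q : K * K => Num.sqrt (circle2 c q.1)).
  move=> r; apply: (@cvg_comp _ _ _ (fun q : K * K => circle2 c q.1) Num.sqrt).
    exact: circle2_continuous.
  exact: sqrt_continuous.
have f1 : r.1 @[r --> q] --> q.1 by exact: cvg_fst.
have c2' := @signed_continuous _ s _ c2 q.
have c1 : (r.1, signed s (Num.sqrt (circle2 c r.1))) @[r --> q] -->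
    (q.1, signed s (Num.sqrt (circle2 c q.1))) by exact: (cvg_pair f1 c2').
have c3 : (0 : K) @[_ --> q] --> (0 : K) by exact: cvg_cst.
rewrite /continuous_at /=.
exact: (cvg_pair c1 c3).
Qed.

(** The ends of those half circles. *)
Definition branch_points : set P := [set p | surface g p /\ p.1.2 = 0 /\ p.2 = 0].

Lemma height2_eq0 (x y : K) : height2 g x y = 0 -> exists c, y ^+ 2 = circle2 c x.
Proof.
move=> /eqP; rewrite mulf_eq0 => /orP[/eqP|/prodf_eq0[k _ /eqP]]; rewrite ?/outer ?/inner => xy.
  by exists None; rewrite /circle2 /=; lra.
by exists (Some k); rewrite /circle2 /=; lra.
Qed.

Lemma finite_branch_points : finite_set branch_points.
Proof.
pose f (cs : option 'I_g * bool) : P := (circle_center cs.1 + signed cs.2 (circle_radius cs.1), 0, 0).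
apply: (@sub_finite_set _ _ (f @` setT)); last exact/finite_image/finite_finset.
move=> [[x y] z] [/surfaceP /= zz [/= y0 z0]]; move: zz; rewrite {}y0 {}z0 expr0n /=.
move=> /esym /height2_eq0[c]; rewrite expr0n /= /circle2 => /esym /eqP.
rewrite subr_sqr mulf_eq0 => /orP[] /eqP e.
  by exists (c, false) => //; rewrite /f /=; congr (_, _, _); lra.
by exists (c, true) => //; rewrite /f /=; congr (_, _, _); lra.
Qed.

Lemma signed_norm (y : K) : signed (y < 0) `|y| = y.
Proof. by case: ltP => y0 /=; [rewrite ltr0_norm // opprK|rewrite ger0_norm]. Qed.

Lemma chart_onto p : surface g p -> ~ branch_points p ->
  exists k q, 0 < chart_gauge k q /\ chart k q = p.
Proof.
case: p => [[x y] z] sp nb; have /surfaceP /= zz := sp.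
have [z0|z0] := eqVneq z 0; last first.
  exists (inl (z < 0)), (x, y) => /=; rewrite -zz; split.
    by rewrite lt_neqAle sqr_ge0 eq_sym sqrf_eq0 z0.
  by rewrite sqrtr_sqr signed_norm.
move: zz; rewrite z0 expr0n => /esym /height2_eq0[c yc].
exists (inr (c, y < 0)), (x, 0) => /=; rewrite -yc; split.
  rewrite lt_neqAle sqr_ge0 eq_sym sqrf_eq0 andbT; apply/eqP => y0.
  by apply: nb.
by rewrite sqrtr_sqr signed_norm.
Qed.


Definition rational_box := ((rat * rat) * (rat * rat))%type.

Definition qbox (r : rational_box) : set (K * K) :=
  `[ratr r.1.1, ratr r.1.2] `*` `[ratr r.2.1, ratr r.2.2].

Lemma rational_interval (x e : K) : 0 < e -> exists r : rat * rat,
  [/\ ratr r.1 <= x, x <= ratr r.2 & forall s, ratr r.1 <= s -> s <= ratr r.2 -> `|x - s| < e].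
Proof.
move=> e0; have /rat_in_itvoo[r1] : x - e < x by lra.
have /rat_in_itvoo[r2] : x < x + e by lra.
rewrite !in_itv /= => /andP[a1 a2] /andP[b1 b2]; exists (r1, r2) => /=; split; rewrite ?ltW // => s s1 s2.
by rewrite ltr_norml; apply/andP; split; lra.
Qed.

(** There are countably many rational boxes, and their images under the charts are
continua of the surface. *)
Lemma rational_box_in q (U : set (K * K)) : nbhs q U -> exists r, qbox r q /\ qbox r `<=` U.
Proof.
move=> /nbhs_ballP[e /= e0 qU].
have [r1 [r11 r12 r1P]] := rational_interval q.1 e0.
have [r2 [r21 r22 r2P]] := rational_interval q.2 e0.
exists (r1, r2); split; first by split; rewrite /= in_itv /= ?r11 ?r21.
move=> [x y] [] /=; rewrite !in_itv /= => /andP[? ?] /andP[? ?]; apply: qU.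
by split; [exact: r1P|exact: r2P].
Qed.

Lemma qbox_compact r : compact (qbox r).
Proof. by apply: compact_setX; exact: segment_compact. Qed.

Lemma qbox_connected r : connected (qbox r).
Proof.
have [[q qr]|] := pselect (qbox r !=set0); last by move/set0P/negP/negPn/eqP->; exact: connected0.
pose f (z : K * K) (s : K) := (q.1 + s * (z.1 - q.1), q.2 + s * (z.2 - q.2)).
have -> : qbox r = \bigcup_(z in qbox r) (f z @` `[0, 1]).
  apply/seteqP; split=> [z rz|z' [z rz [s s01 <-{z'}]]].
    exists z => //; exists 1; first by rewrite /= in_itv /= ler01 lexx.
    by rewrite /f; case: z {rz} => x y /=; congr (_, _); ring.
  move: s01; rewrite /= in_itv /= => /andP[s0 s1].
  have convex (lo hi x x' : K) : lo <= x <= hi -> lo <= x' <= hi -> lo <= x' + s * (x - x') <= hi.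
    by move=> /andP[? ?] /andP[? ?]; apply/andP; split; nra.
  have [z1 z2] := rz; have [q1 q2] := qr; move: z1 z2 q1 q2; rewrite /= !in_itv /= => z1 z2 q1 q2.
  by split; rewrite /= in_itv /=; exact: convex.
apply: bigcup_connected.
  exists q => z _; exists 0; first by rewrite /= in_itv /= ler01 lexx.
  by rewrite /f !mul0r !addr0; case: (q).
move=> z _; apply: connected_continuous_connected; first exact: segment_connected.
apply: continuous_subspaceT => s.
have c1 : q.1 + s * (z.1 - q.1) @[s --> s] --> q.1 + s * (z.1 - q.1).
  by apply: cvgD; [exact: cvg_cst|apply: cvgM; [exact: cvg_id|exact: cvg_cst]].
have c2 : q.2 + s * (z.2 - q.2) @[s --> s] --> q.2 + s * (z.2 - q.2).
  by apply: cvgD; [exact: cvg_cst|apply: cvgM; [exact: cvg_id|exact: cvg_cst]].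
exact: (cvg_pair c1 c2).
Qed.

End Charts.

Section Triods.
Variables (K : realType) (T : Type) (G : sgraph T) (g : nat).
Variables (pos : T -> K * K * K) (edge : T -> T -> set (K * K * K)).
Hypothesis drawing : is_drawing G (@surface K g) pos edge.
Variables (a : bool -> T) (Q : set (T * T)).
Hypothesis a_neq : a false <> a true.
Hypothesis Q_adj : forall q, Q q -> adj G q.1 q.2 /\ forall b, adj G (a b) q.1 /\ a b <> q.2.
Hypothesis Q_inj1 : forall q q', Q q -> Q q' -> q.1 = q'.1 -> q = q'.
Hypothesis Q_inj2 : forall q q', Q q -> Q q' -> q.2 = q'.2 -> q = q'.
Hypothesis Q_neq : forall q q', Q q -> Q q' -> q.2 <> q'.1.

Definition coded (c : chart_kind g * rational_box) : set (T * T) :=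
  [set q | [/\ Q q, qbox c.2 `<=` [set z : K * K | 0 < chart_gauge c.1 z],
     (chart c.1 @` qbox c.2) (pos q.2) &
     forall b, (chart c.1 @` qbox c.2) `&` edge (a b) q.1 = set0]].

Lemma coded_finite c : finite_set (coded c).
Proof.
apply: contrapT => /infinite_seq[s [s_inj sP]].
pose t n := (s n).1; pose w n := (s n).2.
have Qs n : Q (s n) by case: (sP n).
apply: (@no_hub _ _ _ _ _ _ drawing a t a_neq _ _ w (chart c.1 @` qbox c.2)).
- by move=> m n /(Q_inj1 (Qs m) (Qs n))/s_inj.
- by move=> b n; have [_ /(_ b)[]] := Q_adj (Qs n).
- by move=> b n; have [_ /(_ b)[]] := Q_adj (Qs n).
- by move=> m n /(Q_inj2 (Qs m) (Qs n))/s_inj.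
- by move=> m n; exact: Q_neq.
- by move=> n; have [] := Q_adj (Qs n).
- split.
  + by move=> _ [z zc <-]; apply: chart_surface; have [_ sub _ _] := sP 0%N; exact: sub.
  + apply: continuous_compact; last exact: qbox_compact.
    by apply: continuous_subspaceT; exact: chart_continuous.
  + apply: connected_continuous_connected; first exact: qbox_connected.
    by apply: continuous_subspaceT; exact: chart_continuous.
- by move=> n; case: (sP n).
- by move=> b n; case: (sP n).
Qed.

Lemma edge_closed u v : adj G u v -> closed (edge u v).
Proof.
move=> uv; have [f fP] := arc_map_exists drawing uv; have [_ _ _ _ ->] := fP.
apply: compact_closed; first exact: norm_hausdorff.
exact: (piece_compact fP).
Qed.

(** Code the pair (t, w) by a chart and a rational box whose image contains the
point w and misses the two edges at t; there are countably many codes, and by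
[no_hub] each is used finitely often. *)
Theorem countable_triods : countable Q.
Proof.
pose Q0 : set (T * T) := [set q | Q q /\ branch_points g (pos q.2)].
have Q0_fin : finite_set Q0.
  have /card_eqPle[_ le] : ((fun q => pos q.2) @` Q0 #= Q0)%card.
    apply/inj_card_eq => q q'; rewrite !inE => -[Qq _] [Qq' _] e.
    apply: Q_inj2 => //; apply: (pos_inj drawing) e.
      exact: adj_vertsr (proj1 (Q_adj Qq)).
    exact: adj_vertsr (proj1 (Q_adj Qq')).
  apply: card_le_finite le _.
  by apply: (sub_finite_set _ (@finite_branch_points K g)) => _ [q [_ bq] <-].
pose F (c : option (chart_kind g * rational_box)) := if c is Some c' then coded c' else Q0.
apply: (@sub_countable _ _ _ (\bigcup_c F c)); last first.
  apply: bigcup_countable => [|[c|] _]; [exact: countableP| |]; last exact: finite_set_countable Q0_fin.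
  exact: finite_set_countable (coded_finite c).
apply: subset_card_le => q Qq.
have [bq|nbq] := pselect (branch_points g (pos q.2)); first by exists None.
have [tw aP] := Q_adj Qq.
have [[posS _] _ noV _] := drawing.
have [k [z [z0 zE]]] := chart_onto (posS _ (adj_vertsr tw)) nbq.
have far b : nbhs z [set z' | ~ edge (a b) q.1 (chart k z')].
  apply: (@chart_continuous K g k z (~` edge (a b) q.1)).
  have [atb awb] := aP b.
  apply: open_nbhs_nbhs; split; first exact/closed_openC/edge_closed.
  rewrite zE /= => /(noV _ _ _ atb (adj_vertsr tw))[|wE]; first exact/nesym.
  by apply: (Q_neq Qq Qq).
have pos0 : nbhs z [set z' | 0 < chart_gauge k z'].
  apply: (@chart_gauge_continuous K g k z [set y | 0 < y]).
  by apply: open_nbhs_nbhs; split=> //; exact: open_gt.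
have [r [rz rU]] := rational_box_in (filterI pos0 (filterI (far false) (far true))).
exists (Some (k, r)) => //; split=> //=.
- by move=> z' /rU[].
- by exists z.
- move=> b; apply/seteqP; split=> // _ [[z' /rU[_ [f0 f1]] <-]]; by case: b.
Qed.

End Triods.

(** * Stereographic projection *)

Section Stereographic.
Variable K : realType.
Local Notation P := (K * K * K)%type.
Local Notation plane := (K * K)%type.
Implicit Types (a b d : plane) (t : K).

Definition weight (h : P) : K := h.1.1 ^+ 2 + h.1.2 ^+ 2 + h.2 ^+ 2.

(** Inverse stereographic projection in homogeneous coordinates: the plane point
(x/z, y/z), or the north pole when z = 0.  Segments and half-lines of the plane
are then both images of segments. *)
Definition sphere_point (h : P) : P :=
  (2 * h.2 * h.1.1 / weight h, 2 * h.2 * h.1.2 / weight h,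
   (h.1.1 ^+ 2 + h.1.2 ^+ 2 - h.2 ^+ 2) / weight h).

Definition north : P := (0, 0, 1).

Definition lift a : P := sphere_point (a, 1).

Lemma weight_gt0 (h : P) : h <> 0 -> 0 < weight h.
Proof.
case: h => [[x y] z] h0; rewrite /weight /= lt_neqAle !addr_ge0 ?sqr_ge0 // andbT eq_sym.
apply/eqP => e; apply: h0; have x0 := sqr_ge0 x; have y0 := sqr_ge0 y; have z0 := sqr_ge0 z.
have sq0 (r : K) : r ^+ 2 = 0 -> r = 0 by move=> /eqP; rewrite sqrf_eq0 => /eqP.
have -> : x = 0 by apply: sq0; lra.
have -> : y = 0 by apply: sq0; lra.
by have -> : z = 0 by apply: sq0; lra.
Qed.

Lemma sphere_point_surface h : h <> 0 -> surface 0 (sphere_point h).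
Proof.
move=> /weight_gt0; rewrite /surface /sphere_point /weight /= big_ord0 mulr1 muln0 add0n.
case: h => [[x y] z] /= w0.
have wn0 : x ^+ 2 + y ^+ 2 + z ^+ 2 != 0 by rewrite gt_eqF.
by field.
Qed.

Lemma sphere_point_scale (c : K) (x y z : K) : c != 0 -> (x, y, z) <> (0 : P) ->
  sphere_point (c * x, c * y, c * z) = sphere_point (x, y, z).
Proof.
move=> c0 /weight_gt0; rewrite /sphere_point /weight /= => w0.
have wn0 : x ^+ 2 + y ^+ 2 + z ^+ 2 != 0 by rewrite gt_eqF.
have wc0 : (c * x) ^+ 2 + (c * y) ^+ 2 + (c * z) ^+ 2 != 0.
  by rewrite !exprMn -!mulrDr mulf_neq0 // sqrf_eq0.
by congr (_, _, _); field; rewrite wn0 wc0.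
Qed.

Lemma pair1_neq0 a : (a, 1) <> (0 : P).
Proof. by case=> _ /eqP; rewrite oner_eq0. Qed.

Lemma lift_inj : injective lift.
Proof.
move=> [x y] [x' y'] [] /=; rewrite /weight /= !expr1n.
have n0 := sqr_ge0 x; have n1 := sqr_ge0 y; have n2 := sqr_ge0 x'; have n3 := sqr_ge0 y'.
have w0 : x ^+ 2 + y ^+ 2 + 1 != 0 by rewrite gt_eqF //; lra.
have w0' : x' ^+ 2 + y' ^+ 2 + 1 != 0 by rewrite gt_eqF //; lra.
move=> /eqP; rewrite eqr_div // => /eqP e1 /eqP; rewrite eqr_div // => /eqP e2.
move=> /eqP; rewrite eqr_div // => /eqP e3.
have e : x ^+ 2 + y ^+ 2 + 1 = x' ^+ 2 + y' ^+ 2 + 1 by nra.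
move: e1 e2; rewrite e => /(mulIf w0') e1 /(mulIf w0') e2.
by congr (_, _); lra.
Qed.

Lemma lift_north a : lift a <> north.
Proof.
case: a => x y [_ _] /=; rewrite /weight /= !expr1n.
have n0 := sqr_ge0 x; have n1 := sqr_ge0 y.
have w0 : x ^+ 2 + y ^+ 2 + 1 != 0 by rewrite gt_eqF //; lra.
by move=> /(canRL (divfK w0)); lra.
Qed.

Lemma north_surface : surface 0 north.
Proof. by rewrite /surface /north /= big_ord0; rewrite muln0 add0n; ring. Qed.

Lemma sphere_path_continuous (x y z : K -> K) :
  continuous x -> continuous y -> continuous z -> (forall t, (x t, y t, z t) <> (0 : P)) ->
  continuous (fun t => sphere_point (x t, y t, z t)).
Proof.
move=> cx cy cz n0 t; rewrite /sphere_point /weight /=.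
have c2 (f : K -> K) : continuous f -> (f s ^+ 2) @[s --> t] --> f t ^+ 2.
  by move=> cf; apply: cvgM; exact: cf.
have cw : (x s ^+ 2 + y s ^+ 2 + z s ^+ 2)^-1 @[s --> t] --> (x t ^+ 2 + y t ^+ 2 + z t ^+ 2)^-1.
  apply: cvgV; first by have /weight_gt0 := n0 t; rewrite /weight /= => /gt_eqF ->.
  by apply: cvgD; [apply: cvgD|]; exact: c2.
have cc (f : K -> K) : continuous f -> (2 * z s * f s / (x s ^+ 2 + y s ^+ 2 + z s ^+ 2)) @[s --> t] -->
    2 * z t * f t / (x t ^+ 2 + y t ^+ 2 + z t ^+ 2).
  by move=> cf; apply: cvgM cw; apply: cvgM; [apply: cvgM; [exact: cvg_cst|exact: cz]|exact: cf].
have c12 : (2 * z s * x s / (x s ^+ 2 + y s ^+ 2 + z s ^+ 2), 2 * z s * y s / (x s ^+ 2 + y s ^+ 2 + z s ^+ 2))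
   @[s --> t] --> (2 * z t * x t / (x t ^+ 2 + y t ^+ 2 + z t ^+ 2), 2 * z t * y t / (x t ^+ 2 + y t ^+ 2 + z t ^+ 2)).
  by exact: (cvg_pair (cc _ cx) (cc _ cy)).
have c3 : (x s ^+ 2 + y s ^+ 2 - z s ^+ 2) / (x s ^+ 2 + y s ^+ 2 + z s ^+ 2) @[s --> t] -->
   (x t ^+ 2 + y t ^+ 2 - z t ^+ 2) / (x t ^+ 2 + y t ^+ 2 + z t ^+ 2).
  by apply: cvgM cw; apply: cvgB; [apply: cvgD|]; exact: c2.
by exact: (cvg_pair c12 c3).
Qed.

Lemma affine_continuous (p q : K) : continuous (fun t => p + t * q).
Proof. by move=> t; apply: cvgD; [exact: cvg_cst|apply: cvgM; [exact: cvg_id|exact: cvg_cst]]. Qed.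

Definition towards a d t : plane := (a.1 + t * d.1, a.2 + t * d.2).
Definition seg a b : set plane := towards a (b.1 - a.1, b.2 - a.2) @` `[0, 1].
Definition ray a d : set plane := towards a d @` [set t | 0 <= t].

Lemma towards_inj a d t t' : d <> 0 -> towards a d t = towards a d t' -> t = t'.
Proof.
case: a d => a1 a2 [d1 d2] d0 [/= /addrI e1 /addrI e2]; apply: contrapT => tt; apply: d0.
have inj0 (r : K) : t * r = t' * r -> r = 0.
  move=> e; apply/eqP; have /eqP : (t - t') * r = 0 by rewrite mulrBl e subrr.
  by rewrite mulf_eq0 subr_eq0 => /orP[/eqP|].
by rewrite (inj0 _ e1) (inj0 _ e2).
Qed.

Lemma segC a b : seg a b = seg b a.
Proof.
suff sub c e : seg c e `<=` seg e c by apply/seteqP; split; exact: sub.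
move=> _ [t t01 <-]; exists (1 - t).
  by move: t01; rewrite /= !in_itv /= => /andP[? ?]; apply/andP; split; lra.
by rewrite /towards /=; congr (_, _); ring.
Qed.

(** The parametrisation is defined and continuous on the whole line, which makes it
easy to reverse. *)
Definition extended_arc (p q : P) A := exists f : K -> P,
  [/\ continuous f, set_inj `[0, 1] f, f 0 = p, f 1 = q & A = f @` `[0, 1]].

Lemma extended_arcW p q A : extended_arc p q A -> is_arc p q A.
Proof. by move=> [f [cf ? ? ? ?]]; exists f; split=> //; exact: continuous_subspaceT. Qed.

Lemma extended_arc_sym (p q : P) A : extended_arc p q A -> extended_arc q p A.
Proof.
move=> [f [cf inj f0 f1 ->]].
have rev t : `[0, 1]%classic t -> `[0, 1]%classic (1 - t).
  by rewrite /= !in_itv /= => /andP[? ?]; apply/andP; split; lra.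
exists (fun t => f (1 - t)); rewrite subr0 subrr; split=> //.
- move=> t; apply: (@cvg_comp _ _ _ (fun t => 1 - t) f); last exact: cf.
  by apply: cvgB; [exact: cvg_cst|exact: cvg_id].
- move=> t t'; rewrite !inE => /rev t01 /rev t01' e.
  have : 1 - t = 1 - t' by (apply: inj; rewrite ?inE).
  by lra.
- by apply/seteqP; split=> _ [t t01 <-]; exists (1 - t); rewrite ?subKr //; exact: rev.
Qed.

Lemma seg_arc a b : a <> b -> extended_arc (lift a) (lift b) (lift @` seg a b).
Proof.
move=> ab; pose f t := lift (towards a (b.1 - a.1, b.2 - a.2) t).
have d0 : (b.1 - a.1, b.2 - a.2) <> (0 : plane).
  move=> [/subr0_eq e1 /subr0_eq e2]; apply: ab; move: e1 e2; case: a {f} => ? ?; case: b => ? ? /= -> ->.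
  by [].
exists f; split.
-   apply: (@sphere_path_continuous (fun t => a.1 + t * (b.1 - a.1)) (fun t => a.2 + t * (b.2 - a.2)) (fun=> 1)).
  + exact: affine_continuous.
  + exact: affine_continuous.
  + by move=> t; exact: cvg_cst.
  + by move=> t; exact: pair1_neq0.
- by move=> t t' _ _ /lift_inj/towards_inj; exact.
- by rewrite /f /towards !mul0r !addr0; case: (a).
- by rewrite /f /towards !mul1r ![_ + (_ - _)]addrC !subrK; case: (b).
- by apply/seteqP; split=> [_ [_ [t t01 <-] <-]|_ [t t01 <-]]; [exists t|exists (towards a (b.1 - a.1, b.2 - a.2) t) => //; exists t].
Qed.

(** The half-line a + s d is a + (t / (1 - t)) d, in homogeneous coordinates the
segment from (a, 1) to (d, 0). *)
Lemma ray_arc a d : d <> 0 -> extended_arc (lift a) north (lift @` ray a d `|` [set north]).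
Proof.
move=> d0; pose h t : P := (a.1 + t * (d.1 - a.1), a.2 + t * (d.2 - a.2), 1 + t * - 1).
have h0 t : h t <> 0.
  have [->|t1] := eqVneq t 1.
    rewrite /h !mul1r ![_ + (_ - _)]addrC !subrK => -[e1 e2 _]; apply: d0.
    by move: e1 e2; case: (d) => ? ? /= -> ->.
  by move=> [_ _ /eqP]; rewrite mulrN1 subr_eq0 eq_sym (negPf t1).
have hE t : t != 1 -> sphere_point (h t) = lift (towards a d (t / (1 - t))).
  move=> t1; have t10 : 1 - t != 0 by rewrite subr_eq0 eq_sym.
  rewrite /lift /towards -[RHS](@sphere_point_scale (1 - t)) //; last exact: pair1_neq0.
  by congr sphere_point; rewrite /h; congr (_, _, _); field.
have h1 : sphere_point (h 1) = north.
  rewrite /sphere_point; have := weight_gt0 (h0 1); rewrite /weight /h /= !mul1r subrr.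
  rewrite !(mulr0, mul0r) expr0n /= subr0 addr0 /north => w0.
  by rewrite divff // gt_eqF.
exists (fun t => sphere_point (h t)); split=> //.
- by apply: sphere_path_continuous => //; exact: affine_continuous.
- move=> t t' _ _; have [->|t1] := eqVneq t 1; have [->//|t1'] := eqVneq t' 1.
  + by rewrite h1 hE // => /esym/lift_north.
  + by rewrite h1 hE // => /lift_north.
  + rewrite !hE // => /lift_inj/towards_inj => /(_ d0)/eqP.
    rewrite eqr_div ?subr_eq0 1?eq_sym // => /eqP; lra.
- by rewrite hE 1?eq_sym ?oner_eq0 // mul0r /towards !mul0r !addr0; case: (a).
- apply/seteqP; split=> [_ [[_ [t /= t0 <-] <-]|->]|_ [t t01 <-]].
  + have t1 : 1 + t != 0 by rewrite gt_eqF //; lra.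
    have t2 : t / (1 + t) != 1 by rewrite -subr_eq0 (_ : _ - 1 = - (1 + t)^-1) ?oppr_eq0 ?invr_eq0 //; field.
    exists (t / (1 + t)).
      rewrite /= in_itv /= divr_ge0 //= ?ler_pdivrMr; lra.
    rewrite hE //; congr (lift (towards _ _ _)); field; rewrite t1 /=.
    by have -> : 1 + t - t = 1 by ring.
  + by exists 1 => //=; rewrite in_itv /= ler01 lexx.
  + move: t01; rewrite /= in_itv /= => /andP[t0 t1].
    have [->|t1'] := eqVneq t 1; [by right|left].
    rewrite hE //; exists (towards a d (t / (1 - t))) => //; exists (t / (1 - t)) => //=.
    by rewrite divr_ge0 // subr_ge0.
Qed.

End Stereographic.

(** * A criterion for drawings in the sphere *)

Section PlanarCriterion.
Variables (K : realType) (T : Type) (G : sgraph T) (S : T).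
Local Notation plane := (K * K)%type.
Variables (pl dir : T -> plane).
Hypothesis pl_inj : forall u v, verts G u -> verts G v -> u <> S -> v <> S -> pl u = pl v -> u = v.
Hypothesis dir_neq0 : forall u, adj G u S -> dir u <> 0.
Hypothesis ray_vert : forall u w, adj G u S -> verts G w -> w <> S ->
  ray (pl u) (dir u) (pl w) -> w = u.
Hypothesis seg_vert : forall u v w, adj G u v -> u <> S -> v <> S -> verts G w -> w <> S ->
  seg (pl u) (pl v) (pl w) -> w = u \/ w = v.
Hypothesis ray_ray : forall u u' p, adj G u S -> adj G u' S ->
  ray (pl u) (dir u) p -> ray (pl u') (dir u') p -> u = u'.
Hypothesis ray_seg : forall u v w p, adj G u S -> adj G v w -> v <> S -> w <> S ->
  ray (pl u) (dir u) p -> seg (pl v) (pl w) p -> p = pl u /\ (u = v \/ u = w).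
Hypothesis seg_seg : forall u v u' v' p, adj G u v -> adj G u' v' ->
  u <> S -> v <> S -> u' <> S -> v' <> S -> [set u; v] <> [set u'; v'] ->
  seg (pl u) (pl v) p -> seg (pl u') (pl v') p ->
  exists w, [/\ p = pl w, w = u \/ w = v & w = u' \/ w = v'].

Let pos u : K * K * K := if pselect (u = S) then north K else lift (pl u).
Let edge u v : set (K * K * K) :=
  if pselect (u = S) then @lift K @` ray (pl v) (dir v) `|` [set north K]
  else if pselect (v = S) then @lift K @` ray (pl u) (dir u) `|` [set north K]
  else @lift K @` seg (pl u) (pl v).

Let posS : pos S = north K. Proof. by rewrite /pos; case: pselect. Qed.
Let posN u : u <> S -> pos u = lift (pl u). Proof. by rewrite /pos; case: pselect. Qed.
Let edgeS u : u <> S -> edge u S = @lift K @` ray (pl u) (dir u) `|` [set north K].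
Proof. by move=> uS; rewrite /edge; case: (pselect (u = S)) => // nu; case: (pselect (S = S)). Qed.
Let edgeN u v : u <> S -> v <> S -> edge u v = @lift K @` seg (pl u) (pl v).
Proof. by move=> uS vS; rewrite /edge; case: (pselect (u = S)) => // nu; case: (pselect (v = S)). Qed.
Let edgeC u v : adj G u v -> edge u v = edge v u.
Proof.
move=> uv; rewrite /edge; case: (pselect (u = S)) (pselect (v = S)) => [uS|uS] [vS|vS] //.
  by case: (@adj_irrefl _ G S); rewrite -{1}uS -vS.
by rewrite segC.
Qed.

(** An edge is a spoke, with one end at the pole S, or a chord. *)
Let spoke_or_chord (Q : T -> T -> Prop) : (forall u v, adj G u v -> Q v u -> Q u v) ->
  (forall u, adj G u S -> u <> S -> Q u S) ->
  (forall u v, adj G u v -> u <> S -> v <> S -> Q u v) -> forall u v, adj G u v -> Q u v.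
Proof.
move=> QC Qs Qc u v uv; have [vS|vS] := pselect (v = S).
  by subst v; apply: Qs => // uS; apply: (@adj_irrefl _ G S); rewrite -{1}uS.
have [uS|uS] := pselect (u = S); last exact: Qc.
by subst u; apply: QC => //; apply: Qs => //; exact: adj_sym.
Qed.

(** The vertex S is sent to the north pole; spokes are half-lines and chords are
segments in the plane. *)
Theorem planar_embeddable : embeddable K G 0.
Proof.
have mem_edgeS u p : u <> S -> edge u S p -> (exists2 q, ray (pl u) (dir u) q & p = lift q) \/ p = pos S.
  by move=> uS; rewrite edgeS // posS => -[[q qr <-]|]; [left; exists q|right].
have lift_sub A : @lift K @` A `<=` surface 0.
  by move=> _ [q _ <-]; apply: sphere_point_surface; exact: pair1_neq0.
exists pos, edge; split.
- split=> [u _|u v]; rewrite ?inE.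
    have [->|uS] := pselect (u = S); first by rewrite posS; exact: north_surface.
    by rewrite posN //; apply: (lift_sub setT); exists (pl u).
  have [->|uS] := pselect (u = S); have [->|vS] := pselect (v = S) => // Gu Gv.
  + by rewrite posS posN // => /esym/lift_north.
  + by rewrite posS posN // => /lift_north.
  + by rewrite !posN // => /lift_inj; exact: pl_inj.
- move=> u v uv; rewrite -[edge v u]edgeC //.
  suff [ext sub] : extended_arc (pos u) (pos v) (edge u v) /\ edge u v `<=` surface 0.
    by split=> //; exact: extended_arcW.
  move: u v uv; apply: spoke_or_chord => [u v uv [ext sub]|u uS neS|u v uv uS vS].
  + by rewrite edgeC //; split=> //; exact: extended_arc_sym.
  + rewrite posS posN // edgeS //; split; first by apply: ray_arc; exact: dir_neq0.
    by move=> _ [/lift_sub//|->]; exact: north_surface.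
  + rewrite !posN // edgeN //; split; last exact: lift_sub.
    apply: seg_arc => /pl_inj e; apply: (@adj_irrefl _ G u).
    rewrite {2}e //; [exact: adj_vertsl uv|exact: adj_vertsl (adj_sym uv)].
- move=> u v w uv Gw; have [->|wS] := pselect (w = S).
    move: u v uv; apply: spoke_or_chord => [u v uv Q|u _ _ _|u v uv uS vS].
    + by rewrite edgeC // => /Q[]; [right|left].
    + by right.
    + by rewrite edgeN // posS => -[q _ /lift_north].
  move: u v uv; apply: spoke_or_chord => [u v uv Q|u uv uS|u v uv uS vS].
  + by rewrite edgeC // => /Q[]; [right|left].
  + case/(mem_edgeS _ _ uS) => [[q qr]|].
      by rewrite posN // => /lift_inj e; left; apply: ray_vert => //; rewrite e.
    by rewrite posS posN // => /lift_north.
  + rewrite edgeN // posN // => -[q qr /lift_inj e].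
    by apply: (@seg_vert u v w) => //; rewrite -e.
- suff H u v u' v' p : adj G u v -> adj G u' v' -> [set u; v] <> [set u'; v'] ->
      edge u v p -> edge u' v' p -> exists w, [/\ p = pos w, w = u \/ w = v & w = u' \/ w = v'].
    move=> u v u' v' uv uv' ne p [pu pu'].
    by have [w [pw wu wu']] := H _ _ _ _ _ uv uv' ne pu pu'; exists w.
  move=> uv uv'; move: u' v' uv'; apply: spoke_or_chord.
  + move=> u' v' uv'; rewrite [[set v'; u']]setUC [edge v' u']edgeC //; last exact: adj_sym.
      move=> H /H{}H /H{}H /H[w [? ? ?]]; exists w; split=> //; tauto.
  + move=> u' uS' neS'; move: u v uv; apply: spoke_or_chord.
    * move=> u v uv; rewrite [[set v; u]]setUC [edge v u]edgeC //; last exact: adj_sym.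
      move=> H /H{}H /H{}H /H[w [? ? ?]]; exists w; split=> //; tauto.
    * move=> u uS neS ne /(mem_edgeS _ _ neS)[[q qr ->]|->]; last by exists S; split=> //; right.
      move=> /(mem_edgeS _ _ neS')[[q' qr' /lift_inj e]|]; last by rewrite posS => /lift_north.
      by case: ne; rewrite (ray_ray uS uS' qr) // e.
    * move=> u v uv uS vS ne; rewrite edgeN // => -[q qr <-].
      move=> /(mem_edgeS _ _ neS')[[q' qr' /lift_inj e]|]; last by rewrite posS => /lift_north.
      rewrite -{}e in qr'; have [-> uu] := ray_seg uS' uv uS vS qr' qr.
      by exists u'; split=> //; [rewrite posN|left].
  + move=> u' v' uv' uS' vS'; move: u v uv; apply: spoke_or_chord.
    * move=> u v uv; rewrite [[set v; u]]setUC [edge v u]edgeC //; last exact: adj_sym.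
      move=> H /H{}H /H{}H /H[w [? ? ?]]; exists w; split=> //; tauto.
    * move=> u uS neS ne /(mem_edgeS _ _ neS)[[q qr ->]|->]; last by rewrite edgeN // posS => -[q _ /lift_north].
      rewrite edgeN // => -[q' qr' /lift_inj e]; rewrite {}e in qr'.
      have [-> uu] := ray_seg uS uv' uS' vS' qr qr'.
      by exists u; split=> //; [rewrite posN|left].
    * move=> u v uv uS vS ne; rewrite !edgeN // => -[q qr <-] [q' qr' /lift_inj e].
      rewrite {}e in qr'; have [w [-> wu wu']] := seg_seg uv uv' uS vS uS' vS' ne qr qr'.
      exists w; split=> //; rewrite posN //.
      by case: wu => ->.
Qed.

End PlanarCriterion.

(** * Distinct real labels *)

Section Ternary.
Variable K : realType.

Definition ternary_sum (A : nat -> bool) n : K := \sum_(i < n) (A i)%:R * 3^-1 ^+ i.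
Definition ternary (A : nat -> bool) : K := sup (range (ternary_sum A)).

Lemma ternary_sumS A n : ternary_sum A n.+1 = ternary_sum A n + (A n)%:R * 3^-1 ^+ n.
Proof. by rewrite /ternary_sum big_ord_recr. Qed.

(** The digits are 0 and 1 in base 3, so a tail adds at most half of the last
place. *)
Lemma ternary_sum_tail A n m : (n <= m)%N ->
  ternary_sum A n <= ternary_sum A m <= ternary_sum A n + 3 / 2 * 3^-1 ^+ n - 3 / 2 * 3^-1 ^+ m.
Proof.
move=> /subnKC <-; elim: (m - n)%N => [|k /andP[lo hi]]; first by rewrite addn0; apply/andP; split; lra.
rewrite addnS ternary_sumS exprS; have p0 : (0 : K) <= 3^-1 ^+ (n + k) by rewrite exprn_ge0.
case: (A (n + k)) => /=; apply/andP; split; lra.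
Qed.

Lemma ternary_bounds A n : ternary_sum A n <= ternary A <= ternary_sum A n + 3 / 2 * 3^-1 ^+ n.
Proof.
have pos k : (0 : K) <= 3^-1 ^+ k by rewrite exprn_ge0.
have ub : ubound (range (ternary_sum A)) (ternary_sum A n + 3 / 2 * 3^-1 ^+ n).
  move=> _ [m _ <-]; have := pos n; have := pos m.
  case: (leqP n m) => [/ternary_sum_tail|/ltnW/ternary_sum_tail] /(_ A)/andP[]; lra.
apply/andP; split; last by apply: ge_sup => //; exists (ternary_sum A 0), 0%N.
apply: ub_le_sup; last by exists n.
by exists (ternary_sum A n + 3 / 2 * 3^-1 ^+ n).
Qed.

Lemma ternary_lt A B n : (forall i, (i < n)%N -> A i = B i) -> A n = false -> B n = true ->
  ternary A < ternary B.
Proof.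
move=> AB An Bn; have e : ternary_sum A n = ternary_sum B n.
  by apply: eq_bigr => i _; rewrite AB.
have /andP[_] := ternary_bounds A n.+1; have /andP[+ _] := ternary_bounds B n.+1.
rewrite !ternary_sumS An Bn e exprS /=; have : (0 : K) < 3^-1 ^+ n by rewrite exprn_gt0.
lra.
Qed.

Lemma ternary_inj : injective ternary.
Proof.
move=> A B e; apply/funext => n; apply: contrapT => ABn.
have ex : exists n, A n != B n by exists n; apply/eqP.
case: (ex_minnP ex) => m ABm min.
have low i : (i < m)%N -> A i = B i.
  by move=> im; apply/eqP; apply: contraTT im => /min; rewrite -leqNgt.
case Am : (A m) ABm; case Bm : (B m) => // _.
  by have := @ternary_lt B A m (fun i im => esym (low i im)) Bm Am; rewrite e ltxx.
by have := @ternary_lt A B m low Am Bm; rewrite e ltxx.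
Qed.

(** The three Dedekind cuts of a point of space, enumerated together. *)
Definition cuts (p : K * K * K) (n : nat) : bool :=
  if unpickle n is Some (q, i) then
    ratr q < nth 0 [:: p.1.1; p.1.2; p.2] i
  else false.

Lemma cuts_inj : injective cuts.
Proof.
move=> p p' e.
have coord (i : nat) : nth 0 [:: p.1.1; p.1.2; p.2] i = nth 0 [:: p'.1.1; p'.1.2; p'.2] i.
  have cut (q : rat) : (ratr q < nth 0 [:: p.1.1; p.1.2; p.2] i) = (ratr q < nth 0 [:: p'.1.1; p'.1.2; p'.2] i).
    by have := congr1 (fun A => A (pickle (q, i))) e; rewrite /cuts pickleK.
  case: (ltgtP (nth 0 [:: p.1.1; p.1.2; p.2] i) (nth 0 [:: p'.1.1; p'.1.2; p'.2] i)) => // /rat_in_itvoo[q];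
  rewrite in_itv /= => /andP[q1 q2]; move: (cut q).
    by rewrite q2 lt_gtF.
  by rewrite q2 lt_gtF.
by case: p p' coord {e} => [[x y] z] [[x' y'] z'] coord; move: (coord 0%N) (coord 1%N) (coord 2%N) => /= -> -> ->.
Qed.

Definition code (p : K * K * K) : K := ternary (cuts p).

Lemma code_inj : injective code. Proof. exact: inj_comp ternary_inj cuts_inj. Qed.

Lemma code_bounds p : 0 <= code p <= 3 / 2.
Proof. by have := ternary_bounds (cuts p) 0; rewrite /ternary_sum big_ord0 add0r expr0 mulr1. Qed.

End Ternary.

Section Matching.
Variables (K : realType) (T : Type) (E : T -> T -> Prop) (c : T -> K).
Hypothesis E_sym : forall u v, E u v -> E v u.
Hypothesis E_irr : forall u, ~ E u u.
Hypothesis E_fun : forall u v w, E u v -> E u w -> v = w.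

(** The partner in a matching E, or u itself if there is none. *)
Definition mate u : T := if pselect (exists v, E u v) is left ex then sval (cid ex) else u.

Lemma mateE u v : E u v -> mate u = v.
Proof.
rewrite /mate => uv; case: pselect => [ex|[]]; last by exists v.
exact: E_fun (svalP (cid ex)) uv.
Qed.

Lemma mateN u : ~ (exists v, E u v) -> mate u = u.
Proof. by rewrite /mate; case: pselect. Qed.

Lemma mateK : involutive mate.
Proof.
move=> u; have [[v uv]|nE] := pselect (exists v, E u v); last by rewrite !(mateN nE).
by rewrite (mateE uv) (mateE (E_sym uv)).
Qed.

(** The label shared by the two members of a pair; [pair_side] tells them apart. *)
Definition pair_index u : K := Num.min (c u) (c (mate u)).
Definition pair_side u : K := if c (mate u) < c u then 1 else 0.

Lemma pair_index_mate u : pair_index (mate u) = pair_index u.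
Proof. by rewrite /pair_index mateK minC. Qed.

Lemma pair_index_inj (A : set T) u v : set_inj A c -> (forall w, A w -> A (mate w)) -> A u -> A v ->
  pair_index u = pair_index v -> v = u \/ v = mate u.
Proof.
move=> inj Am Au Av; have {}inj x y : A x -> A y -> c x = c y -> x = y.
  by move=> Ax Ay; apply: inj; rewrite inE.
rewrite /pair_index /Num.min; case: ifP => _; case: ifP => _ /inj e.
- by left; rewrite e.
- by right; rewrite (e Au (Am _ Av)) mateK.
- by right; rewrite (e (Am _ Au) Av).
- by left; rewrite -[u]mateK -[v]mateK (e (Am _ Au) (Am _ Av)).
Qed.

Lemma pair_side_mate (A : set T) u : set_inj A c -> A u -> A (mate u) -> mate u <> u ->
  pair_side (mate u) = 1 - pair_side u.
Proof.
move=> inj Au Am mu; rewrite /pair_side mateK.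
case: (ltgtP (c u) (c (mate u))) => [_|_|e]; rewrite ?subr0 ?subrr //.
by case: mu; apply: esym; apply: inj e; rewrite inE.
Qed.

Lemma pair_side01 u : pair_side u = 0 \/ pair_side u = 1.
Proof. by rewrite /pair_side; case: ifP; [right|left]. Qed.

End Matching.

(** * Drawings with one or two poles *)

(** Equations between vertices or between points of the plane are no input for
linear arithmetic. *)
Ltac real_lra := intros; try match goal with |- @eq ?X _ _ => is_var X; exfalso end;
  repeat match goal with H : @eq ?X _ _ |- _ => is_var X; clear H | H : @eq (_ * _)%type _ _ |- _ => clear H | H : ~ _ |- _ => clear H end;
  first [lra | exfalso; lra].

Section OnePole.
Variables (K : realType) (T : Type) (G : sgraph T) (S : T) (emb : T -> K * K * K).
Hypothesis emb_inj : set_inj (verts G) emb.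
Hypothesis matching : forall u v w, u <> S -> v <> S -> w <> S -> adj G u v -> adj G u w -> v = w.

(** Each pair, or single vertex, lives on a vertical line of its own, at the heights
0 and 1; the half-lines to infinity go down from height 0 and up from
height 1. *)
Theorem one_pole_embeddable : embeddable K G 0.
Proof.
pose E u v := [/\ adj G u v, u <> S & v <> S].
have E_sym u v : E u v -> E v u by move=> [uv uS vS]; split=> //; exact: adj_sym.
have E_irr u : ~ E u u by move=> [uu _ _]; exact: adj_irrefl uu.
have E_fun u v w : E u v -> E u w -> v = w by move=> [uv uS vS] [uw _ wS]; exact: matching uv uw.
pose c u := code (emb u); pose A : set T := [set u | verts G u /\ u <> S].
have c_inj : set_inj A c.
  by move=> u v; rewrite !inE => -[Gu _] [Gv _] /code_inj; apply: emb_inj; rewrite inE.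
have A_mate u : A u -> A (mate E u).
  move=> Au; have [[v uv]|nE] := pselect (exists v, E u v); last by rewrite mateN.
  by rewrite (mateE E_fun uv); have [au _ vS] := uv; split=> //; exact: adj_vertsl (adj_sym au).
pose idx := pair_index E c; pose side := pair_side E c.
have idx_inj u v : A u -> A v -> idx u = idx v -> v = u \/ v = mate E u.
  by move=> Au Av; exact: (pair_index_inj E_sym E_fun c_inj A_mate Au Av).
have side01 u : side u = 0 \/ side u = 1 by exact: pair_side01.
have side_mate u : A u -> mate E u <> u -> side (mate E u) = 1 - side u.
  by move=> Au; apply: (pair_side_mate E_sym E_fun c_inj Au); exact: A_mate.
have chord u v : adj G u v -> u <> S -> v <> S -> [/\ A u, A v, v = mate E u & side v = 1 - side u].
  move=> uv uS vS; have Euv : E u v by [].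
  have vE := mateE E_fun Euv; have Au : A u by split=> //; exact: adj_vertsl uv.
  split=> //; first by split=> //; exact: adj_vertsl (adj_sym uv).
  by rewrite -vE; apply: side_mate => // e; apply: (E_irr u); rewrite -{2}e vE.
have idx_mate u : idx (mate E u) = idx u by exact: pair_index_mate.
pose pl u := (idx u, side u); pose dir u : K * K := (0, 2 * side u - 1).
have rayP u p : ray (pl u) (dir u) p -> p.1 = idx u /\ (side u = 0 /\ p.2 <= 0 \/ side u = 1 /\ 1 <= p.2).
  move=> [t /= t0 <-] /=; rewrite mulr0 addr0; split=> //.
  by case: (side01 u) => ->; [left|right]; split=> //; real_lra.
have segP u v p : adj G u v -> u <> S -> v <> S -> seg (pl u) (pl v) p -> p.1 = idx u /\ 0 <= p.2 <= 1.
  move=> uv uS vS [t /= + <-] /=; rewrite in_itv /= => /andP[t0 t1].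
  have [_ _ ve sv] := chord u v uv uS vS; rewrite sv ve idx_mate subrr mulr0 addr0; split=> //.
  by case: (side01 u) => ->; apply/andP; split; real_lra.
have spokeA u : adj G u S -> A u.
  by move=> uS; split; [exact: adj_vertsl uS|move=> e; apply: (@adj_irrefl _ G S); rewrite -{1}e].
have same u v : A u -> A v -> idx u = idx v -> side u = side v -> v = u.
  move=> Au Av /(idx_inj _ _ Au Av)[->//|vm] sv; have [e|ne] := pselect (mate E u = u); first by rewrite vm.
  by have := side_mate u Au ne; rewrite -vm -sv => h; exfalso; move: h; case: (side01 u) => ->; real_lra.
apply: (@planar_embeddable K T G S pl dir).
- by move=> u v Gu Gv uS vS [e1 e2]; apply/esym; apply: same.
- by move=> u _ []; case: (side01 u) => ->; real_lra.
- move=> u w uS Gw wS /rayP[/= e [[s0 w0]|[s1 w1]]]; apply: same => //; try exact: spokeA.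
    by rewrite s0; case: (side01 w) => sw; real_lra.
  by rewrite s1; case: (side01 w) => sw; real_lra.
- move=> u v w uv uS vS Gw wS /(segP _ _ _ uv uS vS)[/= e _].
  have [Au Av -> _] := chord u v uv uS vS.
  by apply: idx_inj.
- move=> u u' p uS u'S /rayP[e s] /rayP[e' s']; apply: same; rewrite -?e ?e' //; try exact: spokeA.
  by case: s => -[-> s]; case: s' => -[-> s']; real_lra.
- move=> u v w p uS vw vS wS /rayP[e s] /(segP _ _ _ vw vS wS)[e' /andP[p0 p1]].
  have [Av Aw wE _] := chord v w vw vS wS; split.
    by case: p e s e' p0 p1 => x y /= -> s _ p0 p1; congr (_, _); case: s => -[-> s]; real_lra.
  by rewrite wE; apply: idx_inj; rewrite -?e -?e' //; exact: spokeA.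
- move=> u v u' v' p uv uv' uS vS uS' vS' ne /(segP _ _ _ uv uS vS)[e _] /(segP _ _ _ uv' uS' vS')[e' _].
  have [Au Av vE _] := chord u v uv uS vS; have [Au' Av' vE' _] := chord u' v' uv' uS' vS'.
  case: ne; have [u'E|u'E] := idx_inj u u' Au Au' (etrans (esym e) e').
    by rewrite vE vE' u'E.
  by rewrite vE vE' u'E (mateK E_sym E_fun) setUC.
Qed.

End OnePole.

Section TwoPoles.
Variables (K : realType) (T : Type) (G : sgraph T) (S J : T) (emb : T -> K * K * K).
Hypothesis emb_inj : set_inj (verts G) emb.
Let E u v := [/\ adj G u v, u <> S /\ u <> J & v <> S /\ v <> J].
Hypothesis matching : forall u v w, E u v -> E u w -> v = w.
Hypothesis countable_matching : countable [set u | exists v, E u v].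

Lemma unit_gap (k k' : nat) (r : K) :
  2 * k%:R <= r <= 2 * k%:R + 1 -> 2 * k'%:R <= r <= 2 * k'%:R + 1 -> k = k'.
Proof.
have le (i j : nat) : 2 * i%:R <= r <= 2 * i%:R + 1 -> 2 * j%:R <= r <= 2 * j%:R + 1 -> (i <= j)%N.
  move=> /andP[i1 _] /andP[_ j2]; have : (2 * i)%:R <= (2 * j + 1)%:R :> K by rewrite natrD !natrM; real_lra.
  by rewrite ler_nat; lia.
by move=> a b; apply/eqP; rewrite eqn_leq !le.
Qed.

(** J is the origin and the other vertices lie on the line x = 1: pairs at the
heights 2k and 2k + 1, single vertices at negative heights.  The line through J
and a vertex carries its edges to J and, beyond it, to S; the edge from J to S
goes to the left. *)
Theorem two_poles_embeddable : embeddable K G 0.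
Proof.
have E_sym u v : E u v -> E v u by move=> [uv uS vS]; split=> //; exact: adj_sym.
have E_irr u : ~ E u u by move=> [uu _ _]; exact: adj_irrefl uu.
pose M : set T := [set u | exists v, E u v].
have /countable_injP[num num_inj] : countable M by [].
pose c u : K := (num u)%:R.
have c_inj : set_inj M c.
  by move=> u v Mu Mv /eqP; rewrite eqr_nat => /eqP; exact: num_inj.
have M_mate u : M u -> M (mate E u).
  by move=> [v uv]; rewrite (mateE matching uv); exists u; exact: E_sym.
pose side := pair_side E c.
have [idx idxE] : exists idx : T -> nat, forall u, pair_index E c u = (idx u)%:R.
  exists (fun u => minn (num u) (num (mate E u))) => u; rewrite /pair_index /c.
  by case: (leqP (num u) (num (mate E u))) => uu; [rewrite min_l|rewrite min_r]; rewrite // ler_nat // ltnW.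
have idx_inj u v : M u -> M v -> idx u = idx v -> v = u \/ v = mate E u.
  move=> Mu Mv e; apply: (pair_index_inj E_sym matching c_inj M_mate Mu Mv).
  by rewrite !idxE e.
have side01 u : side u = 0 \/ side u = 1 by exact: pair_side01.
have side_mate u v : E u v -> side v = 1 - side u.
  move=> uv; have vE := mateE matching uv; have Mu : M u by exists v.
  rewrite -vE; apply: (pair_side_mate E_sym matching c_inj Mu); first exact: M_mate.
  by rewrite vE => e; apply: (E_irr u); rewrite -{2}e.
have idx_mate u v : E u v -> idx v = idx u.
  move=> uv; apply/eqP; rewrite -(eqr_nat K) -!idxE -(mateE matching uv).
  by rewrite (pair_index_mate c E_sym matching).
pose y u : K := if pselect (M u) then 2 * (idx u)%:R + side u else code (emb u) - 2.
have yM u : M u -> y u = 2 * (idx u)%:R + side u by rewrite /y; case: pselect.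
have y_pos u : M u -> 2 * (idx u)%:R <= y u <= 2 * (idx u)%:R + 1.
  by move=> /yM ->; apply/andP; case: (side01 u) => ->; split; real_lra.
have y_neg u : ~ M u -> y u = code (emb u) - 2 /\ y u < 0.
  rewrite /y; case: pselect => //= nM _; split=> //; have /andP[_] := code_bounds (emb u); real_lra.
have nat0 (k : nat) : (0 : K) <= k%:R by exact: ler0n.
have M_of_y u (k : nat) : 2 * k%:R <= y u <= 2 * k%:R + 1 -> M u.
  by move=> /andP[ku _]; apply: contrapT => /y_neg[_]; have := nat0 k; real_lra.
have y_inj u v : verts G u -> verts G v -> y u = y v -> u = v.
  move=> Gu Gv; have [Mu|Mu] := pselect (M u); have [Mv|Mv] := pselect (M v).
  - move=> e; have yu := y_pos u Mu; have yv := y_pos v Mv; rewrite e in yu.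
    have ei := unit_gap yu yv; have [->//|vm] := idx_inj u v Mu Mv ei.
    have [w uw] := Mu; have vw : v = w by rewrite vm (mateE matching uw).
    have := side_mate u w uw; have := e; rewrite !yM // ei -vw.
    by case: (side01 u) => ->; real_lra.
  - have /andP[yu _] := y_pos u Mu; have [_ yv] := y_neg v Mv; have := nat0 (idx u); real_lra.
  - have /andP[yu _] := y_pos v Mv; have [_ yv] := y_neg u Mu; have := nat0 (idx v); real_lra.
  - have [-> _] := y_neg u Mu; have [-> _] := y_neg v Mv.
    by move=> e; apply: emb_inj; rewrite ?inE //; apply: code_inj; real_lra.
pose pl u : K * K := if pselect (u = J) then (0, 0) else (1, y u).
pose dir u : K * K := if pselect (u = J) then (- 1, 0) else (1, y u).
have plJ : pl J = (0, 0) by rewrite /pl; case: pselect.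
have plN u : u <> J -> pl u = (1, y u) by rewrite /pl; case: pselect.
have dirJ : dir J = (- 1, 0) by rewrite /dir; case: pselect.
have dirN u : u <> J -> dir u = (1, y u) by rewrite /dir; case: pselect.
have rayJ p : ray (pl J) (dir J) p -> p.1 <= 0 /\ p.2 = 0.
  by move=> [t /= t0 <-] /=; rewrite plJ dirJ /=; split; real_lra.
have rayN u p : u <> J -> ray (pl u) (dir u) p -> exists2 s, 1 <= s & p = (s, s * y u).
  move=> uJ [t /= t0 <-]; rewrite /towards plN // dirN //=; exists (1 + t); first real_lra.
  by congr (_, _); ring.
have segP u v p : adj G u v -> u <> S -> v <> S -> seg (pl u) (pl v) p ->
    (exists w s, [/\ w <> J /\ verts G w, [set u; v] = [set w; J], (0 <= s <= 1) & p = (s, s * y w)])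
    \/ [/\ E u v, p.1 = 1 & 2 * (idx u)%:R <= p.2 <= 2 * (idx u)%:R + 1].
  have spoke w q : w <> J -> seg (pl w) (pl J) q -> exists2 s, 0 <= s <= 1 & q = (s, s * y w).
    move=> wJ [t /= + <-]; rewrite in_itv /= plJ plN // /towards => /andP[t0 t1].
    exists (1 - t); first by apply/andP; split; real_lra.
    by congr (_, _) => /=; ring.
  move=> uv uS vS; have Gu := adj_vertsl uv; have Gv := adj_vertsl (adj_sym uv).
  have [vJ|vJ] := pselect (v = J).
    subst v; have uJ : u <> J by move=> e; apply: (@adj_irrefl _ G J); rewrite -{1}e.
    by move=> /(spoke _ _ uJ)[s s01 ->]; left; exists u, s.
  have [uJ|uJ] := pselect (u = J).
    by subst u; rewrite segC => /(spoke _ _ vJ)[s s01 ->]; left; exists v, s; split=> //; rewrite setUC.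
  have Euv : E u v by [].
  move=> [t /= + <-]; rewrite in_itv /= !plN // => /andP[t0 t1]; right; split=> //=; first real_lra.
  rewrite !yM; try by [exists v|exists u; exact: E_sym].
  rewrite (idx_mate _ _ Euv) (side_mate _ _ Euv).
  by apply/andP; case: (side01 u) => ->; split; real_lra.
have adj_neq u v : adj G u v -> u <> v by move=> uv e; apply: (@adj_irrefl _ G v); rewrite -{1}e.
have in_pair (a b x z : T) : [set a; b] = [set x; z] -> x = a \/ x = b.
  by move=> e; have : [set x; z] x by [left]; rewrite -e.
have in_pairr (a b x z : T) : [set a; b] = [set x; z] -> z = a \/ z = b.
  by rewrite [[set x; z]]setUC; exact: in_pair.
have scale_inj (s s' a b : K) : s != 0 -> (s, s * a) = (s', s' * b) -> s = s' /\ a = b.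
  by move=> s0 [<-] /(mulfI s0).
apply: (@planar_embeddable K T G S pl dir).
- move=> u v Gu Gv uS vS; have [->|uJ] := pselect (u = J); have [->|vJ] := pselect (v = J) => //.
  + by rewrite plJ plN // => -[/eqP]; rewrite eq_sym oner_eq0.
  + by rewrite plJ plN // => -[/eqP]; rewrite oner_eq0.
  + by rewrite !plN // => -[]; exact: y_inj.
- move=> u _; have [->|uJ] := pselect (u = J); rewrite ?dirJ ?dirN // => -[/eqP].
    by rewrite oppr_eq0 oner_eq0.
  by rewrite oner_eq0.
- move=> u w uS Gw wS; have [->|uJ] := pselect (u = J); have [->//|wJ] := pselect (w = J).
  + by move=> /rayJ; rewrite plN //= ler10 => -[].
  + by move=> /(rayN _ _ uJ)[s s1]; rewrite plJ => -[]; real_lra.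
  + move=> /(rayN _ _ uJ)[s s1]; rewrite plN // => -[<-]; rewrite mul1r.
    by apply: y_inj => //; exact: adj_vertsl uS.
- move=> u v w uv uS vS Gw wS /(segP _ _ _ uv uS vS)[[x [s [[xJ Gx] e s01]]]|[Euv]].
  + have [->|wJ] := pselect (w = J).
      by move=> _; exact: in_pairr e.
    rewrite plN // => -[<-]; rewrite mul1r => /y_inj -> //; exact: in_pair e.
  + have [->|wJ] := pselect (w = J); first by rewrite plJ /= => /eqP; rewrite eq_sym oner_eq0.
    rewrite plN //= => _ yw; have Mw : M w by exact: M_of_y yw.
    have Mu : M u by exists v.
    have [->|->] := idx_inj u w Mu Mw (unit_gap yw (y_pos w Mw)); [by left|right].
    exact: mateE Euv.
- move=> u u' p uS uS'; have Gu := adj_vertsl uS; have Gu' := adj_vertsl uS'.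
  have [->|uJ] := pselect (u = J); have [->|uJ'] := pselect (u' = J) => //.
  + by move=> /rayJ[p0 _] /(rayN _ _ uJ')[s s1 e]; move: p0; rewrite e /=; real_lra.
  + by move=> /(rayN _ _ uJ)[s s1 e] /rayJ[p0 _]; move: p0; rewrite e /=; real_lra.
  + move=> /(rayN _ _ uJ)[s s1 ->] /(rayN _ _ uJ')[s' s1' e].
    have s0 : s != 0 by rewrite gt_eqF //; real_lra.
    have [_ yu] := scale_inj _ _ _ _ s0 e; exact: y_inj.
- move=> u v w p uS vw vS wS; have Gu := adj_vertsl uS.
  move=> up /(segP _ _ _ vw vS wS)[[x [s [[xJ Gx] e /andP[s0 s1] pE]]]|[Evw p1 p2]].
  + have [uJ|uJ] := pselect (u = J).
      subst u; move: up => /rayJ; rewrite pE /= => -[s0' _].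
      have sz : s = 0 by real_lra.
      rewrite plJ sz mul0r; split=> //; exact: in_pairr e.
    have [s' s1' pE'] := rayN _ _ uJ up.
    have ss : s = s' by move: pE; rewrite pE' => -[].
    have s_1 : s' = 1 by real_lra.
    have yx : y u = y x by move: pE; rewrite pE' ss s_1 !mul1r => -[].
    rewrite plN // pE' s_1 mul1r; split=> //.
    by have -> := y_inj _ _ Gu Gx yx; exact: in_pair e.
  + have [uJ|uJ] := pselect (u = J); first by subst u; move: up => /rayJ; rewrite p1 ler10 => -[].
    have [s' s1' pE'] := rayN _ _ uJ up.
    have s_1 : s' = 1 by move: p1; rewrite pE'.
    rewrite plN // pE' s_1 mul1r; split=> //; move: p2; rewrite pE' s_1 mul1r /= => yu.
    have Mu : M u by exact: M_of_y yu.
    have Mv : M v by exists w.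
    have [->|->] := idx_inj v u Mv Mu (unit_gap yu (y_pos u Mu)); [by left|right].
    exact: mateE Evw.
- move=> u v u' v' p uv uv' uS vS uS' vS' ne.
  move=> /(segP _ _ _ uv uS vS) h /(segP _ _ _ uv' uS' vS') h'.
  have spoke_chord a b a' b' x s : [set a; b] = [set x; J] -> 0 <= s <= 1 -> x <> J -> verts G x ->
      E a' b' -> s = 1 -> 2 * (idx a')%:R <= s * y x <= 2 * (idx a')%:R + 1 ->
      exists w, [/\ (s, s * y x) = pl w, w = a \/ w = b & w = a' \/ w = b'].
    move=> e _ xJ Gx Eab -> ; rewrite mul1r => yx; exists x; rewrite plN //; split=> //; first exact: in_pair e.
    have Mx : M x by exact: M_of_y yx.
    have Ma : M a' by exists b'.
    have [->|->] := idx_inj a' x Ma Mx (unit_gap yx (y_pos x Mx)); [by left|right].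
    exact: mateE Eab.
  case: h h' => [[x [s [[xJ Gx] e s01 pE]]]|[Euv p1 p2]] [[x' [s' [[xJ' Gx'] e' s01' pE']]]|[Euv' p1' p2']].
  + have ss : s' = s by move: pE; rewrite pE' => -[].
    have [sz|sn0] := eqVneq s 0.
      exists J; rewrite plJ pE sz mul0r; split=> //; [exact: in_pairr e|exact: in_pairr e'].
    have yx : y x = y x' by move: pE; rewrite pE' ss => -[/(mulfI sn0)].
    by case: ne; rewrite e e' (y_inj _ _ Gx Gx' yx).
  + rewrite pE; apply: spoke_chord e s01 xJ Gx Euv' _ _; first by move: p1'; rewrite pE.
    by move: p2'; rewrite pE.
  + rewrite pE'; have [||w [? ? ?]] := spoke_chord _ _ _ _ _ _ e' s01' xJ' Gx' Euv; last by exists w.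
      by move: p1; rewrite pE'.
    by move: p2; rewrite pE'.
  + have Mu : M u by exists v. have Mu' : M u' by exists v'.
    case: ne; have [u'E|u'E] := idx_inj u u' Mu Mu' (unit_gap p2 p2').
      by rewrite u'E in Euv' *; rewrite (matching Euv Euv').
    rewrite (mateE matching Euv) in u'E; rewrite u'E in Euv' *.
    by rewrite (matching Euv' (E_sym _ _ Euv)) setUC.
Qed.

End TwoPoles.

(** * Ideals and the annihilating-ideal graph *)

Section Ideals.
Variable R : comNzRingType.
Implicit Types (I J B : set R) (x y : R).

Definition nonzero_ideal I := is_ideal I /\ exists2 x, I x & x <> 0.
Definition kills I J := forall x y, I x -> J y -> x * y = 0.
Definition principal x : set R := [set y | exists a, y = a * x].
(** The ideal B + R x. *)
Definition adjoin B x : set R := [set y | exists b a, B b /\ y = b + a * x].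
Definition annihilator I : set R := [set y | forall x, I x -> x * y = 0].
Definition is_unit x := exists y, y * x = 1.

Lemma ideal0 I : is_ideal I -> I 0. Proof. by case. Qed.
Lemma idealD I x y : is_ideal I -> I x -> I y -> I (x + y). Proof. by case=> _ + _; exact. Qed.
Lemma idealM I a x : is_ideal I -> I x -> I (a * x). Proof. by case=> _ _; exact. Qed.
Lemma idealMr I a x : is_ideal I -> I x -> I (x * a).
Proof. by rewrite mulrC; exact: idealM. Qed.
Lemma idealB I x y : is_ideal I -> I x -> I y -> I (x - y).
Proof. by move=> iI Ix Iy; apply: idealD => //; rewrite -mulN1r; exact: idealM. Qed.

Lemma ideal_unit I x : is_ideal I -> I x -> is_unit x -> forall y, I y.
Proof. by move=> iI Ix [z zx] y; rewrite -[y]mulr1 -zx mulrA; exact: idealM. Qed.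

Lemma principal_ideal x : is_ideal (principal x).
Proof.
split=> [|_ _ [a ->] [b ->]|a _ [b ->]]; first by exists 0; rewrite mul0r.
  by exists (a + b); rewrite mulrDl.
by exists (a * b); rewrite mulrA.
Qed.

Lemma mem_principal x : principal x x. Proof. by exists 1; rewrite mul1r. Qed.

Lemma principal_sub I x : is_ideal I -> I x -> principal x `<=` I.
Proof. by move=> iI Ix _ [a ->]; exact: idealM. Qed.

Lemma principal_nonzero x : x <> 0 -> nonzero_ideal (principal x).
Proof. by move=> x0; split; [exact: principal_ideal|exists x => //; exact: mem_principal]. Qed.

Lemma adjoin_ideal B x : is_ideal B -> is_ideal (adjoin B x).
Proof.
move=> iB; split.
- by exists 0, 0; rewrite mul0r addr0; split=> //; exact: ideal0.
- move=> _ _ [b [a [Bb ->]]] [b' [a' [Bb' ->]]]; exists (b + b'), (a + a').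
  by split; [exact: idealD|ring].
- by move=> c _ [b [a [Bb ->]]]; exists (c * b), (c * a); split; [exact: idealM|ring].
Qed.

Lemma sub_adjoin B x : B `<=` adjoin B x.
Proof. by move=> b Bb; exists b, 0; rewrite mul0r addr0. Qed.

Lemma mem_adjoin B x : is_ideal B -> adjoin B x x.
Proof. by move=> iB; exists 0, 1; rewrite mul1r add0r; split=> //; exact: ideal0. Qed.

Lemma adjoin_sub B I x : is_ideal I -> B `<=` I -> I x -> adjoin B x `<=` I.
Proof. by move=> iI BI Ix _ [b [a [Bb ->]]]; apply: idealD => //; [exact: BI|exact: idealM]. Qed.

Lemma annihilator_ideal I : is_ideal (annihilator I).
Proof.
split=> [x _|x y Ix Iy z Iz|a x Ix z Iz]; first by rewrite mulr0.
  by rewrite mulrDr Ix // Iy // addr0.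
by rewrite mulrCA Ix // mulr0.
Qed.

Lemma setI_ideal I J : is_ideal I -> is_ideal J -> is_ideal (I `&` J).
Proof.
move=> iI iJ; split=> [|x y [Ix Jx] [Iy Jy]|a x [Ix Jx]].
- by split; exact: ideal0.
- by split; exact: idealD.
- by split; exact: idealM.
Qed.

Lemma setT_ideal : is_ideal [set: R]. Proof. by []. Qed.
Lemma zero_ideal : is_ideal [set 0 : R].
Proof. by split=> // [x y -> ->|a x ->]; rewrite ?addr0 ?mulr0. Qed.

Lemma nonzero_idealP I : is_ideal I -> I <> [set 0] -> nonzero_ideal I.
Proof.
move=> iI I0; split=> //; apply: contrapT => nx; apply: I0; apply/seteqP; split=> [x Ix|_ ->].
  by apply: contrapT => x0; apply: nx; exists x.
exact: ideal0.
Qed.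

Lemma nonzero_ideal_neq I : nonzero_ideal I -> I <> [set 0].
Proof. by move=> [_ [x Ix x0]] e; apply: x0; rewrite e in Ix. Qed.

Lemma kills_sym I J : kills I J -> kills J I.
Proof. by move=> IJ x y Jx Iy; rewrite mulrC IJ. Qed.

Lemma kills_mul I J : kills I J -> is_ideal I -> is_ideal J -> ideal_mul I J = [set 0].
Proof.
move=> IJ iI iJ; apply/seteqP; split=> [_ [s sP ->]|_ ->].
  by rewrite big_seq big1 // => p /sP[? ?]; exact: IJ.
by exists [::] => //; rewrite big_nil.
Qed.

Lemma mul_kills I J : ideal_mul I J = [set 0] -> kills I J.
Proof.
move=> e x y Ix Jy; suff : ideal_mul I J (x * y) by rewrite e.
by exists [:: (x, y)]; rewrite ?big_seq1 // => p; rewrite inE => /eqP ->.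
Qed.

Lemma AG_adjP I J : adj (AG R) I J <-> [/\ nonzero_ideal I, nonzero_ideal J, I <> J & kills I J].
Proof.
split=> [[[[iI _] I0] [[iJ _] J0] IJ /mul_kills k]|[nI nJ IJ k]].
  by split=> //; exact: nonzero_idealP.
have [iI iJ] := (proj1 nI, proj1 nJ).
have [I0 J0] := (nonzero_ideal_neq nI, nonzero_ideal_neq nJ).
split=> //; try by exact: kills_mul.
  by split=> //; split=> //; exists J; split=> //; exact: kills_mul.
by split=> //; split=> //; exists I; split=> //; apply: kills_mul => //; exact: kills_sym.
Qed.

(** Otherwise choose larger and larger members of F. *)
Lemma noetherian_max (F : set (set R)) : noetherian R -> (forall I, F I -> is_ideal I) -> F !=set0 ->
  exists2 I, F I & forall J, F J -> I `<=` J -> J = I.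
Proof.
move=> noeth iF [I0 FI0]; apply: contrapT => nmax.
have /boolp.choice[next nextP] I : exists J, F I -> [/\ F J, I `<=` J & J <> I].
  have [FI|] := pselect (F I); last by exists I.
  apply: contrapT => nJ; apply: nmax; exists I => // J FJ IJ; apply: contrapT => JI.
  by apply: nJ; exists J.
pose c k := iter k next I0.
have Fc k : F (c k) by elim: k => //= k /nextP[].
have [k||N cN] := noeth c; first exact: iF.
  by move=> k; have [] := nextP _ (Fc k).
by have [_ _] := nextP _ (Fc N); apply; exact: cN (leqnSn N).
Qed.

End Ideals.

Section IdealGraph.
Variables (K : realType) (R : comNzRingType) (g : nat).
Variables (pos : set R -> K * K * K) (edge : set R -> set R -> set (K * K * K)).
Hypothesis drawing : is_drawing (AG R) (@surface K g) pos edge.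
Implicit Types (I J : set R) (A : set (set R)).

Lemma no_three_killers A I0 I1 I2 : infinite_set A -> (forall I, A I -> nonzero_ideal I) ->
  [/\ nonzero_ideal I0, nonzero_ideal I1 & nonzero_ideal I2] ->
  [/\ I0 <> I1, I0 <> I2 & I1 <> I2] ->
  (forall I, A I -> [/\ kills I0 I, kills I1 I & kills I2 I]) -> False.
Proof.
move=> infA nA [n0 n1 n2] [d01 d02 d12] kA.
have infB : infinite_set (A `\` [set I0; I1; I2]).
  exact: infinite_setD.
have [t [t_inj tP]] := infinite_seq infB.
pose a (b : bool) := if b then I1 else I0.
apply: (@no_infinite_K3 _ _ _ _ _ _ drawing a I2 t) => //.
- move=> b j; have [At nt] := tP j; have [k0 k1 k2] := kA _ At.
  by apply/AG_adjP; case: b => /=; split=> //; [exact: nA|move=> e|exact: nA|move=> e]; apply: nt; rewrite -e; left; [right|left].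
- by case.
- move=> j; have [At nt] := tP j; have [k0 k1 k2] := kA _ At.
  apply/AG_adjP; split=> //; [exact: nA|move=> e]; apply: nt; rewrite -e; by right.
Qed.

Lemma no_infinite_clique A : infinite_set A -> (forall I, A I -> nonzero_ideal I) ->
  (forall I J, A I -> A J -> kills I J) -> False.
Proof.
move=> infA nA kA; have [t [t_inj tP]] := infinite_seq infA.
apply: (@no_three_killers A (t 0%N) (t 1%N) (t 2%N)) => //.
- by split; exact: nA.
- by split=> /t_inj.
- by move=> I AI; split; exact: kA.
Qed.

(** If some U I is used infinitely often it is itself a third killer; otherwise
the U I can be chosen distinct. *)
Lemma no_subdivided_killers A I0 I1 I2 (U : set R -> set R) : infinite_set A ->
  (forall I, A I -> nonzero_ideal I /\ nonzero_ideal (U I)) ->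
  [/\ nonzero_ideal I0, nonzero_ideal I1 & nonzero_ideal I2] ->
  [/\ I0 <> I1, I0 <> I2 & I1 <> I2] ->
  (forall I, A I -> [/\ kills I0 I, kills I1 I, kills (U I) I & kills I2 (U I)]) ->
  (forall I, A I -> [/\ I0 <> U I, I1 <> U I & I2 <> U I]) ->
  (forall I J, A I -> A J -> U I <> J) -> False.
Proof.
move=> infA nA [n0 n1 n2] [d01 d02 d12] kA dU dUA.
pose B := A `\` [set I0; I1; I2].
have infB : infinite_set B.
  exact: infinite_setD.
have [finU|infU] := pselect (finite_set (U @` B)).
  have [V infV] : exists V, infinite_set (B `&` [set I | U I = V]).
    apply: contrapT => nV; apply: infB.
    have -> : B = \bigcup_(V in U @` B) (B `&` [set I | U I = V]).
      apply/seteqP; split=> [I AI|I [_ _ []]//]; by exists (U I) => //; exists I.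
    apply: bigcup_finite => // V _; apply: contrapT => infV; apply: nV; by exists V.
  have [t [_ /(_ 0%N)[[At _] Vt]]] := infinite_seq infV.
  apply: (@no_three_killers _ I0 I1 V infV).
  - by move=> I [[/nA[]]].
  - by split=> //; rewrite -Vt; case: (nA _ At).
  - by split=> //; rewrite -Vt; case: (dU _ At).
  - by move=> I [[/kA[? ? k _] _] VI]; split=> //; rewrite -VI.
have [u [u_inj uP]] := infinite_seq infU.
have /boolp.choice[t tP] j : exists I, B I /\ U I = u j by have [I AI <-] := uP j; exists I.
pose a (b : bool) := if b then I1 else I0.
have At j : A (t j) by case: (tP j) => -[].
have Ut j : U (t j) = u j by case: (tP j).
have nIt j : ~ [set I0; I1; I2] (t j) by case: (tP j) => -[].
have nt j := nA _ (At j); have kt j := kA _ (At j); have dt j := dU _ (At j).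
apply: (@no_subdivided_K3 _ _ _ _ _ _ drawing a I2 t _ _ _ u) => //.
- by move=> i j e; apply: u_inj; rewrite -!Ut e.
- move=> b j; have [[nt1 _] [k0 k1 _ _]] := (nt j, kt j).
  apply/AG_adjP; case: b => /=; split=> // e; apply: (nIt j); rewrite -e; left; by [right|left].
- by case.
- by move=> b j; have [? ? _] := dt j; rewrite -Ut; case: b.
- by move=> i j; rewrite -Ut; exact: dUA.
- by move=> i e; apply: (nIt i); rewrite -e; right.
- by move=> j; rewrite -Ut; apply/AG_adjP; have [[[_ nu] [_ _ _ k]] [_ _ d]] := (nt j, kt j, dt j); split.
- move=> j; rewrite -Ut; apply/AG_adjP; have [[nt1 nu] [_ _ k _]] := (nt j, kt j).
  by split=> //; exact: dUA.
Qed.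

End IdealGraph.

(** * Finiteness conditions on the ideals of a ring *)

Lemma finite_of_injection (T U : Type) (f : T -> U) (A : set T) (B : set U) :
  finite_set B -> (forall x, A x -> B (f x)) ->
  (forall x y, A x -> A y -> f x = f y -> x = y) -> finite_set A.
Proof.
move=> finB AB inj; have /card_eqPle[_ le] : (f @` A #= A)%card.
  by apply: inj_card_eq => x y; rewrite !inE; exact: inj.
by apply: card_le_finite le _; apply: sub_finite_set finB => _ [x /AB ? <-].
Qed.

Lemma asbool_iff (P Q : Prop) : `[< P >] = `[< Q >] -> (P <-> Q).
Proof. by move=> e; split=> /asboolP; [rewrite e|rewrite -e] => /asboolP. Qed.

Lemma finite_subsets (T : choiceType) : finite_set [set: T] -> finite_set [set: set T].
Proof.
move=> /finite_seqP[s sE]; pose f (A : set T) := map_tuple (fun x => `[< A x >]) (in_tuple s).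
apply: (@finite_of_injection _ _ f _ setT) => // A B _ _ e.
have AB x : `[< A x >] = `[< B x >].
  have xs : x \in s by move: (I : [set: T] x); rewrite sE.
  by move: (congr1 val e) => /= /eq_in_map; apply.
by apply/seteqP; split=> x /asboolP; [rewrite AB|rewrite -AB] => /asboolP.
Qed.

Section Comaximal.
Variable R : comNzRingType.
Hypothesis noeth : noetherian R.
Implicit Types (I J M : set R).

Definition maximal_ideal M :=
  [/\ is_ideal M, ~ M 1 & forall a, ~ M a -> exists r, M (1 - r * a)].

Lemma exists_maximal x : ~ is_unit x -> exists2 M, maximal_ideal M & M x.
Proof.
move=> nu; pose F := [set I : set R | [/\ is_ideal I, ~ I 1 & I x]].
have [||M [iM M1 Mx] max] := @noetherian_max R F noeth; first by move=> I [].
  exists (principal x); split; [exact: principal_ideal| |exact: mem_principal].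
  by move=> [a e]; apply: nu; exists a.
exists M => //; split=> // a Ma; apply: contrapT => nr; apply: Ma.
rewrite -(max (adjoin M a)); [exact: mem_adjoin| |exact: sub_adjoin].
split; [exact: adjoin_ideal| |exact: sub_adjoin].
by move=> [b [r [Mb e]]]; apply: nr; exists r; rewrite e addrK.
Qed.

(** If a in J is outside M, then 1 - r a is in M for some r, and x is the sum of
(r a) x in J and (1 - r a) x in the trace of I on M. *)
Lemma maximal_step M I J : maximal_ideal M -> is_ideal I -> is_ideal J ->
  I `&` M `<=` J -> (J `<=` M -> I `<=` M) -> I `<=` J.
Proof.
move=> [iM M1 inv] iI iJ IMJ JM x Ix.
have [/JM IM|nJM] := pselect (J `<=` M); first by apply: IMJ; split=> //; exact: IM.
have [a Ja Ma] : exists2 a, J a & ~ M a.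
  by apply: contrapT => na; apply: nJM => a Ja; apply: contrapT => Ma; apply: na; exists a.
have [r Mr] := inv a Ma; have -> : x = (r * a) * x + x * (1 - r * a) by ring.
apply: idealD => //; first by apply: idealMr => //; exact: idealM.
by apply: IMJ; split; [exact: idealMr|exact: idealM].
Qed.

Lemma maximal_eq M I J : maximal_ideal M -> is_ideal I -> is_ideal J ->
  I `&` M = J `&` M -> (I `<=` M <-> J `<=` M) -> I = J.
Proof.
move=> mM iI iJ e [IJ JI]; apply/seteqP; split; apply: (@maximal_step M) => //.
  by rewrite e; exact: subIsetl.
by rewrite -e; exact: subIsetl.
Qed.

(** Apply [maximal_eq] first to the traces on M2, then to the ideals. *)
Lemma finite_ideals_below M1 M2 : maximal_ideal M1 -> maximal_ideal M2 ->
  finite_set [set I | is_ideal I /\ I `<=` M1 `&` M2] -> finite_set [set I : set R | is_ideal I].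
Proof.
move=> mM1 mM2 fin; have [iM1 iM2] : is_ideal M1 /\ is_ideal M2 by case: mM1; case: mM2.
pose f I := (I `&` (M1 `&` M2), (`[< I `&` M2 `<=` M1 >], `[< I `<=` M2 >])).
apply: (@finite_of_injection _ _ f _ ([set I | is_ideal I /\ I `<=` M1 `&` M2] `*` setT)).
- by apply: finite_setX => //; exact: finite_finset.
- move=> I iI; split=> //=; split; last by move=> x [].
  by apply: setI_ideal => //; exact: setI_ideal.
- move=> I J iI iJ [eN e1 e2].
  apply: (maximal_eq mM2) => //; last exact: asbool_iff e2.
  apply: (maximal_eq mM1); try exact: setI_ideal; try exact: asbool_iff e1.
  by rewrite -!setIA ![M2 `&` M1]setIC.
Qed.

End Comaximal.

Section LocalRing.
Variable R : comNzRingType.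
Hypothesis noeth : noetherian R.
Implicit Types (I J B : set R) (x y : R).
Local Notation m := [set x : R | ~ is_unit x].
Hypothesis m_add : forall x y, m x -> m y -> m (x + y).

Lemma m_ideal : is_ideal m.
Proof.
split=> // [[y /eqP]|a x mx [y e]]; first by rewrite mulr0 eq_sym oner_eq0.
by apply: mx; exists (y * a); rewrite -mulrA.
Qed.

Lemma unit1 : is_unit (1 : R). Proof. by exists 1; rewrite mulr1. Qed.

Lemma unit_sub x : m x -> is_unit (1 - x).
Proof. by move=> mx; apply: contrapT => n; have := m_add n mx; rewrite subrK; apply; exact: unit1. Qed.

Lemma sub_m I : is_ideal I -> ~ I 1 -> I `<=` m.
Proof. by move=> iI I1 x Ix /(ideal_unit iI Ix) IT; exact: I1. Qed.

Lemma ideal_mul_ideal I J : is_ideal I -> is_ideal J -> is_ideal (ideal_mul I J).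
Proof.
move=> iI iJ; split.
- by exists [::] => //; rewrite big_nil.
- move=> _ _ [s sP ->] [t tP ->]; exists (s ++ t); last by rewrite big_cat.
  by move=> p; rewrite mem_cat => /orP[/sP|/tP].
- move=> a _ [s sP ->]; exists [seq (a * p.1, p.2) | p <- s].
    by move=> _ /mapP[p /sP[? ?] ->]; split=> //; exact: idealM.
  by rewrite big_map mulr_sumr; apply: eq_bigr => p _; rewrite mulrA.
Qed.

Lemma mem_ideal_mul I J x y : I x -> J y -> ideal_mul I J (x * y).
Proof. by move=> Ix Jy; exists [:: (x, y)]; rewrite ?big_seq1 // => p; rewrite inE => /eqP ->. Qed.

Lemma ideal_mul_sub I J L : is_ideal L -> (forall x y, I x -> J y -> L (x * y)) -> ideal_mul I J `<=` L.
Proof.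
move=> iL IJL _ [s sP ->]; rewrite big_seq; apply: (big_ind (fun x => L x)).
- exact: ideal0.
- by move=> x y; exact: idealD.
- by move=> p /sP[? ?]; exact: IJL.
Qed.

(** Let L be maximal among the proper subideals of I; then I/L is simple, so m I is
contained in L. *)
Lemma nakayama I : nonzero_ideal I -> exists2 x, I x & ~ ideal_mul m I x.
Proof.
move=> [iI [z Iz z0]]; pose F := [set L : set R | [/\ is_ideal L, L `<=` I & L <> I]].
have [||L [iL LI LnI] max] := @noetherian_max R F noeth; first by move=> L [].
  exists [set 0]; split; [exact: zero_ideal|by move=> _ ->; exact: ideal0|].
  by move=> e; apply: z0; rewrite -e in Iz.
have [x Ix Lx] : exists2 x, I x & ~ L x.
  apply: contrapT => nx; apply: LnI; apply/seteqP; split=> // x Ix.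
  by apply: contrapT => Lx; apply: nx; exists x.
exists x => //; suff sub : ideal_mul m I `<=` L by move=> /sub.
apply: ideal_mul_sub => // y w my Iw; apply: contrapT => nL.
have eI : adjoin L (y * w) = I.
  apply: contrapT => ne; apply: nL; rewrite -(max (adjoin L (y * w))).
  - exact: mem_adjoin.
  - by split=> //; [exact: adjoin_ideal|apply: adjoin_sub => //; exact: idealM].
  - exact: sub_adjoin.
have [l [r [Ll e]]] : adjoin L (y * w) w by rewrite eI.
apply: nL; apply: idealM => //.
have [v ve] : is_unit (1 - r * y) by apply: unit_sub; exact: idealM m_ideal my.
rewrite -[w]mul1r -ve -mulrA; apply: idealM => //.
by rewrite mulrBl mul1r {1}e mulrA addrK.
Qed.

Definition ideal_pow I k := iter k (ideal_mul m) I.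

Lemma ideal_pow_ideal I k : is_ideal I -> is_ideal (ideal_pow I k).
Proof. by move=> iI; elim: k => //= k; exact: ideal_mul_ideal m_ideal. Qed.

Section Nilpotent.
Variable e : nat.
Hypothesis nilpotent : ideal_pow [set: R] e `<=` [set 0].

(** Multiply x by elements of m as long as the result stays outside B; nilpotency
bounds the number of steps. *)
Lemma socle_layer B x : is_ideal B -> ~ B x ->
  exists a, ~ B (a * x) /\ forall c, m c -> B (c * (a * x)).
Proof.
move=> iB; suff H k y : (forall z, ideal_pow [set: R] k z -> B (z * y)) -> ~ B y ->
    exists a, ~ B (a * y) /\ forall c, m c -> B (c * (a * y)).
  by apply: (H e) => z /nilpotent ->; rewrite mul0r; exact: ideal0.
elim: k y => [|k IH] y Bk nB; first by case: nB; rewrite -[y]mul1r; exact: Bk.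
have [all|] := pselect (forall c, m c -> B (c * y)); first by exists 1; rewrite mul1r.
move=> /existsNP[c /not_implyP[mc nBc]].
have [z pz|//|a [na aP]] := IH (c * y); last by exists (a * c); rewrite -mulrA.
by rewrite mulrCA mulrA; apply: Bk; exact: mem_ideal_mul.
Qed.

(** If R/m were finite, adjoining a multiple w of an element with m w in I would turn
a finite ideal I into a larger finite one; a maximal finite ideal is therefore
R, and a finite ring has finitely many ideals. *)
Lemma infinite_residues : infinite_set [set I : set R | is_ideal I] ->
  exists r : nat -> R, forall i j, i <> j -> is_unit (r i - r j).
Proof.
move=> inf; pose cls x := [set y | m (x - y)].
have cls_eq x y : m (x - y) -> cls x = cls y.
  move=> xy; apply/seteqP; split=> z h; rewrite /cls /mkset in h *.
    have : m ((x - z) - (x - y)) := idealB m_ideal h xy.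
    by rewrite (_ : _ - _ = y - z) //; ring.
  have : m ((x - y) + (y - z)) := m_add xy h.
  by rewrite (_ : _ + _ = x - z) //; ring.
have [finD|infD] := pselect (finite_set (range cls)); last first.
  have [t [t_inj tP]] := infinite_seq infD.
  have /boolp.choice[r rP] i : exists x, cls x = t i by have [x _ <-] := tP i; exists x.
  exists r => i j ij; apply: contrapT => nu; apply: ij; apply: t_inj.
  by rewrite -!rP; exact: cls_eq.
exfalso; apply: inf; apply: sub_finite_set (finite_subsets _) => //.
have /boolp.choice[rep repP] (C : set R) : exists c, range cls C -> C c.
  have [[x _ <-]|] := pselect (range cls C); last by exists 0.
  by exists x => _; rewrite /cls /= subrr; exact: ideal0 m_ideal.
pose F := [set I : set R | is_ideal I /\ finite_set I].
have [||I [iI finI] max] := @noetherian_max R F noeth; first by move=> I [].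
  by exists [set 0]; split; [exact: zero_ideal|exact: finite_set1].
suff IT : I = setT by rewrite -IT.
apply/seteqP; split=> // x _; apply: contrapT => nIx.
have [a [naI aI]] := socle_layer iI nIx; apply: naI; set w := a * x in aI *.
rewrite -(max (adjoin I w)); [exact: mem_adjoin| |exact: sub_adjoin].
split; first exact: adjoin_ideal.
apply: (@sub_finite_set _ _ (\bigcup_(C in range cls) ((fun i => i + rep C * w) @` I))); last first.
  by apply: bigcup_finite => // C _; exact: finite_image.
move=> _ [i [c [Ii ->]]]; exists (cls c); first by exists c.
exists (i + (c - rep (cls c)) * w); last by ring.
apply: idealD => //; apply: aI; exact: (repP (cls c) (imageT _ _)).
Qed.

End Nilpotent.

End LocalRing.

(** * Local rings *)

Lemma infinite_range (T : Type) (t : nat -> T) : injective t -> infinite_set (range t).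
Proof.
move=> t_inj fin; apply: infinite_nat; apply: (finite_of_injection fin) => [n _|m n _ _]; last exact: t_inj.
by exists n.
Qed.

Lemma kills_principal (R : comNzRingType) (x y : R) : x * y = 0 -> kills (principal x) (principal y).
Proof. by move=> xy _ _ [a ->] [b ->]; rewrite mulrACA xy mulr0. Qed.

Section LocalGraph.
Variables (K : realType) (R : comNzRingType) (g : nat).
Variables (pos : set R -> K * K * K) (edge : set R -> set R -> set (K * K * K)).
Hypothesis drawing : is_drawing (AG R) (@surface K g) pos edge.
Hypothesis nonplanar : ~ embeddable K (AG R) 0.
Hypothesis noeth : noetherian R.
Hypothesis killed : forall I : set R, nonzero_ideal I -> ~ I 1 -> exists2 y, y <> 0 & annihilator I y.
Hypothesis inf_ideals : infinite_set [set I : set R | is_ideal I].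
Implicit Types (I J B : set R) (x y z : R).
Local Notation m := [set x : R | ~ is_unit x].
Hypothesis m_add : forall x y, m x -> m y -> m (x + y).
Local Notation S := (annihilator m).
Local Notation m_ideal := (m_ideal m_add).

Let pos_inj : set_inj (verts (AG R)) pos. Proof. by case: drawing => -[]. Qed.

Lemma m_nonzero : nonzero_ideal m.
Proof.
apply: nonzero_idealP; first exact: m_ideal.
move=> m0; apply: inf_ideals; apply: (@sub_finite_set _ _ [set [set 0]; setT]) => // I iI.
have [I1|I1] := pselect (I 1); [right|left]; apply/seteqP; split=> // x.
- by move=> _; apply: ideal_unit iI I1 _ _; exact: unit1.
- by move=> /(sub_m iI I1); rewrite m0.
- by move=> ->; exact: ideal0.
Qed.

Lemma m1 : ~ m 1. Proof. by apply; exact: unit1. Qed.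

Lemma S_ideal : is_ideal S. Proof. exact: annihilator_ideal. Qed.

Lemma S_nonzero : nonzero_ideal S.
Proof. by split; [exact: S_ideal|have [y y0 Sy] := killed m_nonzero m1; exists y]. Qed.

Lemma proper_sub I J : is_ideal I -> nonzero_ideal J -> kills I J -> I `<=` m.
Proof.
move=> iI [_ [x Jx x0]] IJ; apply: sub_m => // I1.
by apply: x0; rewrite -[x]mul1r IJ.
Qed.

Lemma S_sub_m : S `<=` m.
Proof. by apply: proper_sub S_ideal m_nonzero _ => x y Sx my; rewrite mulrC Sx. Qed.

Lemma mS x y : m x -> S y -> x * y = 0. Proof. by move=> mx Sy; exact: Sy. Qed.

Lemma unit_cancel I c x : is_ideal I -> is_unit c -> I (c * x) -> I x.
Proof. by move=> iI [d dc] Icx; rewrite -[x]mul1r -dc -mulrA; exact: idealM. Qed.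

Section NotNilpotent.
Hypothesis not_nilpotent : forall k, ~ ideal_pow [set: R] k `<=` [set 0].

Lemma pow_nonzero k : nonzero_ideal (ideal_pow [set: R] k).
Proof.
have iP : is_ideal (ideal_pow [set: R] k) by exact: ideal_pow_ideal.
by apply: nonzero_idealP => // e; apply: (@not_nilpotent k); rewrite e.
Qed.

Lemma pow_subS I k : is_ideal I -> ideal_pow I k.+1 `<=` ideal_pow I k.
Proof.
move=> iI; have iP : is_ideal (ideal_pow I k) by exact: ideal_pow_ideal.
by apply: ideal_mul_sub => // x y _; exact: idealM.
Qed.

Lemma pow_sub I j k : is_ideal I -> (j <= k)%N -> ideal_pow I k `<=` ideal_pow I j.
Proof.
move=> iI /subnKC <-; elim: (k - j)%N => [|n IH]; first by rewrite addn0.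
by rewrite addnS => x /(pow_subS iI); exact: IH.
Qed.

Lemma pow_inj I : (forall k, nonzero_ideal (ideal_pow I k)) -> injective (ideal_pow I).
Proof.
move=> nI; have iI : is_ideal I by have [] := nI 0%N.
have lt j k : (j < k)%N -> ideal_pow I j <> ideal_pow I k.
  move=> jk e; have [x Ix nx] := nakayama noeth m_add (nI j); apply: nx.
  by apply: (pow_sub iI jk); rewrite -e.
by move=> j k e; case: (ltngtP j k) => // /lt; rewrite e.
Qed.

Lemma pow_mul I k x y : is_ideal I -> ideal_pow [set: R] k x -> I y -> ideal_pow I k (x * y).
Proof.
move=> iI + Iy; elim: k x => [|k IH] x; first by move=> _; exact: idealM.
have iP : is_ideal (ideal_pow I k.+1) by exact: ideal_pow_ideal.
apply: (@ideal_mul_sub R m (ideal_pow [set: R] k) [set x | ideal_pow I k.+1 (x * y)]).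
  split=> [|a b|a b] /=; rewrite ?mul0r ?mulrDl -?mulrA; [exact: ideal0|exact: idealD|exact: idealM].
by move=> a b ma pb; rewrite /mkset -mulrA; apply: mem_ideal_mul => //; exact: IH.
Qed.

Definition torsion I := exists k, ideal_pow I k `<=` [set 0].

Lemma torsion_kills I : is_ideal I -> torsion I ->
  exists k, forall j, (k <= j)%N -> kills I (ideal_pow [set: R] j).
Proof.
move=> iI [k Ik]; exists k => j kj x y Ix /(pow_sub (setT_ideal R) kj) py.
by rewrite mulrC; apply: Ik; exact: pow_mul.
Qed.

(** All large powers of m are killed by the three ideals. *)
Lemma two_torsion I0 I1 I2 : [/\ nonzero_ideal I0, nonzero_ideal I1 & nonzero_ideal I2] ->
  [/\ I0 <> I1, I0 <> I2 & I1 <> I2] -> torsion I0 -> torsion I1 -> torsion I2 -> False.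
Proof.
move=> n dist t0 t1 t2; have [[i0 _] [i1 _] [i2 _]] := n.
have [k0 K0] := torsion_kills i0 t0; have [k1 K1] := torsion_kills i1 t1.
have [k2 K2] := torsion_kills i2 t2.
pose t j := ideal_pow [set: R] (j + (k0 + k1 + k2)).
apply: (no_three_killers drawing (A := range t) _ _ n dist).
- apply: infinite_range => i j /(pow_inj pow_nonzero); lia.
- by move=> _ [j _ <-]; exact: pow_nonzero.
- by move=> _ [j _ <-]; split; [apply: K0|apply: K1|apply: K2]; lia.
Qed.

(** The ideals m^k I are distinct by the lemma of Nakayama, and they are killed by
J, m J and m^2 J. *)
Lemma torsion_edge I J : nonzero_ideal I -> nonzero_ideal J -> kills I J -> ~ torsion I -> ~ torsion J -> False.
Proof.
move=> [iI _] [iJ _] IJ tI tJ.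
have alive L : is_ideal L -> ~ torsion L -> forall k, nonzero_ideal (ideal_pow L k).
  move=> iL tL k; apply: nonzero_idealP; first exact: ideal_pow_ideal.
  by move=> e; apply: tL; exists k; rewrite e.
have aI := alive I iI tI; have aJ := alive J iJ tJ.
apply: (@no_three_killers _ _ _ _ _ drawing (range (ideal_pow I)) (ideal_pow J 0) (ideal_pow J 1) (ideal_pow J 2)).
- exact: infinite_range (pow_inj aI).
- by move=> _ [k _ <-].
- by split.
- by split=> /(pow_inj aJ).
- have kl j k : kills (ideal_pow J j) (ideal_pow I k).
    move=> x y /(pow_sub iJ (leq0n j)) Jx /(pow_sub iI (leq0n k)) Iy.
    by rewrite mulrC IJ.
  by move=> _ [k _ <-].
Qed.

(** Both poles are torsion ideals, possibly the same one. *)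
Theorem not_nilpotent_False : False.
Proof.
have S_torsion : torsion S.
  exists 1%N; apply: ideal_mul_sub; first exact: zero_ideal.
  by move=> x y mx Sy; exact: Sy.
have [J cover] : exists J, forall I, nonzero_ideal I -> torsion I -> I = S \/ I = J.
  have [[J [nJ tJ JS]]|none] := pselect (exists J, [/\ nonzero_ideal J, torsion J & J <> S]).
    exists J => I nI tI; apply: contrapT => /not_orP[IS IJ].
    by apply: (@two_torsion S J I) => //; split=> //; [exact: S_nonzero|exact/nesym|exact/nesym|exact/nesym].
  exists S => I nI tI; left.
  by apply: contrapT => IS; apply: none; exists I.
have noE u v : [/\ adj (AG R) u v, u <> S /\ u <> J & v <> S /\ v <> J] -> False.
  move=> [/AG_adjP[nu nv _ k] [uS uJ] [vS vJ]].
  by apply: (torsion_edge nu nv k) => [/(cover _ nu)[]|/(cover _ nv)[]].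
apply: nonplanar; apply: (@two_poles_embeddable _ _ _ S J pos) => //.
- by move=> u v w /noE.
- by rewrite (_ : [set _ | _] = set0) //; apply/seteqP; split=> // u [v /noE].
Qed.

End NotNilpotent.

Section Nilpotent.
Variable e : nat.
Hypothesis nilpotent : ideal_pow [set: R] e `<=` [set 0].

Let r_exists := infinite_residues noeth m_add nilpotent inf_ideals.

Section Lines.
Variables (B : set R) (x y : R).
Hypotheses (B_ideal : is_ideal B) (x_notin : ~ B x) (y_notin : ~ adjoin B x y).
Hypotheses (mx : forall c, m c -> B (c * x)) (my : forall c, m c -> B (c * y)).

Lemma line_notin c : ~ B (x + c * y).
Proof.
move=> Bxy; have [uc|mc] := pselect (is_unit c).
  apply: y_notin; apply: (unit_cancel (adjoin_ideal x B_ideal) uc).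
  by exists (x + c * y), (- 1); split=> //; ring.
by apply: x_notin; rewrite -[x](addrK (c * y)); apply: idealB => //; exact: my.
Qed.

(** If x and y are independent modulo B then the lines through x + r i y are
distinct for distinct residues r i. *)
Lemma lines_inj (r : nat -> R) : (forall i j, i <> j -> is_unit (r i - r j)) ->
  injective (fun i => principal (x + r i * y)).
Proof.
move=> rP i j eq_ij; apply: contrapT => ij; have urij := rP i j ij.
have [c cE] : principal (x + r i * y) (x + r j * y) by rewrite eq_ij; exact: mem_principal.
have lin : (1 - c) * x = (c * r i - r j) * y.
  have -> : (1 - c) * x = (x + r j * y) - r j * y - c * x by ring.
  by rewrite cE; ring.
have [u1|m1] := pselect (is_unit (1 - c)).
  have [uc|mc] := pselect (is_unit (c * r i - r j)).
    apply: y_notin; apply: (unit_cancel (adjoin_ideal x B_ideal) uc); rewrite -lin.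
    by exists 0, (1 - c); split; [exact: ideal0|rewrite add0r].
  by apply: x_notin; apply: (unit_cancel B_ideal u1); rewrite lin; apply: my.
apply: y_notin; apply: sub_adjoin; apply: (unit_cancel B_ideal urij).
have -> : (r i - r j) * y = (1 - c) * x + r i * ((1 - c) * y).
  by rewrite lin; ring.
by apply: idealD => //; [exact: mx|apply: idealM => //; exact: my].
Qed.

End Lines.

(** Otherwise S contains infinitely many lines, which kill one another. *)
Lemma socle_simple x y : S x -> x <> 0 -> S y -> principal x y.
Proof.
move=> Sx x0 Sy; apply: contrapT => nxy; have [r rP] := r_exists.
have Z0 := zero_ideal R.
have ny : ~ adjoin [set 0] x y by move=> [_ [a [-> e']]]; apply: nxy; exists a; rewrite e' add0r.
have mS0 z c : S z -> m c -> [set 0] (c * z) by move=> Sz mc; exact: Sz.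
pose t i := principal (x + r i * y).
have Sl i : S (x + r i * y) by exact: (idealD S_ideal Sx (idealM _ S_ideal Sy)).
apply: (@no_infinite_clique _ _ _ _ _ drawing (range t)).
- apply: infinite_range; apply: (lines_inj Z0 x0 ny) => // c; exact: mS0.
- by move=> _ [i _ <-]; apply: principal_nonzero; apply: (line_notin Z0 x0 ny) => c; exact: mS0.
- move=> _ _ [i _ <-] [j _ <-]; apply: kills_principal; apply: mS => //; exact: S_sub_m.
Qed.

Lemma S_min I : nonzero_ideal I -> S `<=` I.
Proof.
move=> [iI [x Ix x0]]; have [a [ax0 max]] := socle_layer nilpotent (zero_ideal R) x0.
have Sax : S (a * x) by move=> c mc; exact: max.
move=> y Sy; apply: (principal_sub iI _ (socle_simple Sax ax0 Sy)); exact: idealM.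
Qed.

Lemma outside_S I : nonzero_ideal I -> I <> S -> exists2 x, I x & ~ S x.
Proof.
move=> nI IS; apply: contrapT => nx; apply: IS; apply/seteqP; split; last exact: S_min.
by move=> x Ix; apply: contrapT => Sx; apply: nx; exists x.
Qed.

(** The annihilator of m^2, by its relation to S. *)
Definition layer2 : set R := [set z | forall a, m a -> S (a * z)].
Local Notation Z := layer2.

Lemma Z_ideal : is_ideal Z.
Proof.
split=> [a _|x y Zx Zy a ma|b x Zx a ma]; first by rewrite mulr0; exact: ideal0 S_ideal.
  by rewrite mulrDr; apply: idealD S_ideal _ _; [exact: Zx|exact: Zy].
by rewrite mulrCA; apply: idealM S_ideal _; exact: Zx.
Qed.

Lemma not_S x : ~ S x -> exists2 a, m a & a * x <> 0.
Proof.
by move=> nS; apply: contrapT => na; apply: nS => a ma; apply: contrapT => ax; apply: na; exists a.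
Qed.

Lemma not_Z x : ~ Z x -> exists2 a, m a & ~ S (a * x).
Proof.
by move=> nZ; apply: contrapT => na; apply: nZ => a ma; apply: contrapT => ax; apply: na; exists a.
Qed.

Lemma S_neqT : ~ S 1.
Proof. by move=> /S_sub_m; exact: m1. Qed.

Lemma exists_layer2 : exists2 q, Z q & ~ S q.
Proof.
by have [a [nS aS]] := socle_layer nilpotent S_ideal S_neqT; exists (a * 1).
Qed.

Section RankOne.
Variable q : R.
Hypotheses (Zq : Z q) (q_notin : ~ S q) (Z_sub : Z `<=` adjoin S q).

(** Choose u in m with u q nonzero.  The annihilator of u meets the span of S and q
only in S, so by [socle_layer] it is S; hence the quotients of successive
annihilators of powers of u embed in S, which is simple, and the ideals are
exactly these annihilators. *)
Lemma rank_one_finite : False.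
Proof.
have [u mu uq0] := not_S q_notin.
have annu y : u * y = 0 -> S y.
  move=> uy; apply: contrapT => nS; have [a [nSa aS]] := socle_layer nilpotent S_ideal nS.
  have [s [c [Ss ay]]] : adjoin S q (a * y) by apply: Z_sub => c mc; exact: aS.
  have : u * (c * q) = 0.
    by rewrite -[c * q](addKr s) -ay mulrDr mulrCA uy mulr0 addr0 mulrN mS // oppr0.
  have [uc|mc] := pselect (is_unit c).
    by rewrite mulrCA => /(@unit_cancel [set 0] _ _ (zero_ideal R) uc).
  move=> _; apply: nSa; rewrite ay; apply: idealD S_ideal Ss _; exact: Zq.
pose ker i : set R := [set y | u ^+ i * y = 0].
have ue : u ^+ e = 0.
  apply: nilpotent; elim: (e) => //= k IH; rewrite exprS.
  by apply: mem_ideal_mul.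
have kerS i y y' : ker i.+1 y -> ~ ker i y -> ker i.+1 y' -> exists c, ker i (y' - c * y).
  rewrite /ker /= !exprS -!mulrA => /annu Sy y0 /annu Sy'.
  by have [c cE] := socle_simple Sy y0 Sy'; exists c; rewrite mulrBr cE; ring.
apply: inf_ideals; apply: (@sub_finite_set _ _ (ker @` `I_e.+1)); last exact/finite_image/finite_II.
move=> I iI; have ex : exists i, `[< I `<=` ker i >].
  by exists e; apply/asboolP => y _; rewrite /ker /= ue mul0r.
case: (ex_minnP ex) => i /asboolP Ii min; exists i.
  by rewrite /= ltnS; apply: min; apply/asboolP => y _; rewrite /ker /= ue mul0r.
apply/seteqP; split=> //; case: i Ii min => [_ _ y|i Ii min].
  by rewrite /ker /= expr0 mul1r => ->; exact: ideal0.
have [y Iy ny] : exists2 y, I y & ~ ker i y.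
  apply: contrapT => ny; suff /min : `[< I `<=` ker i >] by rewrite ltnn.
  by apply/asboolP => y Iy; apply: contrapT => nk; apply: ny; exists y.
have sub j : (j <= i.+1)%N -> ker j `<=` I.
  elim: j => [_ z|j IH ji z zj]; first by rewrite /ker /= expr0 mul1r => ->; exact: ideal0.
  pose w := u ^+ (i - j) * y; have Iw : I w by exact: idealM.
  have [||c /(IH (ltnW ji)) Ic] := @kerS j w z _ _ zj.
  - by rewrite /ker /w /= mulrA -exprD (_ : j.+1 + (i - j) = i.+1)%N; [exact: Ii|lia].
  - by rewrite /ker /w /= mulrA -exprD (_ : j + (i - j) = i)%N; [exact: ny|lia].
  by rewrite -[z](subrK (c * w)); apply: idealD => //; exact: idealM.
exact: sub.
Qed.

End RankOne.

(** Multiplication by x is a linear form on Z/S with values in S, a line; its kernel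
has codimension at most one. *)
Lemma kernel2 x p1 p2 : m x -> Z p1 -> Z p2 -> ~ S p1 -> ~ adjoin S p1 p2 ->
  exists w a b, [/\ w = a * p1 + b * p2, ~ S w & x * w = 0].
Proof.
move=> mx Z1 Z2 n1 n2; have [xp|xp] := pselect (x * p1 = 0).
  by exists p1, 1, 0; split=> //; ring.
have [c cE] := socle_simple (Z1 x mx) xp (Z2 x mx).
exists (p2 - c * p1), (- c), 1; split; [ring| |by rewrite mulrBr cE; ring].
by move=> Sw; apply: n2; exists (p2 - c * p1), c; split=> //; ring.
Qed.

Lemma kernel3 x p1 p2 p3 : m x -> Z p1 -> Z p2 -> Z p3 -> ~ S p1 -> ~ adjoin S p1 p2 ->
  ~ adjoin (adjoin S p1) p2 p3 ->
  exists w1 w2, [/\ Z w1 /\ Z w2, ~ S w1, ~ adjoin S w1 w2, x * w1 = 0 & x * w2 = 0].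
Proof.
move=> mx Z1 Z2 Z3 n1 n2 n3.
have comb a b c : Z (a * p1 + b * p2 + c * p3).
  by apply: (idealD Z_ideal); [apply: (idealD Z_ideal)|]; apply: (idealM _ Z_ideal).
have [xp|xp] := pselect (x * p1 = 0).
  have [xp2|xp2] := pselect (x * p2 = 0); first by exists p1, p2.
  have [c cE] := socle_simple (Z2 x mx) xp2 (Z3 x mx).
  exists p1, (p3 - c * p2); split=> //; last by rewrite mulrBr cE; ring.
    by split=> //; rewrite (_ : _ - _ = 0 * p1 + (- c) * p2 + 1 * p3); [exact: comb|ring].
  by move=> Sw; apply: n3; exists (p3 - c * p2), c; split=> //; ring.
have [c cE] := socle_simple (Z1 x mx) xp (Z2 x mx).
have [c' cE'] := socle_simple (Z1 x mx) xp (Z3 x mx).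
exists (p2 - c * p1), (p3 - c' * p1); split.
- split; first by rewrite (_ : _ - _ = (- c) * p1 + 1 * p2 + 0 * p3); [exact: comb|ring].
  by rewrite (_ : _ - _ = (- c') * p1 + 0 * p2 + 1 * p3); [exact: comb|ring].
- by move=> Sw; apply: n2; exists (p2 - c * p1), c; split=> //; ring.
- move=> [s [d [Ss dE]]]; apply: n3; exists (s + (c' - d * c) * p1), d; split.
    by exists s, (c' - d * c).
  by rewrite -[p3](subrK (c' * p1)) dE; ring.
- by rewrite mulrBr cE; ring.
- by rewrite mulrBr cE'; ring.
Qed.

Lemma adjoin_scale B p a : is_ideal B -> adjoin B p (a * p).
Proof. by move=> iB; exists 0, a; rewrite add0r; split=> //; exact: ideal0. Qed.

Lemma Z_sub_m p1 p2 : Z p1 -> Z p2 -> ~ S p1 -> ~ adjoin S p1 p2 -> Z `<=` m.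
Proof.
move=> Z1 Z2 n1 n2; apply: sub_m; first exact: Z_ideal.
move=> Z1'; have mS' : m `<=` S by move=> a ma; rewrite -[a]mulr1; exact: Z1'.
have [u1|/mS' //] := pselect (is_unit p1).
by have [a ap1] := u1; apply: n2; rewrite -[p2]mulr1 -ap1 mulrA; apply: adjoin_scale S_ideal.
Qed.

(** If the factors found first generate the same ideal, change the second by an
element y of m outside this ideal. *)
Lemma distinct_factors p1 p2 : Z p1 -> Z p2 -> ~ S p1 -> ~ adjoin S p1 p2 ->
  exists x1 x2, [/\ m x1, m x2, x1 * x2 <> 0 & principal x1 <> principal x2].
Proof.
move=> Z1 Z2 n1 n2; have Zm := Z_sub_m Z1 Z2 n1 n2.
have [x2 m2 n12] := not_S n1; have m1' := Zm _ Z1.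
have x12 : p1 * x2 <> 0 by rewrite mulrC.
have [e12|] := pselect (principal p1 = principal x2); last by exists p1, x2.
have [y my ny] : exists2 y, m y & ~ principal p1 y.
  apply: contrapT => none.
  have [w [a [b [wE nw pw]]]] := kernel2 m1' Z1 Z2 n1 n2.
  apply: nw => c mc; have [d ->] : principal p1 c by apply: contrapT => nc; apply: none; exists c.
  by rewrite -mulrA pw mulr0.
have [py|py] := pselect (p1 * y = 0).
  exists p1, (x2 + y); split=> //; [exact: m_add|by rewrite mulrDr py addr0|].
  move=> e'; apply: ny; rewrite -[y](addKr x2); apply: idealD; first exact: principal_ideal.
    by rewrite -mulN1r; apply: idealM; [exact: principal_ideal|rewrite e12; exact: mem_principal].
  by rewrite e'; exact: mem_principal.
exists p1, y; split=> // e'; apply: ny; rewrite e'; exact: mem_principal.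
Qed.

Lemma line_in_Z w1 w2 c : Z w1 -> Z w2 -> Z (w1 + c * w2).
Proof. by move=> Z1 Z2; apply: (idealD Z_ideal Z1); exact: (idealM _ Z_ideal Z2). Qed.

Lemma nonzero_of_notin B x : is_ideal B -> ~ B x -> x <> 0.
Proof. by move=> iB nB x0; apply: nB; rewrite x0; exact: ideal0. Qed.

(** The lines Q of Z killed by x1 are killed by S and x1.  If infinitely many of them
are killed by x2 as well, these are three killers.  Otherwise each Q is joined
to R x2 through a line U killed by x2 and by Q, found in the kernel of two linear
forms on a space of dimension three. *)
Theorem no_independent_triple p1 p2 p3 : Z p1 -> Z p2 -> Z p3 -> ~ S p1 ->
  ~ adjoin S p1 p2 -> ~ adjoin (adjoin S p1) p2 p3 -> False.
Proof.
move=> Z1 Z2 Z3 n1 n2 n3; have Zm := Z_sub_m Z1 Z2 n1 n2; have [r rP] := r_exists.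
have [x1 [x2 [m1' m2 x12 ne12]]] := distinct_factors Z1 Z2 n1 n2.
have [w1 [w2 [[Zw1 Zw2] nw1 nw2 xw1 xw2]]] := kernel3 m1' Z1 Z2 Z3 n1 n2 n3.
pose q i := w1 + r i * w2; pose A := range (fun i => principal (q i)).
have nq i : ~ S (q i) by apply: (line_notin S_ideal nw1 nw2) => c; exact: Zw2.
have Zq i : Z (q i) by exact: line_in_Z.
have xq i : x1 * q i = 0 by rewrite mulrDr mulrCA xw1 xw2 mulr0 addr0.
have infA : infinite_set A.
  by apply: infinite_range; apply: (lines_inj S_ideal nw1 nw2 _ _ rP) => c; [exact: Zw1|exact: Zw2].
have nA I : A I -> nonzero_ideal I.
  by move=> [i _ <-]; apply: principal_nonzero; exact: nonzero_of_notin S_ideal (nq i).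
have n01 : nonzero_ideal (principal x1).
  by apply: principal_nonzero => e'; apply: x12; rewrite e' mul0r.
have n02 : nonzero_ideal (principal x2).
  by apply: principal_nonzero => e'; apply: x12; rewrite e' mulr0.
have S_neq x : m x -> (exists2 y, m y & x * y <> 0) -> S <> principal x.
  move=> mx [y my xy] e'; apply: xy; rewrite mulrC; apply: mS => //.
  by rewrite e'; exact: mem_principal.
have S1 : S <> principal x1 by apply: S_neq => //; exists x2.
have S2 : S <> principal x2 by apply: S_neq => //; exists x1 => //; rewrite mulrC.
have SA I : A I -> kills S I.
  move=> [i _ <-] x y Sx py; rewrite mulrC; apply: mS => //.
  exact: (principal_sub m_ideal (Zm _ (Zq i))).
have XA I : A I -> kills (principal x1) I by move=> [i _ <-]; exact: kills_principal.
pose A0 := A `&` [set I | kills (principal x2) I].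
have [fin0|inf0] := pselect (finite_set A0); last first.
  apply: (no_three_killers drawing inf0 (I0 := S) (I1 := principal x1) (I2 := principal x2)).
  - by move=> I [/nA].
  - by split=> //; exact: S_nonzero.
  - by split.
  - by move=> I [AI k]; split=> //; [exact: SA|exact: XA].
have inf1 : infinite_set (A `\` A0) by exact: infinite_setD.
have exU I : A I -> exists U, [/\ nonzero_ideal U, S <> U, kills U I & kills (principal x2) U].
  move=> [i _ <-].
  have [v1 [v2 [[Zv1 Zv2] nv1 nv2 xv1 xv2]]] := kernel3 m2 Z1 Z2 Z3 n1 n2 n3.
  have [w [a [b [wE nw qw]]]] := kernel2 (Zm _ (Zq i)) Zv1 Zv2 nv1 nv2.
  exists (principal w); split.
  - by apply: principal_nonzero; exact: nonzero_of_notin S_ideal nw.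
  - by move=> e'; apply: nw; rewrite e'; exact: mem_principal.
  - by apply: kills_principal; rewrite mulrC.
  - by apply: kills_principal; rewrite wE mulrDr !(mulrCA x2) xv1 xv2 !mulr0 addr0.
have /boolp.choice[U UP] I : exists U, A I -> [/\ nonzero_ideal U, S <> U, kills U I & kills (principal x2) U].
  by have [/exU[U UP]|] := pselect (A I); [exists U|exists S].
have notA0 I : (A `\` A0) I -> ~ kills (principal x2) I by move=> [AI nI k]; apply: nI.
apply: (no_subdivided_killers drawing (I0 := S) (I1 := principal x1) (I2 := principal x2) (U := U) inf1).
- by move=> I [AI _]; have [nU _ _ _] := UP I AI; split=> //; exact: nA.
- by split=> //; exact: S_nonzero.
- by split.
- by move=> I [AI _]; have [_ _ k1 k2] := UP I AI; split=> //; [exact: SA|exact: XA].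
- move=> I AI; have [_ SU k1 k2] := UP I (proj1 AI); split=> // e'.
    apply: x12; rewrite mulrC; apply: k2; [|rewrite -e']; exact: mem_principal.
  by apply: (notA0 I AI); rewrite e'.
- move=> I J AI AJ e'; apply: (notA0 J AJ); rewrite -e'.
  by have [] := UP I (proj1 AI).
Qed.

Section RankTwo.
Variables p1 p2 : R.
Hypotheses (Z1 : Z p1) (Z2 : Z p2) (n1 : ~ S p1) (n2 : ~ adjoin S p1 p2).

Let Zm : Z `<=` m := Z_sub_m Z1 Z2 n1 n2.

Lemma Z_span w1 w2 : Z w1 -> Z w2 -> ~ S w1 -> ~ adjoin S w1 w2 -> Z `<=` adjoin (adjoin S w1) w2.
Proof.
by move=> Zw1 Zw2 nw1 nw2 z Zz; apply: contrapT => nz; exact: no_independent_triple Zw1 Zw2 Zz nw1 nw2 nz.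
Qed.

(** A nonzero linear form on Z/S has a kernel of dimension one. *)
Lemma line_unique t V W : m t -> (exists2 z, Z z & t * z <> 0) ->
  nonzero_ideal V -> nonzero_ideal W -> V `<=` Z -> W `<=` Z -> V <> S -> W <> S ->
  (forall v, V v -> t * v = 0) -> (forall w, W w -> t * w = 0) -> V = W.
Proof.
move=> mt [z Zz tz].
suff sub V' W' : nonzero_ideal V' -> nonzero_ideal W' -> V' `<=` Z -> W' `<=` Z -> W' <> S ->
    (forall v, V' v -> t * v = 0) -> (forall w, W' w -> t * w = 0) -> V' `<=` W'.
  by move=> nV nW VZ WZ VS WS tV tW; apply/seteqP; split; exact: sub.
move=> nV nW VZ WZ WS tV tW v Vv; have [w Ww nw] := outside_S nW WS.
have iW := proj1 nW.
suff : adjoin S w v by apply: adjoin_sub => //; exact: S_min.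
apply: contrapT => nv; apply: tz.
have [b [a [[s [c [Ss bE]]] ->]]] := Z_span (WZ _ Ww) (VZ _ Vv) nw nv Zz.
rewrite bE (_ : _ * _ = t * s + c * (t * w) + a * (t * v)); last by ring.
by rewrite (tW _ Ww) (tV _ Vv) (mS mt Ss) !mulr0 !addr0.
Qed.

Lemma adj_proper I J : adj (AG R) I J -> I `<=` m.
Proof. by move=> /AG_adjP[[iI _] nJ _ k]; exact: proper_sub k. Qed.

Section CubeZero.
Hypothesis cube0 : forall a b c, m a -> m b -> m c -> a * b * c = 0.

(** Here m is contained in Z, and two ideals other than S that are killed by the same
one are equal by [line_unique]. *)
Lemma cube_zero_False : False.
Proof.
have mZ : m `<=` Z by move=> a ma b mb c mc; rewrite mulrA cube0.
apply: nonplanar; apply: (@one_pole_embeddable _ _ _ S pos) => //.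
move=> u v w uS vS wS uv uw.
have [/AG_adjP[nu nv _ kuv] /AG_adjP[_ nw _ kuw]] := (uv, uw).
have [t ut nt] := outside_S nu uS; have mt := adj_proper uv ut.
have [z mz zt] := not_S nt.
apply: (line_unique mt) => //.
- by exists z; [exact: mZ|rewrite mulrC].
- by move=> x /(adj_proper (adj_sym uv)); exact: mZ.
- by move=> x /(adj_proper (adj_sym uw)); exact: mZ.
- by move=> x vx; exact: kuv.
- by move=> x wx; exact: kuw.
Qed.

End CubeZero.

Section CubeNonzero.
Variables a0 b0 c0 : R.
Hypotheses (ma0 : m a0) (mb0 : m b0) (mc0 : m c0) (cube : a0 * b0 * c0 <> 0).
Local Notation J := (ideal_mul m m).

Lemma J_ideal : is_ideal J. Proof. exact: ideal_mul_ideal m_ideal m_ideal. Qed.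

Lemma J_nonzero : nonzero_ideal J.
Proof.
split; [exact: J_ideal|exists (a0 * b0); first exact: mem_ideal_mul].
by move=> ab; apply: cube; rewrite ab mul0r.
Qed.

Lemma J_kills_Z : kills J Z.
Proof.
move=> j z Jj Zz; move: j Jj; apply: (@ideal_mul_sub R m m (fun j => j * z = 0)).
  split=> [|x y|a x]; rewrite ?mul0r // ?mulrDl => e1; first by move=> e2; rewrite e1 e2 addr0.
  by rewrite -mulrA e1 mulr0.
by move=> x y mx my; rewrite -mulrA; apply: mS => //; exact: Zz.
Qed.

Lemma S_neq_J : S <> J.
Proof.
move=> SJ; apply: cube; rewrite mulrC; apply: (mS mc0); rewrite SJ; exact: mem_ideal_mul.
Qed.

Let lines_exist : exists A : set (set R), infinite_set A /\ forall I, A I -> nonzero_ideal I /\ I `<=` Z.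
Proof.
have [r rP] := r_exists; exists (range (fun i => principal (p1 + r i * p2))); split.
  by apply: infinite_range; apply: (lines_inj S_ideal n1 n2 _ _ rP) => c; [exact: Z1|exact: Z2].
move=> _ [i _ <-]; split; last exact: (principal_sub Z_ideal (line_in_Z _ Z1 Z2)).
apply: principal_nonzero; apply: (nonzero_of_notin S_ideal).
by apply: (line_notin S_ideal n1 n2) => c; exact: Z2.
Qed.

Lemma S_kills_Z : kills S Z.
Proof. by move=> x y Sx Zy; rewrite mulrC; apply: mS => //; exact: Zm. Qed.

(** Otherwise S, m^2 and m^3 kill the lines of Z. *)
Lemma cube_sub_S : ideal_mul m J `<=` S.
Proof.
apply: contrapT => nS; have [A [infA AP]] := lines_exist.
have iP : is_ideal (ideal_mul m J) := ideal_mul_ideal m_ideal J_ideal.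
have PJ : ideal_mul m J `<=` J by apply: ideal_mul_sub J_ideal _ => x y _; exact: idealM J_ideal.
apply: (no_three_killers drawing infA (I0 := S) (I1 := J) (I2 := ideal_mul m J)).
- by move=> I /AP[].
- split; [exact: S_nonzero|exact: J_nonzero|split=> //; exists (c0 * (a0 * b0)); last by rewrite mulrC].
  by apply: mem_ideal_mul => //; exact: mem_ideal_mul.
- split; [exact: S_neq_J|by move=> e'; apply: nS; rewrite -e'|].
  by have [x Jx nx] := nakayama noeth m_add J_nonzero => e'; apply: nx; rewrite -e'.
- move=> I /AP[_ IZ]; split=> x y.
  + by move=> Sx /IZ; exact: S_kills_Z.
  + by move=> Jx /IZ; exact: J_kills_Z.
  + by move=> /PJ Jx /IZ; exact: J_kills_Z.
Qed.

Lemma J_sub_Z : J `<=` Z.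
Proof. by move=> j Jj a ma; apply: cube_sub_S; exact: mem_ideal_mul. Qed.

(** Otherwise the lines of Z kill one another. *)
Lemma Z_square : exists z z', [/\ Z z, Z z' & z * z' <> 0].
Proof.
apply: contrapT => none; have [A [infA AP]] := lines_exist.
apply: (no_infinite_clique drawing infA) => [I /AP[]//|I I' /AP[_ IZ] /AP[_ IZ'] x y /IZ Zx /IZ' Zy].
by apply: contrapT => xy; apply: none; exists x, y.
Qed.

Lemma J_line j : J j -> ~ S j -> J `<=` adjoin S j.
Proof.
move=> Jj nj j' Jj'; apply: contrapT => nj'; have [z [z' [Zz Zz' zz]]] := Z_square.
apply: zz; apply: J_kills_Z Zz'.
suff : adjoin (adjoin S j) j' `<=` J by apply; exact: (Z_span (J_sub_Z Jj) (J_sub_Z Jj') nj nj').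
by do 2 (apply: adjoin_sub J_ideal _ _ => //); exact: S_min J_nonzero.
Qed.

Lemma Z_over_J w : Z w -> ~ J w -> Z `<=` adjoin J w.
Proof.
move=> Zw nw; have [j Jj nj] := outside_S J_nonzero (nesym S_neq_J).
have SJ := S_min J_nonzero.
have jJ : adjoin S j `<=` J by exact: adjoin_sub J_ideal SJ Jj.
have nw' : ~ adjoin S j w by move=> /jJ.
move=> z /(Z_span (J_sub_Z Jj) Zw nj nw')[b [a [/jJ Jb ->]]]; by exists b, a.
Qed.

(** Z is spanned by J and w, and J kills Z. *)
Lemma square_nonzero w : Z w -> ~ J w -> w * w <> 0.
Proof.
move=> Zw nw ww; have [z [z' [Zz Zz' zz]]] := Z_square; apply: zz.
have [j [a [Jj ->]]] := Z_over_J Zw nw Zz; have [j' [a' [Jj' ->]]] := Z_over_J Zw nw Zz'.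
have -> : (j + a * w) * (j' + a' * w) = j * (j' + a' * w) + a * (j' * w) + a * a' * (w * w) by ring.
rewrite (J_kills_Z Jj' Zw) ww (J_kills_Z Jj) ?mulr0 ?addr0 //.
by apply: (idealD Z_ideal); [exact: J_sub_Z|exact: (idealM _ Z_ideal Zw)].
Qed.

Lemma product_nonzero w w' : Z w -> Z w' -> ~ J w -> ~ J w' -> w * w' <> 0.
Proof.
move=> Zw Zw' nw nw' ww'; have [j [a [Jj e']]] := Z_over_J Zw nw Zw'.
have [ua|ma] := pselect (is_unit a).
  apply: (square_nonzero Zw nw); apply: (unit_cancel (zero_ideal R) ua).
  by move: ww'; rewrite e' mulrDr mulrC (J_kills_Z Jj Zw) add0r mulrCA.
apply: nw'; rewrite e'; apply: (idealD J_ideal Jj); apply: (S_min J_nonzero); exact: Zw.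
Qed.

Lemma J_span x a : m x -> m a -> ~ S (a * x) -> J `<=` adjoin S (a * x).
Proof. by move=> mx ma; apply: J_line; exact: mem_ideal_mul. Qed.

(** J is S plus the line of a x, and y does not kill J. *)
Lemma transversal_product x y : m x -> m y -> ~ Z x -> ~ Z y -> x * y <> 0.
Proof.
move=> mx my /not_Z[a ma nax] /not_Z[b mb /not_S[c mc cby]] xy; apply: cby.
have [s [d [Ss cb]]] := J_span mx ma nax (mem_ideal_mul mc mb).
rewrite mulrA cb mulrDl [s * y]mulrC (mS my Ss).
by rewrite add0r -!mulrA xy !mulr0.
Qed.

(** Z has codimension one in m: choose c such that a y and c a x agree modulo S. *)
Lemma transversal_mod x y : m x -> ~ Z x -> m y -> exists c, Z (y - c * x).
Proof.
move=> mx /not_Z[a ma nax] my; have [s [c [Ss ay]]] := J_span mx ma nax (mem_ideal_mul ma my).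
have Sa : S (a * (y - c * x)) by rewrite (_ : _ * _ = s) // mulrBr ay; ring.
exists c => b mb b' mb'.
have [s' [d [Ss' bb]]] := J_span mx ma nax (mem_ideal_mul mb' mb).
rewrite mulrA bb mulrDl.
have my' : m (y - c * x) by apply: (idealB m_ideal my); exact: (idealM _ m_ideal mx).
rewrite [s' * _]mulrC (mS my' Ss') add0r.
have -> : d * (a * x) * (y - c * x) = d * (x * (a * (y - c * x))) by ring.
by rewrite (mS mx Sa) mulr0.
Qed.

Definition side_edge (u v : set R) :=
  [/\ adj (AG R) u v, u <> S /\ u <> J & v <> S /\ v <> J].

Lemma side_edge_sym u v : side_edge u v -> side_edge v u.
Proof. by move=> [uv ? ?]; split=> //; exact: adj_sym. Qed.

Lemma outside_J I : nonzero_ideal I -> I <> S -> I <> J -> exists2 x, I x & ~ J x.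
Proof.
move=> nI IS IJ; apply: contrapT => none; apply: IJ.
have IsubJ : I `<=` J by move=> x Ix; apply: contrapT => nx; apply: none; exists x.
apply/seteqP; split=> // j Jj; have [x Ix nx] := outside_S nI IS.
apply: (adjoin_sub (proj1 nI) (S_min nI) Ix); exact: J_line (IsubJ _ Ix) nx _ Jj.
Qed.

Lemma side_edge_not_both u v : side_edge u v -> u `<=` Z -> ~ v `<=` Z.
Proof.
move=> [/AG_adjP[nu nv _ k] [uS uJ] [vS vJ]] uZ vZ.
have [x ux nx] := outside_J nu uS uJ; have [y vy ny] := outside_J nv vS vJ.
exact: product_nonzero (uZ _ ux) (vZ _ vy) nx ny (k _ _ ux vy).
Qed.

Lemma not_sub_Z I : ~ I `<=` Z -> exists2 x, I x & ~ Z x.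
Proof.
by move=> nIZ; apply: contrapT => none; apply: nIZ => x Ix; apply: contrapT => nx; apply: none; exists x.
Qed.

Lemma side_edge_some u v : side_edge u v -> ~ u `<=` Z -> v `<=` Z.
Proof.
move=> [uv _ _] /not_sub_Z[x ux nx]; apply: contrapT => /not_sub_Z[y vy ny].
have /AG_adjP[_ _ _ k] := uv.
exact: transversal_product (adj_proper uv ux) (adj_proper (adj_sym uv) vy) nx ny (k _ _ ux vy).
Qed.

(** If u is not inside Z, the ideals v and w are lines of Z killed by an element
outside Z.  If u is inside Z, the ideals v and w contain J and are spanned modulo
J by any of their elements outside Z. *)
Lemma side_matching u v w : side_edge u v -> side_edge u w -> v = w.
Proof.
move=> euv euw; have [uv [uS uJ] [vS vJ]] := euv; have [uw _ [wS wJ]] := euw.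
have [/AG_adjP[nu nv _ kuv] /AG_adjP[_ nw _ kuw]] := (uv, uw).
have [uZ|nuZ] := pselect (u `<=` Z); last first.
  have [t ut nt] := not_sub_Z nuZ; have mt := adj_proper uv ut.
  have [b mb /not_S[c mc cbt]] := not_Z nt.
  apply: (line_unique mt) => //.
  - exists (c * b); first by apply: J_sub_Z; exact: mem_ideal_mul.
    by rewrite mulrC -mulrA.
  - exact: side_edge_some euv nuZ.
  - exact: side_edge_some euw nuZ.
  - by move=> x vx; exact: kuv.
  - by move=> x wx; exact: kuw.
have [z uz nz] := outside_J nu uS uJ.
suff sub v' w' : side_edge u v' -> side_edge u w' -> w' `<=` v'.
  by apply/seteqP; split; exact: sub.
move=> euv' euw'; have [uv' _ _] := euv'; have [uw' _ _] := euw'.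
have [/AG_adjP[_ nv' _ kv'] /AG_adjP[_ nw' _ kw']] := (uv', uw').
have iv' := proj1 nv'.
have [x vx nx] := not_sub_Z (side_edge_not_both euv' uZ).
have mx := adj_proper (adj_sym uv') vx.
have [a ma nax] := not_Z nx.
have Jv : J `<=` v'.
  by move=> j /(J_span mx ma nax); apply: adjoin_sub => //; [exact: S_min|exact: idealM].
move=> y wy; have my := adj_proper (adj_sym uw') wy.
have [c Zyx] := transversal_mod mx nx my.
rewrite -[y](subrK (c * x)); apply: idealD => //; last exact: idealM.
apply: Jv; apply: contrapT => nJ; apply: (product_nonzero (uZ _ uz) Zyx nz nJ).
by rewrite mulrBr (kw' _ _ uz wy) mulrCA (kv' _ _ uz vx) mulr0 subrr.
Qed.

(** The ideals inside Z are neighbours of S and J, so they and their partners form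
triods. *)
Lemma side_countable : countable [set u | exists v, side_edge u v].
Proof.
pose Q : set (set R * set R) := [set q | side_edge q.1 q.2 /\ q.1 `<=` Z].
have cQ : countable Q.
  apply: (countable_triods drawing (a := fun b => if b then J else S) S_neq_J).
  - move=> [L N] [/= e1 LZ]; have [LN [LS LJ] [NS NJ]] := e1.
    have /AG_adjP[nL _ _ _] := LN; split=> // b; split; last by case: b; exact: nesym.
    apply/AG_adjP; case: b; split=> //; try exact/nesym.
    + exact: J_nonzero.
    + by move=> x y Jx /LZ; exact: J_kills_Z.
    + exact: S_nonzero.
    + by move=> x y Sx /LZ; exact: S_kills_Z.
  - move=> [L N] [L' N'] [/= e1 _] [/= e2 _] LL; rewrite -LL in e2 *.
    by rewrite (side_matching e1 e2).
  - move=> [L N] [L' N'] [/= e1 _] [/= e2 _] NN; rewrite -NN in e2 *.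
    by rewrite (side_matching (side_edge_sym e1) (side_edge_sym e2)).
  - move=> [L N] [L' N'] [/= e1 LZ] [/= e2 LZ'] NL.
    by apply: (side_edge_not_both e1 LZ); rewrite NL.
pose F (b : bool) := (fun q : set R * set R => if b then q.1 else q.2) @` Q.
apply: (@sub_countable _ _ _ (\bigcup_b F b)); last first.
  apply: bigcup_countable => [|b _]; first exact: countableP.
  exact: sub_countable (card_image_le _ _) cQ.
apply: subset_card_le => u [v uv].
have [uZ|nuZ] := pselect (u `<=` Z); first by exists true => //; exists (u, v).
exists false => //; exists (v, u) => //; split; first exact: side_edge_sym.
exact: side_edge_some uv nuZ.
Qed.

Lemma cube_nonzero_False : False.
Proof.
apply: nonplanar; apply: (two_poles_embeddable pos_inj); last exact: side_countable.
by move=> u v w; exact: side_matching.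
Qed.

End CubeNonzero.
End RankTwo.

Theorem nilpotent_False : False.
Proof.
have [q1 Z1 n1] := exists_layer2.
have [q2 Z2 n2] : exists2 q2, Z q2 & ~ adjoin S q1 q2.
  apply: contrapT => none; apply: (rank_one_finite Z1 n1) => z Zz.
  by apply: contrapT => nz; apply: none; exists z.
have [[a [b [c [ma mb mc abc]]]]|none] :=
    pselect (exists a b c, [/\ m a, m b, m c & a * b * c <> 0]).
  exact (cube_nonzero_False Z1 Z2 n1 n2 ma mb mc abc).
apply: cube_zero_False => a b c ma mb mc.
by apply: contrapT => abc; apply: none; exists a, b, c.
Qed.

End Nilpotent.

End LocalGraph.

(** * The theorem *)

Lemma artinian_of_finite (R : comNzRingType) : finite_set [set I : set R | is_ideal I] -> artinian R.
Proof.
move=> fin I iI desc; apply: contrapT => nostop.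
have /boolp.choice[next nextP] N : exists n, (N <= n)%N /\ I n <> I N.
  apply: contrapT => none; apply: nostop; exists N => n Nn.
  by apply: contrapT => ne; apply: none; exists n.
have sub j k : (j <= k)%N -> I k `<=` I j.
  move=> /subnKC <-; elim: (k - j)%N => [|d IH]; first by rewrite addn0.
  by rewrite addnS => x /desc; exact: IH.
pose f k := iter k next 0%N.
have f_mono j k : (j <= k)%N -> (f j <= f k)%N.
  move=> /subnKC <-; elim: (k - j)%N => [|d IH]; first by rewrite addn0.
  by rewrite addnS; apply: leq_trans IH _; have [] := nextP (f (j + d)%N).
have lt j k : (j < k)%N -> I (f j) <> I (f k).
  move=> jk eq_jk; have [le ne] := nextP (f j); apply: ne; apply/seteqP; split; first exact: sub.
  by rewrite eq_jk; apply: sub; exact: (f_mono j.+1 k jk).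
apply: (@infinite_range _ (I \o f)).
  by move=> j k /= e; case: (ltngtP j k) => // /lt; rewrite e.
by apply: sub_finite_set fin => _ [k _ <-]; exact: iI.
Qed.

Section Assembly.
Variables (K : realType) (R : comNzRingType) (g : nat).
Variables (pos : set R -> K * K * K) (edge : set R -> set R -> set (K * K * K)).
Hypothesis drawing : is_drawing (AG R) (@surface K g) pos edge.
Hypothesis noeth : noetherian R.
Hypothesis killed : forall I : set R, nonzero_ideal I -> ~ I 1 -> exists2 y, y <> 0 & annihilator I y.

(** The elements y1 and y2 killed by M1 and M2 generate three different ideals that
kill every ideal inside both M1 and M2. *)
Lemma nonlocal_finite (x y : R) : ~ is_unit x -> ~ is_unit y -> is_unit (x + y) ->
  finite_set [set I : set R | is_ideal I].
Proof.
move=> nx ny [c cxy].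
have nmul z : ~ is_unit z -> ~ is_unit (c * z) by move=> nz [d dz]; apply: nz; exists (d * c); rewrite -mulrA.
have one : c * x + c * y = 1 by rewrite -mulrDr.
have [M1 mM1 M1x] := exists_maximal noeth (nmul x nx).
have [M2 mM2 M2y] := exists_maximal noeth (nmul y ny).
have [iM1 M11 _] := mM1; have [iM2 M21 _] := mM2.
have cx0 : c * x <> 0.
  by move=> e; apply: (nmul y ny); exists 1; rewrite mul1r -one e add0r.
have cy0 : c * y <> 0.
  by move=> e; apply: (nmul x nx); exists 1; rewrite mul1r -one e addr0.
have [|y1 y10 S1] := killed (I := M1) _ M11; first by split=> //; exists (c * x).
have [|y2 y20 S2] := killed (I := M2) _ M21; first by split=> //; exists (c * y).
have apart z : annihilator M1 z -> annihilator M2 z -> z = 0.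
  by move=> z1 z2; rewrite -[z]mul1r -one mulrDl z1 // z2 // addr0.
have ny12 : ~ principal y2 y1.
  move=> p; apply: y10; apply: apart => //.
  by apply: (principal_sub (annihilator_ideal _) S2 p).
have ny21 : ~ principal y1 y2.
  move=> p; apply: y20; apply: apart => //.
  by apply: (principal_sub (annihilator_ideal _) S1 p).
apply: (finite_ideals_below mM1 mM2).
pose A := [set I : set R | nonzero_ideal I /\ I `<=` M1 `&` M2].
have finA : finite_set A.
  apply: contrapT => infA.
  apply: (no_three_killers drawing infA (I0 := principal y1) (I1 := principal y2) (I2 := adjoin (principal y1) y2)).
  - by move=> I [].
  - split; try exact: principal_nonzero.
    split; first exact: adjoin_ideal (principal_ideal _).
    by exists y2 => //; exact: mem_adjoin (principal_ideal _).
  - split=> e.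
    + by apply: ny12; rewrite -e; exact: mem_principal.
    + by apply: ny21; rewrite e; exact: mem_adjoin (principal_ideal _).
    + by apply: ny12; rewrite e; apply: sub_adjoin; exact: mem_principal.
  - move=> I [_ IM].
    have k1 : annihilator I y1 by move=> z /IM[z1 _]; exact: S1.
    have k2 : annihilator I y2 by move=> z /IM[_ z2]; exact: S2.
    have aI := annihilator_ideal I.
    split=> u v pu Iv; rewrite mulrC.
    + exact: (principal_sub aI k1 pu).
    + exact: (principal_sub aI k2 pu).
    + by apply: (adjoin_sub aI (principal_sub aI k1) k2 pu).
apply: (@sub_finite_set _ _ (A `|` [set [set 0]])); last by rewrite finite_setU; split.
move=> I [iI IM]; have [->|I0] := pselect (I = [set 0]); [by right|left].
by split=> //; exact: nonzero_idealP.
Qed.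

Theorem finitely_many_ideals : ~ embeddable K (AG R) 0 -> finite_set [set I : set R | is_ideal I].
Proof.
move=> nonplanar; apply: contrapT => inf.
have m_add (x y : R) : ~ is_unit x -> ~ is_unit y -> ~ is_unit (x + y).
  by move=> nx ny uxy; apply: inf; exact: nonlocal_finite nx ny uxy.
have [[e nil]|nonnil] := pselect (exists e, ideal_pow [set: R] e `<=` [set 0]).
  exact: (nilpotent_False drawing nonplanar noeth killed inf m_add nil).
apply: (not_nilpotent_False drawing nonplanar noeth killed inf m_add) => e nil.
by apply: nonnil; exists e.
Qed.

End Assembly.

Theorem corollary3p3 (K : realType) (R : comNzRingType)
    (R_noetherian : noetherian R)
    (ideals_verts : forall I : set R, is_ideal I ->
       I <> [set 0] -> I <> [set: R] -> verts (AG R) I)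
    (genus_pos_fin : exists n : nat, (0 < n)%N /\ has_genus K (AG R) n) :
  artinian R /\ finite_set [set I : set R | is_ideal I].
Proof.
have [n [n0 [[pos [edge drawing]] min]]] := genus_pos_fin.
suff fin : finite_set [set I : set R | is_ideal I] by split=> //; exact: artinian_of_finite.
apply: (finitely_many_ideals drawing R_noetherian); last first.
  by move=> /min; rewrite leqNgt n0.
move=> I nI I1; have [iI _] := nI.
have [|[_ [J [iJ J0 IJ]]] _] := ideals_verts I iI (nonzero_ideal_neq nI).
  by move=> IT; apply: I1; rewrite IT.
have [_ [y Jy y0]] := nonzero_idealP iJ J0.
by exists y => // x Ix; apply: (mul_kills IJ).
Qed.
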